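(* Let $\varphi : M^2 \to N^4 (\epsilon)$ be a non-CMC biconservative W-surface with flat normal bundle. Assume that $3 f^2 + K - \epsilon \neq 0$, $\nabla^\perp E_3 \neq 0$, $A_4 \neq 0$ and $\nabla_{E_2} E_2 \neq 0$ at any point. Then $M$ satisfies \[ \nabla _{E_2} E_2 = \frac 3 2 \frac{\dot f}{f} E_1 \] if and only if, locally, the functions $a_2,b_1,\alpha,k_2,K$ and the mean curvature function $f=f(s)$ are given by one of the following: a) \[ b_1 = \frac{\dot f \left( c_1^{-1} c_2 f - 3 \right)}{c_1^{-1/2} f^{3/2} \sqrt{2 c_2 - c_1^{-1} c_2^2 f - c_1^{-5} f^3}},\quad a_2=\frac32\frac{\dot f}{f},\quad \alpha=c_1^{-1/2} f^{3/2} \sqrt{2 c_2 - c_1^{-1} c_2^2 f - c_1^{-5} f^3}, \] \[ k_2=c_1^{-1}c_2f^2,\qquad K=\epsilon+c_1^{-6}f^6, \] where $c_1>0$, $c_2>0$ and $f$ is a positive solution of $\ddot f f - \frac 5 2 \dot f^2 - \frac 2 3 \epsilon f^2 - \frac 2 3 c_1^{-6} f^8 = 0$ such that $\dot f>0$; b) \[ b_1 = - \frac{\dot f (3 - c f)}{\sqrt c\, f^{3/2} \sqrt{2 - c f}},\quad a_2=\frac32\frac{\dot f}{f},\quad \alpha=\sqrt c\, f^{3/2}\sqrt{2-cf},\quad k_2=c f^2,\quad K=\epsilon, \] where $c>0$ and $f$ is a positive solution of $\ddot f f - \frac 5 2 \dot f^2 - \frac 2 3 \epsilon f^2=0$ such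 that $\dot f>0$; c) \[ b_1 = \frac{\dot f \left( c_1^{-1} c_2 f - 3 \right)}{c_1^{-1/2} f^{3/2} \sqrt{2 c_2 - c_1^{-1} c_2^2 f + c_1^{-5} f^3}},\quad a_2=\frac32\frac{\dot f}{f},\quad \alpha=c_1^{-1/2} f^{3/2} \sqrt{2 c_2 - c_1^{-1} c_2^2 f + c_1^{-5} f^3}, \] \[ k_2=c_1^{-1}c_2f^2,\qquad K=\epsilon-c_1^{-6}f^6, \] where $c_1>0$, $c_2\in\mathbb R$ and $f$ is a positive solution of $\ddot f f - \frac 5 2 \dot f^2 - \frac 2 3 \epsilon f^2 + \frac 2 3 c_1^{-6} f^8 = 0$ such that $\dot f>0$.
   Context: $N^4(\epsilon)$, $\epsilon\in\mathbb R$, is the 4-dimensional space form (complete, simply connected) of constant sectional curvature $\epsilon$. Manifolds are connected and immersions are isometric. For a surface $\varphi:M^2\to N^4(\epsilon)$: $B$ is the second fundamental form, $A_\eta$ the shape operator in the normal direction $\eta$, $\nabla$ the Levi-Civita connection, $\nabla^\perp$ the normal connection, $H=\frac12\operatorname{trace}B$, $f=|H|$ the mean curvature function, $K$ the Gaussian curvature. The surface has flat normal bundle if the curvature of $\nabla^\perp$ vanishes. It is biconservative if $2\operatorname{trace}A_{\nabla^\perp_{(\cdot)}H}(\cdot)+\operatorname{grad}|H|^2=0$. It is a W-surface if there is a smooth $W:\mathbb R^2\to\mathbb R$ with nowhere zero gradient such that $W(f,K)=0$ on $M$. ''Non-CMC biconservative'' means biconservative with $H\neq0$, $\operatorname{grad}f\neq0$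 and $A_{H/f}\neq f\,\mathrm{Id}$ at every point. Frame (all results are local; $M$ is taken to be a connected domain where the following is defined): $E_3=H/f$, $E_4$ is a unit normal section orthogonal to $E_3$, $A_3=A_{E_3}$, $A_4=A_{E_4}$, and $\{E_1,E_2\}$ is an orthonormal tangent frame with $A_3E_1=k_1E_1$, $A_3E_2=k_2E_2$. Flatness of the normal bundle gives $A_4E_1=\alpha E_1$, $A_4E_2=-\alpha E_2$ for a smooth function $\alpha$. The functions $a_i,b_i$ are defined by $\nabla_{E_1}E_1=-a_1E_2$, $\nabla_{E_2}E_2=a_2E_1$ and $b_i=\langle\nabla^\perp_{E_i}E_3,E_4\rangle$, $i=1,2$. Labelling convention: when $b_1b_2=0$ on $M$ and $\nabla^\perp E_3\neq0$ at every point (the first condition is automatic for the surfaces considered here), $E_1,E_2$ are labelled so that $b_1\neq0$ everywhere and $b_2=0$ on $M$. Sign convention: the signs of $E_1$ and $E_4$ are chosen so that $E_1(f)>0$ and $\alpha>0$ (then $E_1=\operatorname{grad}f/|\operatorname{grad}f|$). ''Locally'' means: around any point, in local coordinates $(s,t)$ in which the metric is $ds^2+g_{22}(s)dt^2$, $E_1=\partial/\partial s$, $E_2=g_{22}^{-1/2}\partial/\partial t$, and $f,k_1,k_2,\alpha,a_2,b_1,K$ depend only on $s$ (such coordinates exist for the surfaces considered here). The dot denotes $d/ds$, so $\dot f=E_1(f)$. *)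

(* Defs.v *)
From HB Require Import structures.
From mathcomp Require Export all_boot all_order all_algebra.
From mathcomp Require Export all_classical all_reals all_analysis.
Export Order.TTheory GRing.Theory Num.Theory.
Export numFieldNormedType.Exports.

#[export] Set Implicit Arguments.
#[export] Unset Strict Implicit.
#[export] Unset Printing Implicit Defensive.

Open Scope classical_set_scope.
Open Scope ring_scope.

(* [smooth_on U F] is the C^infinity condition; it is meant for open [U], on
   which [F] and all its iterated directional derivatives are differentiable. *)

Fixpoint smooth_upto (R : realType) (V W : normedModType R) (n : nat)
    (U : set V) (F : V -> W) : Prop :=
  (forall y, U y -> differentiable F y) /\
  (if n is m.+1 then forall v : V, smooth_upto m U (fun y => 'D_v F y)
   else True).

Definition smooth_on (R : realType) (V W : normedModType R)
    (U : set V) (F : V -> W) : Prop :=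
  forall n, smooth_upto n U F.

(** * Smooth surfaces *)

(* A chart is a homeomorphism between an open set of M and an open set of R^2;
   the values of [cmap] and [cinv] outside of these sets are irrelevant. *)
Record chart (R : realType) (M : topologicalType) := Chart {
  cdom : set M;
  cmap : M -> 'rV[R]_2;
  cinv : 'rV[R]_2 -> M;
  cdom_open : open cdom;
  cimg_open : open (cmap @` cdom);
  cmapK : forall p, cdom p -> cinv (cmap p) = p;
  cmap_continuous : forall p, cdom p -> {for p, continuous cmap};
  cinv_continuous : forall p, cdom p -> {for cmap p, continuous cinv} }.

Definition cimg (R : realType) (M : topologicalType) (c : chart R M) :
  set 'rV[R]_2 := cmap c @` cdom c.

Definition compatible (R : realType) (M : topologicalType) (c d : chart R M) :=
  smooth_on (cmap c @` (cdom c `&` cdom d)) (cmap d \o cinv c) /\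
  smooth_on (cmap d @` (cdom c `&` cdom d)) (cmap c \o cinv d).

Record surface (R : realType) := Surface {
  carrier :> topologicalType;
  surface_hausdorff : hausdorff_space carrier;
  surface_second_countable : @second_countable carrier;
  surface_connected : connected [set: carrier];
  atlas : set (chart R carrier);
  atlas_cover : forall p : carrier, exists2 c, atlas c & cdom c p;
  atlas_compatible : forall c d, atlas c -> atlas d -> compatible c d;
  atlas_maximal : forall c, (forall d, atlas d -> compatible c d) -> atlas c }.

(* [P] holds at (the coordinates of) every point in every chart. *)
Definition everywhere (R : realType) (M : surface R)
    (P : chart R M -> 'rV[R]_2 -> Prop) : Prop :=
  forall c, atlas c -> forall y, cimg c y -> P c y.

(* A vector field is given by its components in the charts, as a function of
   the coordinates, subject to the usual transformation rule. *)
Record vfield (R : realType) (M : surface R) := VField {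
  vcomp :> chart R M -> 'rV[R]_2 -> 'rV[R]_2;
  vcomp_smooth : forall c, atlas c -> smooth_on (cimg c) (vcomp c);
  vcomp_change : forall c d, atlas c -> atlas d ->
    forall p, cdom c p -> cdom d p ->
    'D_(vcomp c (cmap c p)) (cmap d \o cinv c) (cmap c p) = vcomp d (cmap d p) }.

(** * The space forms N^4(eps) *)

(* They are realized in R^5 as the hyperplane x_0 = 0 (eps = 0), the sphere of
   radius eps^(-1/2) (eps > 0) and a sheet of a hyperboloid in Minkowski space
   (eps < 0). In all cases the Levi-Civita connection of N^4(eps) at x is
   D_X Z + eps <X, Z> x, where D is the flat connection of R^5. *)
Definition sform (R : realType) (eps : R) (x y : 'rV[R]_5) : R :=
  \sum_(i < 5) (if (i == 0) && (eps < 0) then -1 else 1) * (x 0 i * y 0 i).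

Definition space_form (R : realType) (eps : R) : set 'rV[R]_5 :=
  [set x : 'rV[R]_5 | if eps == 0 then x 0 0 = 0
           else sform eps x x = eps^-1 /\ (eps < 0 -> 0 < x 0 0)].

Definition space_form_tangent (R : realType) (eps : R) (x : 'rV[R]_5) :
    set 'rV[R]_5 :=
  [set v : 'rV[R]_5 | if eps == 0 then v 0 0 = 0 else sform eps v x = 0].

(** * Geometry of a parametrized surface psi : R^2 -> N^4(eps) *)

(* Here [y] is a point of the parameter domain; tangent vectors are given by
   their components in the coordinate basis, [bas R 0] and [bas R 1]. *)

Definition bas (R : realType) (i : 'I_2) : 'rV[R]_2 := delta_mx 0 i.
Arguments bas : clear implicits.

Definition metric (R : realType) (eps : R) (psi : 'rV[R]_2 -> 'rV[R]_5)
    (y v w : 'rV[R]_2) : R :=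
  sform eps ('D_v psi y) ('D_w psi y).

Definition gram (R : realType) (eps : R) (psi : 'rV[R]_2 -> 'rV[R]_5)
    (y : 'rV[R]_2) : 'M[R]_2 :=
  \matrix_(i, j) metric eps psi y (bas R i) (bas R j).

Definition ginv (R : realType) (eps : R) (psi : 'rV[R]_2 -> 'rV[R]_5)
    (y : 'rV[R]_2) : 'M[R]_2 :=
  invmx (gram eps psi y).

(* The components of the covariant derivative of d/dy_j along d/dy_i. *)
Definition christoffel (R : realType) (eps : R) (psi : 'rV[R]_2 -> 'rV[R]_5)
    (y : 'rV[R]_2) (i j : 'I_2) : 'rV[R]_2 :=
  let g k l := fun z => gram eps psi z k l in
  2^-1 *: (\row_l ('D_(bas R i) (g j l) y + 'D_(bas R j) (g i l) y
                   - 'D_(bas R l) (g i j) y) *m ginv eps psi y).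

Definition nabla (R : realType) (eps : R) (psi : 'rV[R]_2 -> 'rV[R]_5)
    (v : 'rV[R]_2) (Y : 'rV[R]_2 -> 'rV[R]_2) (y : 'rV[R]_2) : 'rV[R]_2 :=
  'D_v Y y + \sum_i \sum_j (v 0 i * Y y 0 j) *: christoffel eps psi y i j.

Definition gauss_curv (R : realType) (eps : R) (psi : 'rV[R]_2 -> 'rV[R]_5)
    (y : 'rV[R]_2) : R :=
  let nb := nabla eps psi in
  let e i := fun _ : 'rV[R]_2 => bas R i in
  metric eps psi y
    (nb (bas R 0) (nb (bas R 1) (e 1)) y - nb (bas R 1) (nb (bas R 0) (e 1)) y)
    (bas R 0)
  / \det (gram eps psi y).

Definition gradient (R : realType) (eps : R) (psi : 'rV[R]_2 -> 'rV[R]_5)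
    (h : 'rV[R]_2 -> R) (y : 'rV[R]_2) : 'rV[R]_2 :=
  (\row_j 'D_(bas R j) h y) *m ginv eps psi y.

Definition ambient_nabla (R : realType) (eps : R)
    (psi : 'rV[R]_2 -> 'rV[R]_5) (v : 'rV[R]_2) (Z : 'rV[R]_2 -> 'rV[R]_5)
    (y : 'rV[R]_2) : 'rV[R]_5 :=
  'D_v Z y + (eps * sform eps ('D_v psi y) (Z y)) *: psi y.

(* Gauss formula, applied to the constant-coefficient extension of [w]. *)
Definition second_form (R : realType) (eps : R)
    (psi : 'rV[R]_2 -> 'rV[R]_5) (y v w : 'rV[R]_2) : 'rV[R]_5 :=
  ambient_nabla eps psi v (fun z => 'D_w psi z) y
  - 'D_(nabla eps psi v (fun=> w) y) psi y.

(* <A_eta v, w> = <B(v, w), eta> for all w. *)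
Definition shape (R : realType) (eps : R) (psi : 'rV[R]_2 -> 'rV[R]_5)
    (eta : 'rV[R]_5) (y v : 'rV[R]_2) : 'rV[R]_2 :=
  (\row_l sform eps (second_form eps psi y v (bas R l)) eta) *m ginv eps psi y.

(* Weingarten formula. *)
Definition normal_nabla (R : realType) (eps : R)
    (psi : 'rV[R]_2 -> 'rV[R]_5) (v : 'rV[R]_2) (eta : 'rV[R]_2 -> 'rV[R]_5)
    (y : 'rV[R]_2) : 'rV[R]_5 :=
  ambient_nabla eps psi v eta y + 'D_(shape eps psi (eta y) y v) psi y.

Definition mean_vec (R : realType) (eps : R) (psi : 'rV[R]_2 -> 'rV[R]_5)
    (y : 'rV[R]_2) : 'rV[R]_5 :=
  2^-1 *: \sum_i \sum_j
    ginv eps psi y i j *: second_form eps psi y (bas R i) (bas R j).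

Definition mean_curv (R : realType) (eps : R) (psi : 'rV[R]_2 -> 'rV[R]_5)
    (y : 'rV[R]_2) : R :=
  Num.sqrt (sform eps (mean_vec eps psi y) (mean_vec eps psi y)).

Definition is_normal (R : realType) (eps : R) (psi : 'rV[R]_2 -> 'rV[R]_5)
    (y : 'rV[R]_2) (eta : 'rV[R]_5) : Prop :=
  space_form_tangent eps (psi y) eta /\
  forall v, sform eps eta ('D_v psi y) = 0.

(** * Surfaces in N^4(eps) *)

Definition immersion (R : realType) (eps : R) (M : surface R)
    (phi : M -> 'rV[R]_5) : Prop :=
  [/\ forall p, space_form eps (phi p),
      forall c, atlas c -> smooth_on (cimg c) (phi \o cinv c) &
      everywhere (fun c y => forall v, 'D_v (phi \o cinv c) y = 0 -> v = 0)].

Definition normal_section (R : realType) (eps : R) (M : surface R)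
    (phi eta : M -> 'rV[R]_5) : Prop :=
  (forall c, atlas c -> smooth_on (cimg c) (eta \o cinv c)) /\
  everywhere (fun c y => is_normal eps (phi \o cinv c) y (eta (cinv c y))).

Definition flat_normal_bundle (R : realType) (eps : R) (M : surface R)
    (phi : M -> 'rV[R]_5) : Prop :=
  forall eta, normal_section eps phi eta ->
  everywhere (fun c y =>
    let nb := normal_nabla eps (phi \o cinv c) in
    let eta_c := eta \o cinv c in
    nb (bas R 0) (nb (bas R 1) eta_c) y
    - nb (bas R 1) (nb (bas R 0) eta_c) y = 0).

Definition biconservative (R : realType) (eps : R) (M : surface R)
    (phi : M -> 'rV[R]_5) : Prop :=
  everywhere (fun c y =>
    let psi := phi \o cinv c in
    2 *: (\sum_i \sum_j ginv eps psi y i j *: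
            shape eps psi (normal_nabla eps psi (bas R i) (mean_vec eps psi) y)
              y (bas R j))
    + gradient eps psi (fun z => mean_curv eps psi z ^+ 2) y = 0).

Definition nonCMC_biconservative (R : realType) (eps : R) (M : surface R)
    (phi : M -> 'rV[R]_5) : Prop :=
  biconservative eps phi /\
  everywhere (fun c y =>
    let psi := phi \o cinv c in
    let f := mean_curv eps psi in
    [/\ mean_vec eps psi y <> 0,
        gradient eps psi f y <> 0 &
        ~ (forall v, shape eps psi ((f y)^-1 *: mean_vec eps psi y) y v
                     = f y *: v)]).

Definition W_surface (R : realType) (eps : R) (M : surface R)
    (phi : M -> 'rV[R]_5) : Prop :=
  exists W : 'rV[R]_2 -> R,
    [/\ smooth_on setT W,
        forall x, exists v, 'D_v W x <> 0 &
        everywhere (fun c y =>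
          let psi := phi \o cinv c in
          W (\row_(i < 2) if i == 0 then mean_curv eps psi y
                          else gauss_curv eps psi y) = 0)].

(** * The adapted frame *)

Record frame (R : realType) (M : surface R) := Frame {
  E1 : vfield M;
  E2 : vfield M;
  E3 : M -> 'rV[R]_5;
  E4 : M -> 'rV[R]_5;
  k1 : M -> R;
  k2 : M -> R;
  alpha : M -> R;
  a1 : M -> R;
  a2 : M -> R;
  b1 : M -> R;
  b2 : M -> R }.

Definition adapted_frame (R : realType) (eps : R) (M : surface R)
    (phi : M -> 'rV[R]_5) (F : frame M) : Prop :=
  normal_section eps phi (E4 F) /\
  everywhere (fun c y =>
    let psi := phi \o cinv c in
    let p := cinv c y in
    let e1 := E1 F c y in
    let e2 := E2 F c y in
    let e3 := E3 F p in
    let e4 := E4 F p in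
    [/\ [/\ metric eps psi y e1 e1 = 1,
            metric eps psi y e2 e2 = 1 &
            metric eps psi y e1 e2 = 0],
        [/\ e3 = (mean_curv eps psi y)^-1 *: mean_vec eps psi y,
            sform eps e4 e4 = 1 &
            sform eps e3 e4 = 0],
        [/\ shape eps psi e3 y e1 = k1 F p *: e1,
            shape eps psi e3 y e2 = k2 F p *: e2,
            shape eps psi e4 y e1 = alpha F p *: e1 &
            shape eps psi e4 y e2 = - alpha F p *: e2],
        nabla eps psi e1 (E1 F c) y = - a1 F p *: e2 /\
        nabla eps psi e2 (E2 F c) y = a2 F p *: e1 &
        b1 F p = sform eps (normal_nabla eps psi e1 (E3 F \o cinv c) y) e4 /\
        b2 F p = sform eps (normal_nabla eps psi e2 (E3 F \o cinv c) y) e4]).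

Definition frame_labelling (R : realType) (M : surface R) (F : frame M) :=
  forall p : M, b1 F p <> 0 /\ b2 F p = 0.

Definition frame_signs (R : realType) (eps : R) (M : surface R)
    (phi : M -> 'rV[R]_5) (F : frame M) : Prop :=
  (forall p : M, 0 < alpha F p) /\
  everywhere (fun c y =>
    0 < 'D_(E1 F c y) (mean_curv eps (phi \o cinv c)) y).

(** * The local forms *)

Definition caseA (R : realType) (eps : R) (I : set R)
    (f a2 b1 alpha k2 K : R -> R) : Prop :=
  exists c1 c2 : R, [/\ 0 < c1, 0 < c2 & forall s, I s ->
    let r : R := Num.sqrt (2 * c2 - c1^-1 * c2 ^+ 2 * f s - c1 ^- 5 * f s ^+ 3) in
    [/\ b1 s = derive1 f s * (c1^-1 * c2 * f s - 3)
               / (c1 `^ (- (1 / 2)) * f s `^ (3 / 2) * r),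
        a2 s = 3 / 2 * (derive1 f s / f s) &
        alpha s = c1 `^ (- (1 / 2)) * f s `^ (3 / 2) * r] /\
    [/\ k2 s = c1^-1 * c2 * f s ^+ 2,
        K s = eps + c1 ^- 6 * f s ^+ 6,
        0 < f s,
        0 < derive1 f s &
        derive1n 2 f s * f s - 5 / 2 * derive1 f s ^+ 2 - 2 / 3 * eps * f s ^+ 2
          - 2 / 3 * c1 ^- 6 * f s ^+ 8 = 0]].

Definition caseB (R : realType) (eps : R) (I : set R)
    (f a2 b1 alpha k2 K : R -> R) : Prop :=
  exists c : R, 0 < c /\ forall s, I s ->
    let r : R := Num.sqrt (2 - c * f s) in
    [/\ b1 s = - (derive1 f s * (3 - c * f s)
                  / (Num.sqrt c * f s `^ (3 / 2) * r)),
        a2 s = 3 / 2 * (derive1 f s / f s) &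
        alpha s = Num.sqrt c * f s `^ (3 / 2) * r] /\
    [/\ k2 s = c * f s ^+ 2,
        K s = eps,
        0 < f s,
        0 < derive1 f s &
        derive1n 2 f s * f s - 5 / 2 * derive1 f s ^+ 2 - 2 / 3 * eps * f s ^+ 2 = 0].

Definition caseC (R : realType) (eps : R) (I : set R)
    (f a2 b1 alpha k2 K : R -> R) : Prop :=
  exists c1 c2 : R, 0 < c1 /\ forall s, I s ->
    let r : R := Num.sqrt (2 * c2 - c1^-1 * c2 ^+ 2 * f s + c1 ^- 5 * f s ^+ 3) in
    [/\ b1 s = derive1 f s * (c1^-1 * c2 * f s - 3)
               / (c1 `^ (- (1 / 2)) * f s `^ (3 / 2) * r),
        a2 s = 3 / 2 * (derive1 f s / f s) &
        alpha s = c1 `^ (- (1 / 2)) * f s `^ (3 / 2) * r] /\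
    [/\ k2 s = c1^-1 * c2 * f s ^+ 2,
        K s = eps - c1 ^- 6 * f s ^+ 6,
        0 < f s,
        0 < derive1 f s &
        derive1n 2 f s * f s - 5 / 2 * derive1 f s ^+ 2 - 2 / 3 * eps * f s ^+ 2
          + 2 / 3 * c1 ^- 6 * f s ^+ 8 = 0].

(* In the chart [c], with coordinates s = y 0 0 and t = y 0 1, the metric is
   ds^2 + g22(s) dt^2, E1 = d/ds, E2 = g22^(-1/2) d/dt, and the geometric
   quantities are the given functions of s. *)
Definition adapted_chart (R : realType) (eps : R) (M : surface R)
    (phi : M -> 'rV[R]_5) (F : frame M) (c : chart R M)
    (g22 f K fk1 fk2 falpha fa2 fb1 : R -> R) : Prop :=
  let psi := phi \o cinv c in
  forall y, cimg c y ->
    let s := y 0 0 in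
    let p := cinv c y in
    [/\ [/\ 0 < g22 s,
            metric eps psi y (bas R 0) (bas R 0) = 1,
            metric eps psi y (bas R 0) (bas R 1) = 0 &
            metric eps psi y (bas R 1) (bas R 1) = g22 s],
        E1 F c y = bas R 0 /\
        E2 F c y = (Num.sqrt (g22 s))^-1 *: bas R 1,
        mean_curv eps psi y = f s /\ gauss_curv eps psi y = K s,
        [/\ k1 F p = fk1 s, k2 F p = fk2 s & alpha F p = falpha s] &
        a2 F p = fa2 s /\ b1 F p = fb1 s].

(* Main.v *)
Require Import Defs.
From HB Require Import structures.
From mathcomp Require Import ring lra.

(** Seen in [R^5], the adapted frame [X1, X2, E3, E4] of the surface and its position
    vector satisfy linear differential equations whose coefficients are [k1], [k2],
    [alpha], [a1], [a2], [b1] ([X11E], [X12E], [X21E], [X22E], [derive_e3], [derive_e4]).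
    Symmetry of second derivatives turns them into the Gauss and Codazzi equations
    ([codazzi_gauss]); as [k1 + k2 = 2 f], the biconservative equation becomes
      (k1 + f) E1(f) + f b1 alpha = 0   and   (k2 + f) E2(f) = 0
    ([biconservative_equations]).

    Suppose [nabla_E2 E2 = 3/2 (E1(f) / f) E1], that is [a2 = 3/2 E1(f) / f]. If [E2(f)] did
    not vanish at a point, [k2 = - f] nearby, against Codazzi ([derive2_mean_curv]). Hence
    [E2(f) = 0], the Weingarten relation gives [E2(K) = 0], and with
    [K = eps + k1 k2 - alpha^2] and Codazzi this reads
    [a1 ((k2 - k1)^2 + 4 alpha^2) = 0], so that [a1 = 0] ([a1_eq0]). All the functions are then
    constant along [E2] and obey ordinary differential equations along [E1] ([frame_ode])
    with three first integrals ([frame_invariants])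
      C = k2 / f^2,   D = (alpha^2 + k2^2 - 2 k2 f) / f^6,
      lam = (a2^2 + k2^2 + alpha^2 + eps) / f^3.
    They express [k2], [alpha] and [K = eps - D f^6] through [f], [b1] follows from the
    biconservative equation, and [E1(a2) - a2^2 = K] is the differential equation of [f].
    The three local forms are the cases [D < 0], [D = 0] and [D > 0], with
    [c1^-6 = |D|] and [c2 = c1 C] ([local_forms]).

    The coordinates are obtained by quadratures. Along [E1], [f] satisfies an autonomous
    equation [E1(f)^2 = P(f)], and the primitive of [1 / sqrt P] evaluated at [f] is [s]
    ([coordinate_s]). Along [E2], every component of [X2] is a harmonic oscillator, and the
    same device applied to one component gives [t] with [E1(t) = 0] and [E2(t) = f^(3/2)]
    ([coordinate_t]). By the inverse function theorem [(s, t)] is a chart on a neighbourhood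
    whose image is a square ([adapted_coordinates]); it lies in the atlas because the
    atlas is maximal ([refine_chart]). On a square, vanishing of the second partial
    derivative means that only the first coordinate matters ([profile_eq]).

    Conversely [nabla_E2 E2 = a2 E1] in every chart, the local forms prescribe
    [a2 = 3/2 f' / f], and [f] and [E1(f)] do not depend on the chart
    ([mean_curv_change], [derive_mean_curv_change]). *)

(** * Differentiable maps *)

Section Differentiability.
Context {R : realType} {V W : normedModType R}.
Implicit Types (f g : V -> W) (x v : V).

Lemma differentiable_approx f x (e : R) : differentiable f x -> 0 < e ->
  \forall y \near x, `|f y - f x - 'd f x (y - x)| <= e * `|y - x|.
Proof.
move=> df e0; have [_ /eqaddoP/(_ e e0)] := (diff_locallyP x f).1 df.
rewrite (near_shift 0 x) subr0; apply: filterS => y /=.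
by rewrite addrK -[(_ - _) y]/(f (y + x) - (f x + 'd f x y)) opprD addrA.
Qed.

Lemma is_diff_approx f x (L : {linear V -> W}) : continuous L ->
  (forall e : R, 0 < e ->
     \forall y \near x, `|f y - f x - L (y - x)| <= e * `|y - x|) ->
  is_diff x f L.
Proof.
move=> cL H.
have E : f \o shift x = cst (f x) + L +o_ 0 id.
  apply/eqaddoP => e e0; move: (H e e0); rewrite (near_shift 0 x) subr0.
  apply: filterS => y /=.
  by rewrite addrK -[X in _ -> `|X| <= _]/(f (y + x) - (f x + L y)) opprD addrA.
have D := diff_unique cL E.
by apply: DiffDef => //; apply/diff_locallyP; rewrite D; split.
Qed.

(** The first order expansion of [f] at [x] is also one of [g]. *)
Lemma near_eq_differentiable f g x : (\near x, f x = g x) ->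
  differentiable f x -> differentiable g x.
Proof.
move=> fg df.
suff: is_diff x g ('d f x) by case.
apply: is_diff_approx => [|e e0]; first exact: diff_continuous.
have fgx := nbhs_singleton fg.
have := differentiable_approx df e0; apply: filterS2 fg => y fgy.
by rewrite fgy fgx.
Qed.

End Differentiability.

Section DerivativeRules.
Context {R : realType} {V W : normedModType R}.
Implicit Types (f g : V -> W) (h k : V -> R) (x v : V).

Lemma deriveD_fun f g x v : differentiable f x -> differentiable g x ->
  'D_v (fun y => f y + g y) x = 'D_v f x + 'D_v g x.
Proof. by move=> df dg; apply: deriveD; exact: diff_derivable. Qed.

Lemma deriveN_fun f x v : differentiable f x ->
  'D_v (fun y => - f y) x = - 'D_v f x.
Proof. by move=> df; apply: deriveN; exact: diff_derivable. Qed.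

Lemma deriveB_fun f g x v : differentiable f x -> differentiable g x ->
  'D_v (fun y => f y - g y) x = 'D_v f x - 'D_v g x.
Proof. by move=> df dg; apply: deriveB; exact: diff_derivable. Qed.

Lemma deriveM_fun h k x v : differentiable h x -> differentiable k x ->
  'D_v (fun y => h y * k y) x = h x * 'D_v k x + k x * 'D_v h x.
Proof. by move=> df dg; apply: deriveM; exact: diff_derivable. Qed.

Lemma derive_cstM (a : R) h x v : differentiable h x ->
  'D_v (fun y => a * h y) x = a * 'D_v h x.
Proof. by move=> dh; rewrite deriveM_fun// derive_cst mulr0 addr0. Qed.

Lemma derive_sum_fun n (F : 'I_n -> V -> W) x v :
  (forall i, differentiable (F i) x) ->
  'D_v (fun y => \sum_i F i y) x = \sum_i 'D_v (F i) x.
Proof.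
move=> dF.
rewrite (_ : (fun y => \sum_i F i y) = \sum_i F i); last first.
  by apply/funext => y; rewrite fct_sumE.
by rewrite derive_sum// => i; exact: diff_derivable.
Qed.

Lemma differentiable_sum_fun n (F : 'I_n -> V -> W) x :
  (forall i, differentiable (F i) x) ->
  differentiable (fun y => \sum_i F i y) x.
Proof.
move=> dF; rewrite (_ : (fun y => \sum_i F i y) = \sum_i F i).
  exact: differentiable_sum.
by apply/funext => y; rewrite fct_sumE.
Qed.

Lemma deriveV_fun h x v : h x != 0 -> differentiable h x ->
  'D_v (fun y => (h y)^-1) x = - (h x ^- 2 * 'D_v h x).
Proof. by move=> h0 dh; rewrite deriveV//; [exact: mulNr|exact: diff_derivable]. Qed.

Lemma derive_comp (X : normedModType R) (f : V -> W) (g : W -> X) x v :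
  differentiable f x -> differentiable g (f x) ->
  'D_v (fun y => g (f y)) x = 'D_('D_v f x) g (f x).
Proof.
move=> df dg; rewrite (deriveE _ dg) (deriveE _ df).
by rewrite (deriveE _ (differentiable_comp df dg)) diff_comp.
Qed.

Lemma derive_addv f x u v : differentiable f x ->
  'D_(u + v) f x = 'D_u f x + 'D_v f x.
Proof. by move=> df; rewrite !deriveE// linearD. Qed.

Lemma derive_subv f x u v : differentiable f x ->
  'D_(u - v) f x = 'D_u f x - 'D_v f x.
Proof. by move=> df; rewrite !deriveE// linearB. Qed.

Lemma derive_scalev f x (a : R) v : differentiable f x ->
  'D_(a *: v) f x = a *: 'D_v f x.
Proof. by move=> df; rewrite !deriveE// linearZ. Qed.

Lemma derive_sumv f x n (u : 'I_n -> V) : differentiable f x ->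
  'D_(\sum_i u i) f x = \sum_i 'D_(u i) f x.
Proof.
move=> df; rewrite deriveE// linear_sum; apply: eq_bigr => i _.
by rewrite deriveE.
Qed.

End DerivativeRules.

Section RowVectors.
Context {R : realType} {V W : normedModType R}.

Lemma derive_coord m (F : V -> 'rV[R]_m) x v i : differentiable F x ->
  ('D_v F x) 0 i = 'D_v (fun y => F y 0 i) x.
Proof. by move=> dF; rewrite derive_mx ?mxE//; exact: diff_derivable. Qed.

Lemma differentiable_rowP m (F : V -> 'rV[R]_m) x :
  differentiable F x <-> forall i, differentiable (fun y => F y 0 i) x.
Proof.
split=> [dF i|dF].
  exact: (differentiable_comp dF (differentiable_coord _ _ _)).
rewrite (_ : F = fun y => \sum_i F y 0 i *: delta_mx 0 i); last first.
  by apply/funext => y; rewrite -row_sum_delta.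
by apply: differentiable_sum_fun => i; apply: differentiableZl.
Qed.

Lemma derive_row m (F : 'rV[R]_m -> W) x v : differentiable F x ->
  'D_v F x = \sum_i v 0 i *: 'D_(delta_mx 0 i) F x.
Proof.
move=> dF; rewrite {1}(row_sum_delta v) derive_sumv//.
by apply: eq_bigr => i _; rewrite derive_scalev.
Qed.

Lemma derive_scale_row m (h : V -> R) (F : V -> 'rV[R]_m) x v :
  differentiable h x -> differentiable F x ->
  'D_v (fun y => h y *: F y) x = 'D_v h x *: F x + h x *: 'D_v F x.
Proof.
move=> dh dF; have dFi i := (differentiable_rowP F x).1 dF i.
have E i : (fun y => (h y *: F y) 0 i) = (fun y => h y * F y 0 i).
  by apply/funext => y; rewrite mxE.
have dM : differentiable (fun y => h y *: F y) x.
  by apply/differentiable_rowP => i; rewrite E; exact: differentiableM.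
apply/rowP => i; refine (etrans (derive_coord v i dM) _); rewrite E.
refine (etrans (deriveM_fun v dh (dFi i)) _); rewrite -(derive_coord v i dF) !mxE.
exact (etrans (addrC _ _) (congr1 (fun a => a + _) (mulrC _ _))).
Qed.

End RowVectors.

(** * Smooth maps *)

Section Smooth.
Context {R : realType} {V W : normedModType R}.
Implicit Types (U : set V) (f g : V -> W) (h k : V -> R).

Lemma smooth_upto_diff n U f : smooth_upto n U f ->
  forall y, U y -> differentiable f y.
Proof. by case: n => [|n] []. Qed.

Lemma smooth_on_diff U f : smooth_on U f ->
  forall y, U y -> differentiable f y.
Proof. by move=> sf; exact: smooth_upto_diff (sf 0). Qed.

Lemma smooth_on_derive U f v : smooth_on U f -> smooth_on U (fun y => 'D_v f y).
Proof. by move=> sf n; have [_] := sf n.+1; exact. Qed.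

Lemma smooth_onI U f : (forall y, U y -> differentiable f y) ->
  (forall v, smooth_on U (fun y => 'D_v f y)) -> smooth_on U f.
Proof. by move=> df sf [|n]; split=> // v; exact: sf. Qed.

Lemma smooth_uptoS n U f : smooth_upto n.+1 U f -> smooth_upto n U f.
Proof.
elim: n f => [|n IH] f [df sf]; split=> // v.
by apply: IH; exact: sf.
Qed.

Lemma smooth_upto_sub n U U' f : U' `<=` U ->
  smooth_upto n U f -> smooth_upto n U' f.
Proof.
move=> UU'; elim: n f => [|n IH] f [df sf]; split=> //; try by move=> y /UU'/df.
by move=> v; exact: IH (sf v).
Qed.

Lemma smooth_on_sub U U' f : U' `<=` U -> smooth_on U f -> smooth_on U' f.
Proof. by move=> s sf n; exact: smooth_upto_sub (sf n). Qed.

Lemma near_open U x : open U -> U x -> \near x, U x.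
Proof. by move=> oU Ux; apply: open_nbhs_nbhs. Qed.

Lemma eq_on_near U f g x : open U -> U x -> (forall y, U y -> f y = g y) ->
  \near x, f x = g x.
Proof. by move=> oU Ux fg; apply: filterS (near_open oU Ux) => y; exact: fg. Qed.

Lemma eq_on_derive U f g x v : open U -> U x ->
  (forall y, U y -> f y = g y) -> 'D_v f x = 'D_v g x.
Proof. by move=> oU Ux fg; apply: near_eq_derive; exact: eq_on_near fg. Qed.

Lemma eq_smooth_upto n U f g : open U -> (forall y, U y -> f y = g y) ->
  smooth_upto n U f -> smooth_upto n U g.
Proof.
move=> oU; elim: n f g => [|n IH] f g fg [df sf]; split=> //.
- by move=> y Uy; exact: near_eq_differentiable (eq_on_near oU Uy fg) (df y Uy).
- by move=> y Uy; exact: near_eq_differentiable (eq_on_near oU Uy fg) (df y Uy).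
- move=> v; by apply: IH (sf v) => y Uy; exact: eq_on_derive fg.
Qed.

Lemma eq_smooth_on U f g : open U -> (forall y, U y -> f y = g y) ->
  smooth_on U f -> smooth_on U g.
Proof. by move=> oU fg sf n; exact: eq_smooth_upto (sf n). Qed.

Lemma smooth_on_cst U (w : W) : smooth_on U (fun=> w).
Proof.
move=> n; elim: n w => [|n IH] w; split=> // v.
by under eq_fun do rewrite derive_cst; exact: IH.
Qed.

Lemma smooth_on_linear U (L : {linear V -> W}) : continuous L -> smooth_on U L.
Proof.
move=> cL; have dL y : differentiable L y by exact: linear_differentiable.
apply: smooth_onI => // v; under eq_fun do rewrite deriveE// diff_lin//.
exact: smooth_on_cst.
Qed.

Lemma smooth_uptoD n U f g : open U ->
  smooth_upto n U f -> smooth_upto n U g -> smooth_upto n U (fun y => f y + g y).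
Proof.
move=> oU; elim: n f g => [|n IH] f g [df sf] [dg sg].
  by split=> // y Uy; apply: differentiableD; [exact: df|exact: dg].
split=> [y Uy|v]; first by apply: differentiableD; [exact: df|exact: dg].
apply: eq_smooth_upto (IH _ _ (sf v) (sg v)) => // y Uy.
by rewrite deriveD_fun//; [exact: df|exact: dg].
Qed.

Lemma smooth_onD U f g : open U -> smooth_on U f -> smooth_on U g ->
  smooth_on U (fun y => f y + g y).
Proof. by move=> oU sf sg n; exact: smooth_uptoD. Qed.

Lemma smooth_onN U f : open U -> smooth_on U f -> smooth_on U (fun y => - f y).
Proof.
move=> oU + n; move=> /(_ n); elim: n f => [|n IH] f [df sf].
  by split=> // y Uy; apply: differentiableN; exact: df.
split=> [y Uy|v]; first by apply: differentiableN; exact: df.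
apply: eq_smooth_upto (IH _ (sf v)) => // y Uy.
by rewrite deriveN_fun//; exact: df.
Qed.

Lemma smooth_onB U f g : open U -> smooth_on U f -> smooth_on U g ->
  smooth_on U (fun y => f y - g y).
Proof. by move=> oU sf sg; apply: smooth_onD => //; exact: smooth_onN. Qed.

Lemma smooth_upto_sum n U m (F : 'I_m -> V -> W) : open U ->
  (forall i, smooth_upto n U (F i)) -> smooth_upto n U (fun y => \sum_i F i y).
Proof.
move=> oU; elim: n F => [|n IH] F sF.
  split=> // y Uy; apply: differentiable_sum_fun => i.
  exact: smooth_upto_diff (sF i) _ Uy.
split=> [y Uy|v].
  apply: differentiable_sum_fun => i; exact: smooth_upto_diff (sF i) _ Uy.
apply: (@eq_smooth_upto _ _ (fun y => \sum_i 'D_v (F i) y)) => // [y Uy|].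
  rewrite derive_sum_fun// => i; exact: smooth_upto_diff (sF i) _ Uy.
by apply: IH => i; have [_] := sF i; exact.
Qed.

Lemma smooth_on_sum U m (F : 'I_m -> V -> W) : open U ->
  (forall i, smooth_on U (F i)) -> smooth_on U (fun y => \sum_i F i y).
Proof. by move=> oU sF n; apply: smooth_upto_sum => // i; exact: sF. Qed.

End Smooth.

Section SmoothScalar.
Context {R : realType} {V : normedModType R}.
Implicit Types (U : set V) (h k : V -> R).

Lemma smooth_uptoM n U h k : open U ->
  smooth_upto n U h -> smooth_upto n U k -> smooth_upto n U (fun y => h y * k y).
Proof.
move=> oU; elim: n h k => [|n IH] h k sh sk; have [dh dsh] := sh; have [dk dsk] := sk.
  by split=> // y Uy; apply: differentiableM; [exact: dh|exact: dk].
split=> [y Uy|v]; first by apply: differentiableM; [exact: dh|exact: dk].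
apply: (@eq_smooth_upto _ _ _ _ _
  (fun y => h y * 'D_v k y + k y * 'D_v h y)) => // [y Uy|].
  by rewrite deriveM_fun//; [exact: dh|exact: dk].
apply: smooth_uptoD => //; apply: IH.
- exact: smooth_uptoS sh.
- exact: dsk.
- exact: smooth_uptoS sk.
- exact: dsh.
Qed.

Lemma smooth_onM U h k : open U -> smooth_on U h -> smooth_on U k ->
  smooth_on U (fun y => h y * k y).
Proof. by move=> oU sh sk n; exact: smooth_uptoM. Qed.

Lemma smooth_onX U h m : open U -> smooth_on U h ->
  smooth_on U (fun y => h y ^+ m).
Proof.
move=> oU sh; elim: m => [|m IH].
  by under eq_fun do rewrite expr0; exact: smooth_on_cst.
by under eq_fun do rewrite exprS; exact: smooth_onM.
Qed.

(** The derivative of an inverse is a polynomial in the inverse and in the derivative,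
    which makes the induction on the order of differentiability work. *)
Lemma smooth_onV U h : open U -> smooth_on U h -> (forall y, U y -> h y != 0) ->
  smooth_on U (fun y => (h y)^-1).
Proof.
move=> oU sh h0; elim=> [|n IH].
  by split=> // y Uy; apply: differentiableV; [exact: smooth_on_diff Uy|exact: h0].
split=> [y Uy|v].
  by apply: differentiableV; [exact: smooth_on_diff Uy|exact: h0].
apply: (@eq_smooth_upto _ _ _ _ _
  (fun y => - 1 * ((h y)^-1 * (h y)^-1 * 'D_v h y))) => // [y Uy|].
  rewrite deriveV_fun//; first by rewrite expr2 invfM mulN1r.
    exact: h0.
  exact: smooth_on_diff Uy.
apply: smooth_uptoM => //; first exact: smooth_on_cst.
apply: smooth_uptoM => //; last exact: smooth_on_derive.
exact: smooth_uptoM.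
Qed.

Lemma differentiable_sqrt (x : R) : 0 < x -> differentiable (@Num.sqrt R) x.
Proof.
move=> x0; apply/derivable1_diffP; have := is_derive1_sqrt x0.
by case.
Qed.

Lemma derive_sqrt_fun U h y v : smooth_on U h -> U y -> 0 < h y ->
  'D_v (fun z => Num.sqrt (h z)) y = (2 * Num.sqrt (h y))^-1 * 'D_v h y.
Proof.
move=> sh Uy hy; rewrite derive_comp; last 2 first.
- exact: smooth_on_diff Uy.
- exact: differentiable_sqrt.
rewrite -[X in 'D_X _ _]mulr1 derive_scalev; last exact: differentiable_sqrt.
rewrite derive_sqrt//; exact: mulrC.
Qed.

(** As for inverses: [2^-1 * sqrt h / h] only involves functions of lower order. *)
Lemma smooth_on_sqrt U h : open U -> smooth_on U h -> (forall y, U y -> 0 < h y) ->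
  smooth_on U (fun y => Num.sqrt (h y)).
Proof.
move=> oU sh h0.
have D y : U y -> differentiable (fun y => Num.sqrt (h y)) y.
  move=> Uy; apply: differentiable_comp; first exact: smooth_on_diff Uy.
  exact: differentiable_sqrt (h0 y Uy).
elim=> [|n IH]; split=> // v.
apply: (@eq_smooth_upto _ _ _ _ _
  (fun y => 2^-1 * ((h y)^-1 * Num.sqrt (h y)) * 'D_v h y)) => // [y Uy|].
  rewrite (derive_sqrt_fun _ sh Uy) ?h0// invfM; congr (_ * _ * _).
  have s0 : Num.sqrt (h y) != 0 by rewrite gt_eqF// sqrtr_gt0 h0.
  rewrite -[in (h y)^-1](@sqr_sqrtr _ (h y)) ?ltW ?h0//.
  by rewrite expr2 invfM mulfVK.
apply: smooth_uptoM => //; last exact: smooth_on_derive.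
apply: smooth_uptoM => //; first exact: smooth_on_cst.
apply: smooth_uptoM => //; apply: smooth_onV => // y Uy.
by rewrite gt_eqF// h0.
Qed.

End SmoothScalar.

Section SmoothRow.
Context {R : realType} {V : normedModType R}.
Implicit Types (U : set V).

Lemma smooth_upto_rowP n m U (F : V -> 'rV[R]_m) : open U ->
  smooth_upto n U F <-> forall i, smooth_upto n U (fun y => F y 0 i).
Proof.
move=> oU; elim: n F => [|n IH] F; split.
- by move=> [dF _] i; split=> // y /dF/differentiable_rowP.
- by move=> sF; split=> // y Uy; apply/differentiable_rowP => i; case: (sF i) => + _; exact.
- move=> [dF sF] i; split=> [y /dF/differentiable_rowP//|v].
  apply: eq_smooth_upto ((IH _).1 (sF v) i) => // y Uy.
  by rewrite derive_coord//; exact: dF.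
- move=> sF.
  have dF y : U y -> differentiable F y.
    by move=> Uy; apply/differentiable_rowP => i; case: (sF i) => + _; exact.
  split=> // v; apply/IH => i; have [_ /(_ v)] := sF i.
  by apply: eq_smooth_upto => // y Uy; rewrite derive_coord//; exact: dF.
Qed.

Lemma smooth_on_rowP m U (F : V -> 'rV[R]_m) : open U ->
  smooth_on U F <-> forall i, smooth_on U (fun y => F y 0 i).
Proof.
move=> oU; split=> [sF i n|sF n].
  exact: (smooth_upto_rowP n F oU).1 (sF n) i.
by apply/smooth_upto_rowP => // i; exact: sF.
Qed.

Lemma smooth_onZ m U (h : V -> R) (F : V -> 'rV[R]_m) : open U ->
  smooth_on U h -> smooth_on U F -> smooth_on U (fun y => h y *: F y).
Proof.
move=> oU sh sF; apply/smooth_on_rowP => // i.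
under eq_fun do rewrite mxE.
apply: smooth_onM => //; exact: (smooth_on_rowP F oU).1 sF i.
Qed.

End SmoothRow.

Section SmoothComp.
Context {R : realType} {V : normedModType R}.
Implicit Types (U : set V).

(** By the chain rule a derivative of [F \o G] is a combination of the compositions of the
    partial derivatives of [F] with [G], to which the induction applies. *)
Lemma smooth_upto_comp m n U (U' : set 'rV[R]_m) (F : 'rV[R]_m -> R) (G : V -> 'rV[R]_m) :
  open U -> smooth_on U' F -> smooth_upto n U G ->
  (forall y, U y -> U' (G y)) -> smooth_upto n U (fun y => F (G y)).
Proof.
move=> oU + + GU; elim: n F G GU => [|n IH] F G GU sF sG; have [dG dsG] := sG.
  split=> // y Uy; apply: differentiable_comp; first exact: dG.
  by apply: smooth_on_diff sF _ _; exact: GU.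
split=> [y Uy|v].
  apply: differentiable_comp; first exact: dG.
  by apply: smooth_on_diff sF _ _; exact: GU.
apply: (@eq_smooth_upto _ _ _ _ _
  (fun y => \sum_i ('D_v G y) 0 i * 'D_(delta_mx 0 i) F (G y))) => // [y Uy|].
  have dF : differentiable F (G y) by apply: smooth_on_diff sF _ _; exact: GU.
  by rewrite (derive_comp _ (dG y Uy) dF) derive_row.
apply: smooth_upto_sum => // i; apply: smooth_uptoM => //.
  exact: (smooth_upto_rowP n _ oU).1 (dsG v) i.
apply: (IH (fun z => 'D_(delta_mx 0 i) F z)) => //; first exact: smooth_on_derive.
exact: smooth_uptoS.
Qed.

Lemma smooth_on_comp m p U (U' : set 'rV[R]_m) (F : 'rV[R]_m -> 'rV[R]_p) (G : V -> 'rV[R]_m) :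
  open U -> open U' -> smooth_on U' F -> smooth_on U G ->
  (forall y, U y -> U' (G y)) -> smooth_on U (fun y => F (G y)).
Proof.
move=> oU oU' sF sG GU; apply/smooth_on_rowP => // i n.
apply: (smooth_upto_comp (U' := U') (F := fun z => F z 0 i)) => //.
exact: (smooth_on_rowP F oU').1 sF i.
Qed.

Lemma smooth_on_coord m (U : set 'rV[R]_m) (i : 'I_m) : 
  smooth_on U (fun y : 'rV[R]_m => y 0 i).
Proof.
apply: smooth_onI => [y _|v]; first exact: differentiable_coord.
under eq_fun do rewrite -(@derive_coord _ _ _ id)// derive_id.
exact: smooth_on_cst.
Qed.

End SmoothComp.

(** * Mean value theorem and symmetry of second derivatives *)

Section MeanValue.
Context {R : realType} {V : normedModType R}.
Implicit Types (U : set V) (h : V -> R) (x y v w : V).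

Lemma mean_value h x v :
  (forall t : R, 0 <= t <= 1 -> differentiable h (x + t *: v)) ->
  exists2 t : R, 0 < t < 1 & h (x + v) - h x = 'D_v h (x + t *: v).
Proof.
move=> dh; pose p (t : R) := x + t *: v.
have dZ (t : R) : differentiable (fun t : R => t *: v) t.
  exact: (@differentiableZl _ _ _ id).
have dp t : differentiable p t.
  by apply: differentiableD => //; exact: dZ.
have Dp t : 'D_1 p t = v.
  rewrite /p deriveD_fun//; rewrite derive_cst add0r deriveE; last exact: dZ.
  by rewrite (@diffZl _ _ _ id)//= diff_val scale1r.
have dhp (t : R) : 0 <= t <= 1 -> differentiable (h \o p) t.
  by move=> t01; apply: differentiable_comp => //; exact: dh.
have [||t] := @MVT _ (h \o p) (fun t => 'D_v h (p t)) 0 1 ltr01.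
- move=> t; rewrite in_itv /= => /andP[t0 t1].
  have t01 : 0 <= t <= 1 by rewrite !ltW.
  apply: DeriveDef; first exact/diff_derivable/dhp.
  by rewrite derive_comp ?Dp//; exact: dh.
- apply/continuous_in_subspaceT => t; rewrite inE /= in_itv /= => t01.
  exact/differentiable_continuous/dhp.
by rewrite in_itv /= => t01 E; exists t => //; move: E; rewrite /p/= scale1r scale0r addr0 subr0 mulr1.
Qed.

Lemma ball_segment (c : V) (r : R) x v (t : R) : ball c r x -> ball c r (x + v) ->
  0 <= t <= 1 -> ball c r (x + t *: v).
Proof.
rewrite -!ball_normE /= => cx cv /andP[t0 t1].
have -> : c - (x + t *: v) = (1 - t) *: (c - x) + t *: (c - (x + v)).
  by rewrite !opprD !addrA scalerBl scale1r (scalerBr t (c - x) v) addrA subrK.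
rewrite (le_lt_trans (ler_normD _ _))// !normrZ ger0_norm ?subr_ge0// ger0_norm//.
have [->|t0'] := eqVneq t 0; first by rewrite subr0 mul1r mul0r addr0.
have tp : 0 < t by rewrite lt_neqAle eq_sym t0'.
have : (1 - t) * `|c - x| <= (1 - t) * r by rewrite ler_wpM2l ?subr_ge0// ltW.
have : t * `|c - (x + v)| < t * r by rewrite ltr_pM2l.
lra.
Qed.

Lemma eq_on_ball h (c : V) (r : R) x y : ball c r x -> ball c r y ->
  (forall z, ball c r z -> differentiable h z /\ 'D_(y - x) h z = 0) -> h y = h x.
Proof.
move=> cx cy H; have cxy : ball c r (x + (y - x)) by rewrite subrKC.
have [t t01|t t01] := @mean_value h x (y - x).
  by apply: (H _ _).1; exact: ball_segment.
rewrite (H _ _).2 ?subrKC; first by move/eqP; rewrite subr_eq0 => /eqP.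
by apply: ball_segment => //; case/andP: t01 => t0 t1; rewrite !ltW.
Qed.

(** The mean value theorem along [v], applied to the difference of [h] in the direction
    [w], and then along [w]. *)
Lemma second_difference U h x v w (r t : R) : smooth_on U h -> ball x r `<=` U ->
  0 < t -> t * (`|v| + `|w|) < r ->
  exists2 p, ball x r p &
    h (x + t *: v + t *: w) - h (x + t *: v) - (h (x + t *: w) - h x)
    = t ^+ 2 * 'D_w (fun z => 'D_v h z) p.
Proof.
move=> sh xU t0 tr.
have inr (a b : R) : 0 <= a <= 1 -> 0 <= b <= 1 -> ball x r (x + a *: (t *: v) + b *: (t *: w)).
  move=> /andP[a0 a1] /andP[b0 b1].
  rewrite -ball_normE /= -addrA opprD addNKr normrN.
  rewrite (le_lt_trans (ler_normD _ _))// !normrZ !ger0_norm ?(ltW t0)//.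
  rewrite (le_lt_trans _ tr)// mulrDr lerD//; rewrite ler_piMl// mulr_ge0//; exact: ltW.
have dh (a b : R) : 0 <= a <= 1 -> 0 <= b <= 1 -> differentiable h (x + a *: (t *: v) + b *: (t *: w)).
  by move=> a01 b01; apply: (smooth_on_diff sh); exact/xU/inr.
have i01 : 0 <= (1 : R) <= 1 by rewrite lexx ler01.
have i00 : 0 <= (0 : R) <= 1 by rewrite lexx ler01.
pose g z := h (z + t *: w) - h z.
have dsh (a : R) : 0 <= a <= 1 -> differentiable (fun z => h (z + t *: w)) (x + a *: (t *: v)).
  move=> a01; apply: (@differentiable_comp _ _ _ _ (fun z => z + t *: w) h).
    by apply: differentiableD.
  by have := dh _ _ a01 i01; rewrite scale1r.
have dh0 (a : R) : 0 <= a <= 1 -> differentiable h (x + a *: (t *: v)).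
  by move=> a01; have := dh _ _ a01 i00; rewrite scale0r addr0.
have [a a01|a a01] := @mean_value g x (t *: v).
  by apply: differentiableB; [exact: dsh|exact: dh0].
rewrite {1}/g => ->.
have {}a01 : 0 <= a <= 1 by case/andP: a01 => ? ?; rewrite !ltW.
rewrite /g deriveB_fun; [|exact: dsh|exact: dh0].
rewrite derive_comp; last 2 first.
- by apply: differentiableD.
- by have := dh _ _ a01 i01; rewrite scale1r.
rewrite deriveD_fun// derive_id derive_cst addr0.
have dh1 : differentiable h (x + a *: (t *: v) + t *: w).
  by have := dh _ _ a01 i01; rewrite scale1r.
rewrite !derive_scalev//; last exact: dh0.
have [b b01|b b01 ] := @mean_value (fun z => 'D_v h z) (x + a *: (t *: v)) (t *: w).
  apply: (smooth_on_diff (smooth_on_derive v sh)); exact/xU/inr.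
have {}b01 : 0 <= b <= 1 by case/andP: b01 => ? ?; rewrite !ltW.
rewrite -scalerBr => ->; exists (x + a *: (t *: v) + b *: (t *: w)); first exact: inr.
rewrite derive_scalev; first by rewrite expr2 -mulrA.
by apply: (smooth_on_diff (smooth_on_derive v sh)); exact/xU/inr.
Qed.

(** Both iterated derivatives are limits of the same second difference quotient. *)
Lemma derive_comm U h x v w : open U -> smooth_on U h -> U x ->
  'D_v (fun z => 'D_w h z) x = 'D_w (fun z => 'D_v h z) x.
Proof.
move=> oU sh Ux; apply/eqP; rewrite -subr_eq0 -normr_le0; apply/ler_addgt0Pl => e e0.
rewrite addr0.
pose A z := 'D_v (fun z => 'D_w h z) z; pose B z := 'D_w (fun z => 'D_v h z) z.
have cA : {for x, continuous A}.
  apply/differentiable_continuous/(smooth_on_diff _ Ux).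
  by do 2 apply: smooth_on_derive.
have cB : {for x, continuous B}.
  apply/differentiable_continuous/(smooth_on_diff _ Ux).
  by do 2 apply: smooth_on_derive.
have e2 : 0 < e / 2 by rewrite divr_gt0.
have : \forall z \near x, [/\ U z, `|A x - A z| < e / 2 & `|B x - B z| < e / 2].
  have nA : \forall z \near x, `|A x - A z| < e / 2 by exact: (cvgrPdist_lt _ _).1 cA _ e2.
  have nB : \forall z \near x, `|B x - B z| < e / 2 by exact: (cvgrPdist_lt _ _).1 cB _ e2.
  by apply: filterS3 (near_open oU Ux) nA nB => z; split.
move=> /nbhs_ballP[r /= r0 xr].
have xU : ball x r `<=` U by move=> z /xr[].
have d0 : 0 < 2 * (`|v| + `|w| + 1).
  by rewrite mulr_gt0// addr_ge0_gt0// addr_ge0.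
pose t := r / (2 * (`|v| + `|w| + 1)).
have t0 : 0 < t by rewrite divr_gt0.
have tr : t * (`|v| + `|w|) < r.
  rewrite /t mulrAC ltr_pdivrMr// ltr_pM2l//.
  have := normr_ge0 v; have := normr_ge0 w; lra.
have [p /xr[_ _ Bp] Ep] := second_difference sh xU t0 tr.
have [q /xr[_ Aq _] Eq] : exists2 p, ball x r p &
    h (x + t *: w + t *: v) - h (x + t *: w) - (h (x + t *: v) - h x)
    = t ^+ 2 * 'D_v (fun z => 'D_w h z) p.
  by apply: second_difference; rewrite // addrC.
have {Ep Eq} : A q = B p.
  have t20 : t ^+ 2 != 0 by rewrite expf_neq0// gt_eqF.
  apply: (mulfI t20); apply: etrans (esym Eq) (etrans _ Ep).
  rewrite (addrAC x); move: (h _) (h _) (h _) (h _) => *; ring.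
rewrite -/(A x) -/(B x); move: (A x) (A q) (B x) (B p) Aq Bp => a a' b b' Ha Hb ab.
rewrite -(subrKA a' a) {2}ab -(opprB b).
by rewrite (le_trans (ler_normB _ _))// [leRHS]splitr lerD// ltW.
Qed.

End MeanValue.

(** * Derivatives along vector fields *)

Section Fields.
Context {R : realType} {m : nat}.
Implicit Types (U : set 'rV[R]_m) (h : 'rV[R]_m -> R) (e : 'rV[R]_m -> 'rV[R]_m).

Lemma smooth_on_field U e h : open U -> smooth_on U e -> smooth_on U h ->
  smooth_on U (fun z : 'rV[R]_m => 'D_(e z) h z).
Proof.
move=> oU se sh.
apply: (@eq_smooth_on _ _ _ _ (fun z : 'rV[R]_m => \sum_i e z 0 i * 'D_(delta_mx 0 i) h z)) => //.
  by move=> y Uy; rewrite (derive_row (e y))//; exact: (smooth_on_diff sh).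
apply: smooth_on_sum => // i; apply: smooth_onM => //.
  exact: (smooth_on_rowP e oU).1 se i.
exact: smooth_on_derive.
Qed.

Lemma derive_field U e h y v : open U -> smooth_on U e -> smooth_on U h -> U y ->
  'D_v (fun z : 'rV[R]_m => 'D_(e z) h z) y
  = 'D_v (fun z : 'rV[R]_m => 'D_(e y) h z) y + 'D_('D_v e y) h y.
Proof.
move=> oU se sh Uy.
have dh := smooth_on_diff sh Uy.
have dsh w : differentiable (fun z : 'rV[R]_m => 'D_w h z) y.
  exact: smooth_on_diff (smooth_on_derive w sh) _ Uy.
have de i : differentiable (fun z : 'rV[R]_m => e z 0 i) y.
  exact: smooth_on_diff ((smooth_on_rowP e oU).1 se i) _ Uy.
rewrite (@eq_on_derive _ _ _ U _ (fun z : 'rV[R]_m => \sum_i e z 0 i * 'D_(delta_mx 0 i) h z))//; last first.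
  by move=> z Uz; rewrite (derive_row (e z))//; exact: (smooth_on_diff sh).
rewrite [in RHS](@eq_on_derive _ _ _ U _ (fun z : 'rV[R]_m => \sum_i e y 0 i * 'D_(delta_mx 0 i) h z))//; last first.
  by move=> z Uz; rewrite (derive_row (e y))//; exact: (smooth_on_diff sh).
rewrite !derive_sum_fun; last 2 first.
- by move=> i; apply: differentiableM.
- by move=> i; apply: differentiableM.
rewrite (derive_row ('D_v e y))// -big_split/=; apply: eq_bigr => i _.
rewrite !deriveM_fun// derive_cst mulr0 addr0; congr (_ + _).
rewrite derive_coord; last exact: smooth_on_diff Uy.
exact: mulrC.
Qed.

(** Only the derivatives of the fields survive in a commutator, the second derivatives of
    [h] cancelling by symmetry. *)
Lemma derive_bracket U e e' h y : open U -> smooth_on U e -> smooth_on U e' ->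
  smooth_on U h -> U y ->
  'D_(e y) (fun z : 'rV[R]_m => 'D_(e' z) h z) y - 'D_(e' y) (fun z : 'rV[R]_m => 'D_(e z) h z) y
  = 'D_('D_(e y) e' y - 'D_(e' y) e y) h y.
Proof.
move=> oU se se' sh Uy; rewrite (derive_field _ oU se' sh Uy) (derive_field _ oU se sh Uy).
rewrite (derive_comm (e y) (e' y) oU sh Uy) derive_subv; last exact: (smooth_on_diff sh).
by rewrite opprD addrACA subrr add0r.
Qed.

Context {p : nat}.
Implicit Types F : 'rV[R]_m -> 'rV[R]_p.

Lemma smooth_on_field_row U e F : open U -> smooth_on U e -> smooth_on U F ->
  smooth_on U (fun z : 'rV[R]_m => 'D_(e z) F z).
Proof.
move=> oU se sF; apply/smooth_on_rowP => // i.
apply: (@eq_smooth_on _ _ _ _ (fun z : 'rV[R]_m => 'D_(e z) (fun x : 'rV[R]_m => F x 0 i) z)) => //.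
  by move=> y Uy; rewrite derive_coord//; exact: (smooth_on_diff sF).
by apply: smooth_on_field => //; exact: (smooth_on_rowP F oU).1 sF i.
Qed.

Lemma derive_coord_field U e F y v i : open U -> smooth_on U e -> smooth_on U F -> U y ->
  ('D_v (fun z : 'rV[R]_m => 'D_(e z) F z) y) 0 i
  = 'D_v (fun z : 'rV[R]_m => 'D_(e z) (fun x : 'rV[R]_m => F x 0 i) z) y.
Proof.
move=> oU se sF Uy.
rewrite derive_coord; last exact: (smooth_on_diff (smooth_on_field_row oU se sF)).
apply: (eq_on_derive _ oU Uy) => z Uz; rewrite derive_coord//.
exact: (smooth_on_diff sF).
Qed.

Lemma derive_field_row U e F y v : open U -> smooth_on U e -> smooth_on U F -> U y ->
  'D_v (fun z : 'rV[R]_m => 'D_(e z) F z) y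
  = 'D_v (fun z : 'rV[R]_m => 'D_(e y) F z) y + 'D_('D_v e y) F y.
Proof.
move=> oU se sF Uy; apply/rowP => i; rewrite mxE.
have sFi := (smooth_on_rowP F oU).1 sF i.
have sc w : smooth_on U (fun=> w : 'rV[R]_m) by exact: smooth_on_cst.
have E1 := derive_coord_field v i oU se sF Uy.
have E2 := derive_field v oU se sFi Uy.
have E3 := derive_coord_field v i oU (sc (e y)) sF Uy.
have E4 := derive_coord ('D_v e y) i (smooth_on_diff sF Uy).
apply: etrans E1 (etrans E2 _).
by congr (_ + _); [exact: esym E3|exact: esym E4].
Qed.

Lemma derive_comm_row U F x v w : open U -> smooth_on U F -> U x ->
  'D_v (fun z : 'rV[R]_m => 'D_w F z) x = 'D_w (fun z : 'rV[R]_m => 'D_v F z) x.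
Proof.
move=> oU sF Ux; apply/rowP => i.
have sFi := (smooth_on_rowP F oU).1 sF i.
have sc u : smooth_on U (fun=> u : 'rV[R]_m) by exact: smooth_on_cst.
have E1 := derive_coord_field v i oU (sc w) sF Ux.
have E2 := derive_coord_field w i oU (sc v) sF Ux.
have E3 := derive_comm v w oU sFi Ux.
exact: etrans E1 (etrans E3 (esym E2)).
Qed.

Lemma derive_bracket_row U e e' F y : open U -> smooth_on U e -> smooth_on U e' ->
  smooth_on U F -> U y ->
  'D_(e y) (fun z : 'rV[R]_m => 'D_(e' z) F z) y - 'D_(e' y) (fun z : 'rV[R]_m => 'D_(e z) F z) y
  = 'D_('D_(e y) e' y - 'D_(e' y) e y) F y.
Proof.
move=> oU se se' sF Uy; apply/rowP => i; rewrite mxE [in X in _ + X]mxE.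
have sFi := (smooth_on_rowP F oU).1 sF i.
have E1 := derive_coord_field (e y) i oU se' sF Uy.
have E2 := derive_coord_field (e' y) i oU se sF Uy.
have E3 := derive_bracket oU se se' sFi Uy.
have E4 := derive_coord ('D_(e y) e' y - 'D_(e' y) e y) i (smooth_on_diff sF Uy).
exact: etrans (congr2 (fun a b => a - b) E1 E2) (etrans E3 (esym E4)).
Qed.

End Fields.

(** * Primitives and estimates for row vectors *)

Section Primitive.
Context {R : realType}.

Lemma continuous_primitive (g : R -> R) (a u : R) : continuous g ->
  exists G : R -> R, forall x, a < x < u -> is_derive x 1 G (g x).
Proof.
move=> cg; exists (fun x => \int[lebesgue_measure]_(t in `[a, x]) g t) => x /andP[ax xu].
have ig : lebesgue_measure.-integrable `[a, u] (EFin \o g).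
  apply: continuous_compact_integrable; first exact: segment_compact.
  exact: continuous_subspaceT.
have [dG EG] := continuous_FTC1_closed xu ig ax (cg x).
by apply: DeriveDef; [exact: dG|exact: etrans (esym (derive1E _ _)) EG].
Qed.

Lemma primitive_inv_sqrt (P : R -> R) (x0 : R) : continuous P -> 0 < P x0 ->
  exists G : R -> R, exists2 r : R, 0 < r & forall x, ball x0 r x ->
    is_derive x 1 G (Num.sqrt (P x))^-1.
Proof.
move=> cP P0; pose Q x := Num.max (P x) (P x0 / 2).
have Q0 x : 0 < Q x by rewrite /Q lt_max divr_gt0// orbT.
have cQ : continuous Q.
  move=> x; apply: (@continuous_max _ _ P (cst (P x0 / 2))); first exact: cP.
  exact: cst_continuous.
have cg : continuous (fun x => (Num.sqrt (Q x))^-1).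
  move=> x; apply: cvgV; first by rewrite gt_eqF// sqrtr_gt0.
  apply: (@continuous_comp _ _ _ Q); first exact: cQ.
  exact: sqrt_continuous.
(* [Q] is [P] truncated from below, so that the integrand is continuous everywhere. *)
have [G dG] := @continuous_primitive _ (x0 - 1) (x0 + 1) cg.
have /nbhs_ballP[r /= r0 Hr] : \forall x \near x0, P x0 / 2 < P x.
  apply: (cvgr_gt (P x0) (cP x0)).
  by rewrite ltr_pdivrMr// ltr_pMr// ltr1n.
exists G, (Num.min r 1); first by rewrite lt_min r0 ltr01.
move=> x x0x; have /Hr Px : ball x0 r x.
  by apply: le_ball x0x; rewrite ge_min lexx.
have : ball x0 1 x by apply: le_ball x0x; rewrite ge_min lexx orbT.
rewrite -ball_normE /= ltr_distlC => /andP[x1 x2].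
have := dG x; rewrite /Q max_l ?ltW//; apply; lra.
Qed.

End Primitive.

Section RowNorm.
Context {R : realType}.

Lemma row_norm_le m (v : 'rV[R]_m) (c : R) : 0 <= c ->
  (`|v| <= c) = [forall i, `|v 0 i| <= c].
Proof.
move=> c0; rewrite [`|v|]mx_normrE; apply/idP/forallP => [H i|H].
  by apply: le_trans H; apply: (le_bigmax _ _ (0, i)).
by apply: bigmax_le => // -[a i] _ /=; rewrite (ord1 a).
Qed.

Lemma row_coord_le m (v : 'rV[R]_m) i : `|v 0 i| <= `|v|.
Proof. by have := row_norm_le v (normr_ge0 v); rewrite lexx => /esym/forallP. Qed.

Lemma mulmx_row_bound m p (M : 'M[R]_(m, p)) :
  exists2 k : R, 0 < k & forall v : 'rV[R]_m, `|v *m M| <= k * `|v|.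
Proof.
exists (\sum_i \sum_j `|M i j| + 1).
  by rewrite ltr_wpDl// sumr_ge0// => i _; rewrite sumr_ge0.
move=> v; rewrite row_norm_le; last first.
  by rewrite mulr_ge0// addr_ge0// sumr_ge0// => i _; rewrite sumr_ge0.
apply/forallP => j; rewrite mxE (le_trans (ler_norm_sum _ _ _))//.
rewrite mulrDl mul1r mulr_suml -[leLHS]addr0 lerD// ler_sum// => i _.
rewrite normrM mulrC ler_pM// ?row_coord_le// (bigD1 j)//= lerDl.
by rewrite sumr_ge0.
Qed.

Lemma continuous_mulmxr m p (M : 'M[R]_(m, p)) : continuous (mulmxr M : 'rV[R]_m -> 'rV[R]_p).
Proof.
move=> v; apply/differentiable_continuous/differentiable_rowP => j.
rewrite (_ : (fun y => _) = fun y : 'rV[R]_m => \sum_i y 0 i * M i j); last first.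
  by apply/funext => y; rewrite mxE.
by apply: differentiable_sum_fun => i; apply: differentiableM => //; exact: differentiable_coord.
Qed.

Lemma mean_value_bound m (h : 'rV[R]_m -> R) c r k x y :
  ball c r x -> ball c r y ->
  (forall z, ball c r z -> differentiable h z /\
     forall i, `|'D_(delta_mx 0 i) h z| <= k) -> 
  `|h y - h x| <= m%:R * k * `|y - x|.
Proof.
move=> cx cy H; have cxy : ball c r (x + (y - x)) by rewrite subrKC.
have [t t01|t t01] := @mean_value _ _ h x (y - x).
  by apply: (H _ _).1; exact: ball_segment.
have {}t01 : 0 <= t <= 1 by case/andP: t01 => ? ?; rewrite !ltW.
have [dh Hk] := H (x + t *: (y - x)) (ball_segment cx cxy t01).
rewrite subrKC => ->; rewrite (derive_row _ dh).
rewrite (le_trans (ler_norm_sum _ _ _))//.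
rewrite -mulrA mulr_natl -[X in _ *+ X]card_ord -sumr_const ler_sum// => i _.
by rewrite normrM mulrC ler_pM ?row_coord_le ?Hk.
Qed.

End RowNorm.

(** * The inverse function theorem *)

(* Rows are complete, as required by Banach's fixed point theorem. *)
HB.instance Definition _ (R : realType) (n : nat) := Complete.on 'rV[R]_n.+1.

Section MulmxDerive.
Context {R : realType} {V : normedModType R}.

Lemma derive_mulmxr m p (F : V -> 'rV[R]_m) (A : 'M[R]_(m, p)) y v :
  differentiable F y -> 'D_v (fun x => F x *m A) y = 'D_v F y *m A.
Proof.
move=> dF; have cA := @continuous_mulmxr R m p A.
have dA : differentiable (mulmxr A : 'rV[R]_m -> 'rV[R]_p) (F y).
  exact: linear_differentiable.
by rewrite (derive_comp v dF dA) (deriveE _ dA) diff_lin.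
Qed.

End MulmxDerive.

Section InverseFunction.
Context {R : realType} {n : nat}.
Local Notation E := 'rV[R]_n.+1.
Implicit Types (U : set E) (F G : E -> E) (Z : 'I_n.+1 -> E -> E).

(** Banach's fixed point theorem on a closed ball. *)
Lemma half_contraction_fixpoint (c : E) (r : R) (T : E -> E) : 0 < r ->
  (forall x, `|c - x| <= r -> `|c - T x| <= r) ->
  (forall x y, `|c - x| <= r -> `|c - y| <= r -> `|T x - T y| <= 2^-1 * `|x - y|) ->
  exists2 x, `|c - x| <= r & x = T x.
Proof.
move=> r0 TB TL; pose B : set E := closed_ball_ Num.Def.normr c r.
have TB' : {homo T : x / B x >-> B x} by move=> x; exact: TB.
pose TF : {fun B >-> B} := HB.pack T (isFun.Build _ _ B B T TB').
have [|||x Bx xT] := @banach_fixed_point R E B TF; last by exists x.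
- exists (2^-1)%:nng; split => /=; first by rewrite invf_lt1// ltr1n.
  by move=> [x y] [Bx By] /=; exact: TL.
- exact: closed_closed_ball_.
- by exists c; rewrite /B/= /closed_ball_/= subrr normr0 ltW.
Qed.

Definition field_mx Z (y : E) : 'M[R]_n.+1 := \matrix_i Z i y.

Definition jac F (y : E) : 'M[R]_n.+1 := \matrix_i 'D_(delta_mx 0 i) F y.

Lemma derive_jac F y v : differentiable F y -> 'D_v F y = v *m jac F y.
Proof.
move=> dF; rewrite derive_row// mulmx_sum_row; apply: eq_bigr => i _.
by rewrite rowK.
Qed.

Lemma field_mxE Z y v : v *m field_mx Z y = \sum_i v 0 i *: Z i y.
Proof. by rewrite mulmx_sum_row; apply: eq_bigr => i _; rewrite rowK. Qed.

Lemma jac_inverse F Z y : differentiable F y ->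
  (forall i, 'D_(Z i y) F y = delta_mx 0 i) -> jac F y *m field_mx Z y = 1%:M.
Proof.
move=> dF FZ; apply: mulmx1C; apply/row_matrixP => i.
by rewrite row_mul rowK -derive_jac// FZ row1.
Qed.

(** The fields [Z i], dual to the differential of [F], provide the inverse Jacobian matrix.
    With [A] its value at [y0], [F x = z] says that [x] is fixed by
    [x |-> z A + (x - F x A)], a contraction near [y0]. Since the derivatives of the inverse
    [G] are the [Z i (G z)], its smoothness propagates from each order to the next. *)
Lemma inverse_function U F Z y0 : open U -> U y0 -> smooth_on U F ->
  (forall i, smooth_on U (Z i)) ->
  (forall i y, U y -> 'D_(Z i y) F y = delta_mx 0 i) ->
  exists V G, exists2 r : R, 0 < r &
    [/\ [/\ open V, V `<=` U & V y0],
        forall y, V y -> ball (F y0) r (F y) /\ G (F y) = y,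
        forall z, ball (F y0) r z -> V (G z) /\ F (G z) = z &
        smooth_on (ball (F y0) r) G].
Proof.
move=> oU Uy0 sF sZ FZ.
have dF y : U y -> differentiable F y by exact: smooth_on_diff.
have JZ y : U y -> jac F y *m field_mx Z y = 1%:M.
  by move=> Uy; apply: jac_inverse => [|i]; [exact: dF|exact: FZ].
pose A := field_mx Z y0.
have [K K0 KA] := mulmx_row_bound A.
pose P x := F x *m A; pose h x := x - P x.
have sP : smooth_on U P.
  apply/smooth_on_rowP => // j.
  apply: (@eq_smooth_on _ _ _ _ (fun x => \sum_i F x 0 i * A i j)) => //.
    by move=> x _; rewrite mxE.
  apply: smooth_on_sum => // i; apply: smooth_onM => //; last exact: smooth_on_cst.
  exact: (smooth_on_rowP F oU).1 sF i.
have sh : smooth_on U h.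
  apply: smooth_onB => //; apply/smooth_on_rowP => // i; exact: smooth_on_coord.
have shj j : smooth_on U (fun x => h x 0 j) by exact: (smooth_on_rowP h oU).1 sh j.
have Dh0 i j : 'D_(delta_mx 0 i) (fun x => h x 0 j) y0 = 0.
  rewrite -derive_coord; last exact: smooth_on_diff Uy0.
  rewrite /h deriveB_fun//; last exact: smooth_on_diff Uy0.
  rewrite derive_id /P (derive_mulmxr _ _ (dF _ Uy0)) derive_jac; last exact: dF.
  by rewrite -mulmxA JZ// mulmx1 subrr mxE.
(* Partial derivatives of [h] below [k] make [h] Lipschitz with constant [1 / 2]. *)
pose k : R := (2 * n.+1%:R)^-1.
have k0 : 0 < k by rewrite invr_gt0 mulr_gt0.
have Dk : \forall x \near y0, forall ij : 'I_n.+1 * 'I_n.+1,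
    `|'D_(delta_mx 0 ij.1) (fun x => h x 0 ij.2) x| < k.
  apply: (filter_forall (nbhs_filter y0)) => -[i j] /=.
  have c : {for y0, continuous (fun x => 'D_(delta_mx 0 i) (fun x => h x 0 j) x)}.
    apply: differentiable_continuous.
    exact: smooth_on_diff (smooth_on_derive _ (shj j)) _ Uy0.
  have /cvgrPdist_lt/(_ k k0) := c; rewrite Dh0.
  by apply: filterS => x; rewrite sub0r normrN.
have /nbhs_ballP[rho /= rho0 Hrho] : nbhs y0 (U `&` [set x |
    forall ij : 'I_n.+1 * 'I_n.+1, `|'D_(delta_mx 0 ij.1) (fun x => h x 0 ij.2) x| < k]).
  exact: filterI (near_open oU Uy0) Dk.
have BU x : ball y0 rho x -> U x by move=> /Hrho[].
have hL x y : ball y0 rho x -> ball y0 rho y -> `|h y - h x| <= 2^-1 * `|y - x|.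
  move=> Bx By; rewrite row_norm_le; last by rewrite mulr_ge0// invr_ge0.
  apply/forallP => j.
  have := @mean_value_bound _ _ (fun x => h x 0 j) y0 rho k x y Bx By.
  have -> : n.+1%:R * k = 2^-1 by rewrite /k invfM mulrCA divff ?mulr1// pnatr_eq0.
  have -> : (h y - h x) 0 j = h y 0 j - h x 0 j by rewrite mxE [X in _ + X]mxE.
  apply.
  move=> z /Hrho[Uz Dz]; split; first exact: smooth_on_diff (shj j) _ Uz.
  by move=> i; rewrite ltW//; exact: (Dz (i, j)).
have FL x y : ball y0 rho x -> ball y0 rho y -> `|y - x| <= 2 * K * `|F y - F x|.
  move=> Bx By; have H := hL x y Bx By.
  have : `|y - x| <= `|P y - P x| + `|h y - h x|.
    rewrite (le_trans _ (ler_normD _ _))// /h.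
    by rewrite opprB addrACA subrKC addKr.
  have : `|P y - P x| <= K * `|F y - F x| by rewrite /P -mulmxBl.
  lra.
have r1 : 0 < rho / 2 by rewrite divr_gt0.
(* [z A] moves by at most [rho / 4] when [z] stays at distance [r] from [F y0]; the
   contraction accounts for another [rho / 4]. *)
pose r := rho / 4 / K.
have r0 : 0 < r by rewrite !divr_gt0.
pose V := [set x | ball y0 rho x /\ ball (F y0) r (F x)].
have VF z : ball (F y0) r z -> exists2 x, V x & F x = z.
  move=> Bz; pose T x := z *m A + h x.
  have inB x : `|y0 - x| <= rho / 2 -> ball y0 rho x.
    by rewrite -ball_normE /= => /le_lt_trans; apply; rewrite ltr_pdivrMr// ltr_pMr// ltr1n.
  have [x|x y|x xB xT] := @half_contraction_fixpoint y0 (rho / 2) T r1.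
  - move=> xB; have := hL _ _ (inB _ xB) (ballxx _ rho0); move: (xB).
    have -> : y0 - T x = (F y0 - z) *m A + (h y0 - h x).
      by rewrite mulmxBl -/(P y0) [h y0]/(y0 - P y0) addrACA subrKC -opprD.
    have : `|(F y0 - z) *m A| <= rho / 4.
      rewrite (le_trans (KA _))// mulrC -ler_pdivlMr// ltW//.
      by move: Bz; rewrite -ball_normE.
    have := ler_normD ((F y0 - z) *m A) (h y0 - h x); lra.
  - move=> xB yB; rewrite /T opprD addrACA subrr add0r.
    by apply: hL; exact: inB.
  - have Fx : F x = z.
      have : P x = z *m A by rewrite -[LHS](subKr x) {1}xT /T -/(h x) addrK.
      rewrite /P => /(congr1 (mulmx^~ (jac F y0))).
      by rewrite -!mulmxA (mulmx1C (JZ _ Uy0)) !mulmx1.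
    by exists x => //; split; [exact: inB|rewrite Fx].
pose G z := xget y0 [set x | V x /\ F x = z].
have GP z : ball (F y0) r z -> V (G z) /\ F (G z) = z.
  by move=> /VF[x Vx Fx]; apply: (@xgetPex _ y0 [set x | V x /\ F x = z]); exists x.
have GK y : V y -> ball (F y0) r (F y) /\ G (F y) = y.
  move=> [By BFy]; split=> //; have [[BG _] FG] := GP _ BFy.
  have := FL _ _ BG By; rewrite FG subrr normr0 mulr0 normr_le0 subr_eq0.
  by move/eqP.
have oV : open V.
  rewrite openE => x [Bx BFx].
  have nB : nbhs x (ball y0 rho) by apply: open_nbhs_nbhs; split; [exact: ball_open|].
  apply: filterI nB _; apply: (differentiable_continuous (dF _ (BU _ Bx))).
  by apply: open_nbhs_nbhs; split; [exact: ball_open|].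
have dG z : ball (F y0) r z -> is_diff z G (mulmxr (field_mx Z (G z))).
  move=> Bz; apply: is_diff_approx => [|e e0]; first exact: continuous_mulmxr.
  have [[BG BFG] FG] := GP z Bz.
  have UG := BU _ BG.
  have [K' K'0 KZ] := mulmx_row_bound (field_mx Z (G z)).
  pose e' := e / (K' * (2 * K)).
  have e'0 : 0 < e' by rewrite divr_gt0// !mulr_gt0.
  have /nbhs_ballP[d /= d0 Hd] := differentiable_approx (dF _ UG) e'0.
  have nB : \forall z' \near z, ball (F y0) r z'.
    by apply: open_nbhs_nbhs; split; [exact: ball_open|].
  have nd : \forall z' \near z, ball z (d / (2 * K)) z'.
    by apply: nbhsx_ballx; rewrite divr_gt0// mulr_gt0.
  apply: filterS2 nB nd => z' Bz' zz'.
  have [[BG' _] FG'] := GP z' Bz'.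
  have L := FL _ _ BG BG'; rewrite FG FG' in L.
  have /Hd : ball (G z) d (G z').
    rewrite -ball_normE /= distrC (le_lt_trans L)// mulrC -ltr_pdivlMr ?mulr_gt0//.
    by move: zz'; rewrite -ball_normE /= distrC.
  rewrite FG FG' -deriveE; last exact: dF.
  rewrite derive_jac; last exact: dF.
  move=> H; rewrite /mulmxr /=.
  have -> : G z' - G z - (z' - z) *m field_mx Z (G z)
     = - ((z' - z - (G z' - G z) *m jac F (G z)) *m field_mx Z (G z)).
    by rewrite [in RHS]mulmxBl -mulmxA JZ// mulmx1 opprB.
  rewrite normrN (le_trans (KZ _))//.
  rewrite (le_trans (ler_wpM2l (ltW K'0) H))//.
  rewrite (le_trans (ler_wpM2l (ltW K'0) (ler_wpM2l (ltW e'0) L)))//.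
  rewrite /e' le_eqVlt; apply/orP; left; apply/eqP; field.
  by rewrite !gt_eqF.
have dG' z : ball (F y0) r z -> differentiable G z by move=> /dG[].
have DG v z : ball (F y0) r z -> 'D_v G z = \sum_i v 0 i *: Z i (G z).
  move=> Bz; have [dGz EG] := dG z Bz.
  by rewrite (deriveE _ dGz) EG /= field_mxE.
have oB : open (ball (F y0) r) by exact: ball_open.
exists V, G, r => //; split=> //.
- by split=> // [y [/BU]//|]; split; exact: ballxx.
- elim=> [|m IH]; split=> // v.
  apply: (@eq_smooth_upto _ _ _ _ _ (fun z => \sum_i v 0 i *: Z i (G z))) => //.
    by move=> z Bz; rewrite DG.
  apply: smooth_upto_sum => // i; apply/smooth_upto_rowP => // j.
  apply: (@eq_smooth_upto _ _ _ _ _ (fun z => v 0 i * Z i (G z) 0 j)) => //.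
    by move=> z _; rewrite mxE.
  apply: smooth_uptoM => //; first exact: smooth_on_cst.
  apply: (smooth_upto_comp (U' := U) (F := fun x => Z i x 0 j)) => //.
    exact: (smooth_on_rowP (Z i) oU).1 (sZ i) j.
  by move=> z /GP[[/BU]].
Qed.

End InverseFunction.

(** * The bilinear form of the ambient space *)

Section Sform.
Context {R : realType} (eps : R).
Implicit Types x y z v w : 'rV[R]_5.
Local Notation sf := (sform eps).

Lemma sformC x y : sf x y = sf y x.
Proof. by apply: eq_bigr => i _; rewrite (mulrC (x 0 i)). Qed.

Lemma sformDl x y z : sf (x + y) z = sf x z + sf y z.
Proof. by rewrite -big_split/=; apply: eq_bigr => i _; rewrite mxE mulrDl mulrDr. Qed.

Lemma sformZl (a : R) x z : sf (a *: x) z = a * sf x z.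
Proof.
rewrite /sform mulr_sumr; apply: eq_bigr => i _.
by rewrite mxE -mulrA mulrCA.
Qed.

Lemma sformNl x z : sf (- x) z = - sf x z.
Proof. by rewrite -scaleN1r sformZl mulN1r. Qed.

Lemma sformBl x y z : sf (x - y) z = sf x z - sf y z.
Proof. by rewrite sformDl sformNl. Qed.

Lemma sformDr x y z : sf z (x + y) = sf z x + sf z y.
Proof. by rewrite !(sformC z) sformDl. Qed.

Lemma sformZr (a : R) x z : sf z (a *: x) = a * sf z x.
Proof. by rewrite !(sformC z) sformZl. Qed.

Lemma sformNr x z : sf z (- x) = - sf z x.
Proof. by rewrite !(sformC z) sformNl. Qed.

Lemma sformBr x y z : sf z (x - y) = sf z x - sf z y.
Proof. by rewrite !(sformC z) sformBl. Qed.

Lemma sform0l z : sf 0 z = 0.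
Proof. by rewrite -(scale0r 0) sformZl mul0r. Qed.

Lemma sform0r z : sf z 0 = 0.
Proof. by rewrite sformC sform0l. Qed.

Lemma sform_suml n (F : 'I_n -> 'rV[R]_5) z : sf (\sum_i F i) z = \sum_i sf (F i) z.
Proof. by apply: (big_morph (sf^~ z)) => [x y|]; rewrite ?sformDl ?sform0l. Qed.

Lemma sform_sumr n (F : 'I_n -> 'rV[R]_5) z : sf z (\sum_i F i) = \sum_i sf z (F i).
Proof. by rewrite sformC sform_suml; apply: eq_bigr => i _; rewrite sformC. Qed.

Definition sformE := (sformDl, sformBl, sformNl, sformZl, sformDr, sformBr, sformNr, sformZr).

(** Spans the orthogonal complement in [R^5] of the tangent space of the space form. *)
Definition conormal x : 'rV[R]_5 := if eps == 0 then delta_mx 0 0 else x.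

Lemma tangentP x v : space_form_tangent eps x v <-> sf v (conormal x) = 0.
Proof.
rewrite /space_form_tangent /conormal /=; case: eqP => // e0.
rewrite /sform e0 ltxx (bigD1 0)//= big1 ?addr0 => [|i i0]; last first.
  by rewrite !mxE eqxx (negbTE i0) !mulr0.
by rewrite !mxE !eqxx mul1r mulr1.
Qed.

Lemma conormal_neq0 x : space_form eps x -> sf (conormal x) (conormal x) != 0.
Proof.
rewrite /space_form /conormal /=; case: eqP => [e0 _|/eqP e0 [-> _]]; last by rewrite invr_neq0.
rewrite /sform e0 ltxx (bigD1 0)//= big1 ?addr0 => [|i i0]; last first.
  by rewrite !mxE eqxx (negbTE i0) !mulr0.
by rewrite !mxE !eqxx !mulr1 oner_neq0.
Qed.

Lemma tangent_position x v : space_form_tangent eps x v -> eps * sf v x = 0.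
Proof. by rewrite /space_form_tangent /=; case: eqP => [-> _|_ ->]; rewrite ?mul0r ?mulr0. Qed.

(** Five orthogonal vectors, none of them isotropic, form a basis: their Gram matrix is
    diagonal and invertible. The form may be indefinite. *)
Lemma sform_nondegenerate (f : 'I_5 -> 'rV[R]_5) v :
  (forall i j, i != j -> sf (f i) (f j) = 0) -> (forall i, sf (f i) (f i) != 0) ->
  (forall i, sf v (f i) = 0) -> v = 0.
Proof.
move=> f0 fn vf.
pose s (i : 'I_5) : R := if (i == 0) && (eps < 0) then -1 else 1.
pose P := \matrix_i f i; pose J := diag_mx (\row_i s i).
have E (w : 'rV[R]_5) i : (w *m (J *m P^T)) 0 i = sf w (f i).
  rewrite mulmxA mxE; apply: eq_bigr => k _.
  by rewrite mul_mx_diag !mxE mulrAC mulrA mulrC mulrA.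
have PJP : P *m (J *m P^T) = diag_mx (\row_i sf (f i) (f i)).
  apply/matrixP => i j; transitivity ((row i (P *m (J *m P^T))) 0 j).
    by rewrite [RHS]mxE.
  rewrite row_mul E rowK !mxE.
  by have [->|ij] := eqVneq i j; rewrite ?mulr1n// f0// mulr0n.
have uJ : J *m P^T \in unitmx.
  have : P *m (J *m P^T) \in unitmx.
    rewrite PJP unitmxE det_diag unitfE; apply/prodf_neq0 => i _.
    by rewrite mxE fn.
  by rewrite unitmx_mul => /andP[].
apply: (can_inj (mulmxK uJ)); rewrite mul0mx; apply/rowP => i.
by rewrite E vf mxE.
Qed.

(** An orthonormal family of four tangent vectors is completed into an orthogonal basis of
    [R^5] by the conormal. *)
Lemma tangent_frame_eq0 x f1 f2 f3 f4 v : space_form eps x ->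
  [/\ space_form_tangent eps x f1, space_form_tangent eps x f2,
      space_form_tangent eps x f3, space_form_tangent eps x f4 &
      space_form_tangent eps x v] ->
  [/\ sf f1 f1 = 1, sf f2 f2 = 1, sf f3 f3 = 1 & sf f4 f4 = 1] ->
  [/\ sf f1 f2 = 0, sf f1 f3 = 0 & sf f1 f4 = 0] ->
  [/\ sf f2 f3 = 0, sf f2 f4 = 0 & sf f3 f4 = 0] ->
  [/\ sf v f1 = 0, sf v f2 = 0, sf v f3 = 0 & sf v f4 = 0] -> v = 0.
Proof.
move=> xS [/tangentP t1 /tangentP t2 /tangentP t3 /tangentP t4 /tangentP tv].
move=> [n1 n2 n3 n4] [f12 f13 f14] [f23 f24 f34] [v1 v2 v3 v4].
pose f (i : 'I_5) := nth 0 [:: f1; f2; f3; f4; conormal x] i.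
have N0 := conormal_neq0 xS.
apply: (@sform_nondegenerate f) => [i j ij|i|i]; rewrite /f.
- case: i j ij => [[|[|[|[|[|//]]]]] ?] [[|[|[|[|[|//]]]]] ?] // _ /=;
    by rewrite // sformC.
- by case: i => [[|[|[|[|[|//]]]]] ?] /=; rewrite ?n1 ?n2 ?n3 ?n4 ?oner_neq0.
- by case: i => [[|[|[|[|[|//]]]]] ?] /=.
Qed.

Lemma tangent_expand x f1 f2 f3 f4 v : space_form eps x ->
  [/\ space_form_tangent eps x f1, space_form_tangent eps x f2,
      space_form_tangent eps x f3, space_form_tangent eps x f4 &
      space_form_tangent eps x v] ->
  [/\ sf f1 f1 = 1, sf f2 f2 = 1, sf f3 f3 = 1 & sf f4 f4 = 1] ->
  [/\ sf f1 f2 = 0, sf f1 f3 = 0 & sf f1 f4 = 0] ->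
  [/\ sf f2 f3 = 0, sf f2 f4 = 0 & sf f3 f4 = 0] ->
  v = sf v f1 *: f1 + sf v f2 *: f2 + sf v f3 *: f3 + sf v f4 *: f4.
Proof.
move=> xS [t1 t2 t3 t4 tv] fn [f12 f13 f14] [f23 f24 f34].
apply/eqP; rewrite -subr_eq0; apply/eqP.
apply: (@tangent_frame_eq0 x f1 f2 f3 f4) => //.
- split=> //; apply/tangentP; rewrite !sformE.
  move: t1 t2 t3 t4 tv => /tangentP-> /tangentP-> /tangentP-> /tangentP-> /tangentP->.
  by rewrite !mulr0 !addr0 subr0.
- case: fn => n1 n2 n3 n4; rewrite !sformE n1 n2 n3 n4.
  rewrite ![sf f2 f1]sformC ![sf f3 f1]sformC ![sf f4 f1]sformC.
  rewrite ![sf f3 f2]sformC ![sf f4 f2]sformC ![sf f4 f3]sformC f12 f13 f14 f23 f24 f34.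
  by split; ring.
Qed.

End Sform.

Section SformCalculus.
Context {R : realType} (eps : R) {V : normedModType R}.
Local Notation sf := (sform eps).
Implicit Types (U : set V) (F G : V -> 'rV[R]_5).

Lemma derive_sform F G y v : differentiable F y -> differentiable G y ->
  'D_v (fun z => sf (F z) (G z)) y = sf ('D_v F y) (G y) + sf (F y) ('D_v G y).
Proof.
move=> dF dG.
have dFi i : differentiable (fun z => F z 0 i) y by exact: (differentiable_rowP F y).1 dF i.
have dGi i : differentiable (fun z => G z 0 i) y by exact: (differentiable_rowP G y).1 dG i.
rewrite derive_sum_fun; last first.
  by move=> i; apply: differentiableM => //; apply: differentiableM.
rewrite -big_split /=; apply: eq_bigr => i _.
rewrite deriveM_fun; [|by []|by apply: differentiableM].
rewrite derive_cst mulr0 addr0 deriveM_fun// (derive_coord _ i dF) (derive_coord _ i dG).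
by rewrite -mulrDr addrC [X in _ * (X + _)]mulrC.
Qed.

Lemma smooth_on_sform U F G : open U -> smooth_on U F -> smooth_on U G ->
  smooth_on U (fun z => sf (F z) (G z)).
Proof.
move=> oU sF sG; apply: smooth_on_sum => // i.
apply: smooth_onM => //; first exact: smooth_on_cst.
apply: smooth_onM => //; first exact: (smooth_on_rowP F oU).1 sF i.
exact: (smooth_on_rowP G oU).1 sG i.
Qed.

End SformCalculus.

(** * Surfaces in a space form *)

Lemma exchange_big4 (T : nmodType) n (G : 'I_n -> 'I_n -> 'I_n -> 'I_n -> T) :
  \sum_i \sum_j \sum_b \sum_a G i j b a = \sum_a \sum_b \sum_i \sum_j G i j b a.
Proof.
transitivity (\sum_b \sum_a \sum_i \sum_j G i j b a); last exact: exchange_big.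
transitivity (\sum_i \sum_b \sum_a \sum_j G i j b a).
  apply: eq_bigr => i _; rewrite exchange_big; apply: eq_bigr => b _.
  exact: exchange_big.
rewrite exchange_big; apply: eq_bigr => b _; exact: exchange_big.
Qed.

Section ParametrizedSurface.
Context {R : realType} {eps : R} {psi : 'rV[R]_2 -> 'rV[R]_5} {U : set 'rV[R]_2}.
Context (oU : open U) (spsi : smooth_on U psi)
  (psiS : forall y, U y -> space_form eps (psi y)).
Local Notation sf := (sform eps).
Local Notation B := (second_form eps psi).
Implicit Types (y v w u : 'rV[R]_2) (Z : 'rV[R]_2 -> 'rV[R]_5).

Let dpsi y : U y -> differentiable psi y.
Proof. exact: smooth_on_diff. Qed.

Let dDpsi w y : U y -> differentiable (fun z : 'rV[R]_2 => 'D_w psi z) y.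
Proof. by move=> Uy; exact: smooth_on_diff (smooth_on_derive w spsi) _ Uy. Qed.

(** Differentiate the equation saying that [Z] is tangent to the space form; when
    [eps != 0] the correction term of the connection cancels the component along [psi]. *)
Lemma derive_tangent Z y v : U y -> differentiable Z y ->
  (forall z, U z -> space_form_tangent eps (psi z) (Z z)) ->
  space_form_tangent eps (psi y) (ambient_nabla eps psi v Z y).
Proof.
move=> Uy dZ tZ; move: (tZ); rewrite /space_form_tangent /ambient_nabla /=.
case: (eqVneq eps 0) => e0 {}tZ.
  rewrite e0 mul0r scale0r addr0 (derive_coord v 0 dZ).
  rewrite (eq_on_derive v oU Uy (g := fun=> 0)); first by rewrite derive_cst.
  exact: tZ.
rewrite sformDl sformZl.
have := psiS Uy; rewrite /space_form /= (negbTE e0) => -[-> _].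
rewrite mulrAC divff// mul1r.
have E : 'D_v (fun z : 'rV[R]_2 => sf (Z z) (psi z)) y = 0.
  rewrite (eq_on_derive v oU Uy (g := fun=> 0)); first by rewrite derive_cst.
  exact: tZ.
by rewrite -E (derive_sform eps v dZ (dpsi Uy)) [sf ('D_v psi y) _]sformC.
Qed.

Lemma derive_position_tangent y v : U y ->
  space_form_tangent eps (psi y) ('D_v psi y).
Proof.
move=> Uy; have := psiS; rewrite /space_form_tangent /space_form /=.
case: (eqVneq eps 0) => [e0|e0] S.
  rewrite (derive_coord v 0 (dpsi Uy)).
  by rewrite (eq_on_derive v oU Uy (g := fun=> 0)) ?derive_cst.
have : 'D_v (fun z : 'rV[R]_2 => sf (psi z) (psi z)) y = 0.
  rewrite (eq_on_derive v oU Uy (g := fun=> eps^-1)); first by rewrite derive_cst.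
  by move=> z /S[].
rewrite (derive_sform eps v (dpsi Uy) (dpsi Uy)) [sf (psi y) _]sformC.
move: (sf _ _) => a; lra.
Qed.

Lemma sform_ambient Z y v (w : 'rV[R]_5) : space_form_tangent eps (psi y) w ->
  sf (ambient_nabla eps psi v Z y) w = sf ('D_v Z y) w.
Proof.
move=> /tangent_position tw.
by rewrite /ambient_nabla sformDl sformZl mulrAC [sf (psi y) w]sformC tw mul0r addr0.
Qed.

Lemma metricC y v w : metric eps psi y v w = metric eps psi y w v.
Proof. exact: sformC. Qed.

Lemma metric_gram y v w : U y ->
  metric eps psi y v w = \sum_i \sum_j v 0 i * w 0 j * gram eps psi y i j.
Proof.
move=> Uy; rewrite /metric (derive_row v (dpsi Uy)) sform_suml; apply: eq_bigr => i _.
rewrite (derive_row w (dpsi Uy)) sform_sumr; apply: eq_bigr => j _.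
by rewrite sformZl sformZr mxE mulrA.
Qed.

Lemma metric_mx y v w : U y ->
  metric eps psi y v w = (v *m gram eps psi y *m w^T) 0 0.
Proof.
move=> Uy; rewrite metric_gram// exchange_big /= mxE; apply: eq_bigr => j _.
rewrite mxE mxE mulr_suml; apply: eq_bigr => i _.
by rewrite mulrAC.
Qed.

Lemma second_derivative_bilinear y v w : U y ->
  'D_v (fun z : 'rV[R]_2 => 'D_w psi z) y
  = \sum_i \sum_j (v 0 i * w 0 j) *: 'D_(bas R i) (fun z : 'rV[R]_2 => 'D_(bas R j) psi z) y.
Proof.
move=> Uy; rewrite -> (derive_row v (dDpsi w Uy)); apply: eq_bigr => i _.
rewrite -> (derive_comm_row _ _ oU spsi Uy).
rewrite -> (derive_row w (dDpsi _ Uy)).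
rewrite scaler_sumr; apply: eq_bigr => j _.
by rewrite -> (derive_comm_row _ _ oU spsi Uy); rewrite scalerA.
Qed.

Lemma nabla_cst y v w : nabla eps psi v (fun=> w) y
  = \sum_i \sum_j (v 0 i * w 0 j) *: christoffel eps psi y i j.
Proof. by rewrite /nabla derive_cst add0r. Qed.

Lemma sum_bas (T : lmodType R) (F : 'I_2 -> 'I_2 -> T) i j :
  \sum_k \sum_l (bas R i 0 k * bas R j 0 l) *: F k l = F i j.
Proof.
rewrite (bigD1 i)//= (bigD1 j)//= !mxE !eqxx mulr1 scale1r.
rewrite !big1 ?addr0// => [k ki|l lj]; last first.
  by rewrite !mxE eqxx (negbTE lj) mulr0 scale0r.
by rewrite big1// => l _; rewrite !mxE eqxx (negbTE ki) mul0r scale0r.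
Qed.

(** The second form is computed on constant extensions, for which both terms of the Gauss
    formula are bilinear. *)
Lemma second_form_bilinear y v w : U y ->
  B y v w = \sum_i \sum_j (v 0 i * w 0 j) *: B y (bas R i) (bas R j).
Proof.
move=> Uy.
rewrite /second_form /ambient_nabla.
rewrite -> (second_derivative_bilinear v w Uy).
rewrite -> (metric_gram v w Uy : sf _ _ = _).
rewrite nabla_cst derive_sumv; last exact: dpsi.
rewrite mulr_sumr scaler_suml -big_split -sumrB /=; apply: eq_bigr => i _.
rewrite derive_sumv; last exact: dpsi.
rewrite mulr_sumr scaler_suml -big_split -sumrB /=; apply: eq_bigr => j _.
rewrite derive_scalev; last exact: dpsi.
rewrite nabla_cst sum_bas// scalerBr scalerDr.
by rewrite [in RHS]scalerA mxE mulrCA.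
Qed.

Lemma second_formC y v w : U y -> B y v w = B y w v.
Proof.
move=> Uy.
have G i j : christoffel eps psi y i j = christoffel eps psi y j i.
  rewrite /christoffel; apply: (congr1 (fun a => 2^-1 *: (a *m _))).
  apply/rowP => l; rewrite !mxE.
  rewrite [X in X - _]addrC; apply: (congr1 (fun a => _ - a)).
  by apply: (congr1 (fun g => 'D_(bas R l) g y)); apply/funext => z; rewrite !mxE metricC.
rewrite /second_form /ambient_nabla.
rewrite -> (derive_comm_row v w oU spsi Uy).
rewrite -> (sformC eps ('D_v psi y)).
apply: (congr1 (fun a => _ - a)); apply: (congr1 (fun a => 'D_a psi y)).
rewrite !nabla_cst exchange_big; apply: eq_bigr => i _; apply: eq_bigr => j _.
by rewrite G mulrC.
Qed.

Lemma second_form_suml y n (c : 'I_n -> R) (v : 'I_n -> 'rV[R]_2) w : U y ->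
  B y (\sum_k c k *: v k) w = \sum_k c k *: B y (v k) w.
Proof.
move=> Uy; rewrite second_form_bilinear//.
under [RHS]eq_bigr do rewrite second_form_bilinear// scaler_sumr.
rewrite [RHS]exchange_big; apply: eq_bigr => i _ /=.
under [RHS]eq_bigr do rewrite scaler_sumr.
rewrite [RHS]exchange_big; apply: eq_bigr => j _ /=.
rewrite summxE mulr_suml scaler_suml; apply: eq_bigr => k _.
by rewrite mxE scalerA mulrA.
Qed.

Lemma second_form_sumr y n (c : 'I_n -> R) (v : 'I_n -> 'rV[R]_2) w : U y ->
  B y w (\sum_k c k *: v k) = \sum_k c k *: B y w (v k).
Proof.
move=> Uy; rewrite (second_formC w _ Uy) (second_form_suml c v w Uy).
by apply: eq_bigr => k _; rewrite (second_formC w _ Uy).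
Qed.

Lemma second_form_tangent y v w : U y -> space_form_tangent eps (psi y) (B y v w).
Proof.
move=> Uy; refine ((tangentP eps (psi y) _).2 _).
have t1 := derive_tangent v Uy (dDpsi w Uy) (fun z => @derive_position_tangent z w).
have t2 := derive_position_tangent (nabla eps psi v (fun=> w) y) Uy.
refine (etrans (sformBl _ _ _ _) _).
by rewrite ((tangentP _ _ _).1 t1) ((tangentP _ _ _).1 t2) subr0.
Qed.

(** * Orthonormal frames *)

Definition orthonormal y (e : 'I_2 -> 'rV[R]_2) :=
  forall a b, metric eps psi y (e a) (e b) = (a == b)%:R.

Lemma orthonormal_gram y e : U y -> orthonormal y e ->
  gram eps psi y *m ((\matrix_a e a)^T *m (\matrix_a e a)) = 1%:M.
Proof.
move=> Uy oe; rewrite mulmxA; apply: mulmx1C.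
apply/matrixP => a b; rewrite [RHS]mxE -oe metric_mx// mulmxA !mxE.
apply: eq_bigr => k _; rewrite !mxE; congr (_ * _).
by apply: eq_bigr => l _; rewrite !mxE.
Qed.

Lemma gram_unit y e : U y -> orthonormal y e -> gram eps psi y \in unitmx.
Proof. by move=> Uy /(orthonormal_gram Uy)/mulmx1_unit[]. Qed.

Lemma ginvE y e : U y -> orthonormal y e ->
  ginv eps psi y = (\matrix_a e a)^T *m (\matrix_a e a).
Proof.
move=> Uy oe; apply: (can_inj (mulKmx (gram_unit Uy oe))).
by rewrite orthonormal_gram// mulmxV// (gram_unit Uy oe).
Qed.

Lemma ginv_coord y e i j : U y -> orthonormal y e ->
  ginv eps psi y i j = \sum_a e a 0 i * e a 0 j.
Proof.
by move=> Uy oe; rewrite (ginvE Uy oe) mxE; apply: eq_bigr => a _; rewrite !mxE.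
Qed.

Lemma orthonormal_expand y e v : U y -> orthonormal y e ->
  v = \sum_a metric eps psi y v (e a) *: e a.
Proof.
move=> Uy oe; rewrite -[LHS]mulmx1 -(orthonormal_gram Uy oe) !mulmxA mulmx_sum_row.
apply: eq_bigr => a _; rewrite rowK metric_mx// !mxE; congr (_ *: _).
by apply: eq_bigr => k _; rewrite !mxE.
Qed.

(** Koszul's formula: the Christoffel symbols, defined by derivatives of the metric, are the
    tangential parts of the second derivatives of the immersion. *)
Lemma metric_christoffel y e i j k : U y -> orthonormal y e ->
  metric eps psi y (christoffel eps psi y i j) (bas R k)
  = sf ('D_(bas R i) (fun z : 'rV[R]_2 => 'D_(bas R j) psi z) y) ('D_(bas R k) psi y).
Proof.
move=> Uy oe.
pose S a b c := sf ('D_(bas R a) (fun z : 'rV[R]_2 => 'D_(bas R b) psi z) y)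
  ('D_(bas R c) psi y).
have SC a b c : S a b c = S b a c.
  by rewrite /S; apply: (congr1 (sf^~ _)); exact: (derive_comm_row _ _ oU spsi Uy).
have Dg a b c : 'D_(bas R a) (fun z : 'rV[R]_2 => gram eps psi z b c) y = S a b c + S a c b.
  rewrite (eq_on_derive (bas R a) oU Uy
    (g := fun z => sf ('D_(bas R b) psi z) ('D_(bas R c) psi z))); last first.
    by move=> z _; rewrite mxE.
  rewrite (derive_sform eps (bas R a) (dDpsi (bas R b) Uy) (dDpsi (bas R c) Uy)).
  exact: (congr1 (fun x => _ + x) (sformC _ _ _)).
rewrite (metric_mx _ _ Uy) /christoffel; cbv zeta.
rewrite -!scalemxAl mulmxKV; last exact: gram_unit Uy oe.
rewrite [(bas R k)^T]trmx_delta -colE mxE mxE mxE.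
rewrite !Dg (SC j i k) (SC k i j) (SC k j i) -/(S i j k).
move: (S i j k) (S i k j) (S j k i) => a b c; lra.
Qed.

(** The Christoffel symbols remove the whole tangential part, by Koszul's formula. *)
Lemma second_form_normal y e v w u : U y -> orthonormal y e ->
  sf (B y v w) ('D_u psi y) = 0.
Proof.
move=> Uy oe.
rewrite (derive_row u (dpsi Uy)) sform_sumr big1// => k _; rewrite sformZr.
rewrite (second_form_bilinear v w Uy) sform_suml big1 ?mulr0// => i _.
rewrite sform_suml big1// => j _; rewrite sformZl.
rewrite /second_form sformBl; have tk := derive_position_tangent (bas R k) Uy.
rewrite -/(bas R k) (sform_ambient _ _ tk).
rewrite nabla_cst sum_bas.
have E := metric_christoffel i j k Uy oe.
by apply/eqP; rewrite mulf_eq0 subr_eq0; apply/orP; right; apply/eqP; exact: esym E.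
Qed.

(** Gauss formula for an arbitrary field: the derivatives of its components go into the
    tangential part. *)
Lemma ambient_nabla_field (Y : 'rV[R]_2 -> 'rV[R]_2) y v : U y -> smooth_on U Y ->
  ambient_nabla eps psi v (fun z : 'rV[R]_2 => 'D_(Y z) psi z) y
  = 'D_(nabla eps psi v Y y) psi y + B y v (Y y).
Proof.
move=> Uy sY; rewrite /second_form nabla_cst /ambient_nabla.
rewrite -> (derive_field_row v oU sY spsi Uy).
rewrite /nabla derive_addv; last exact: dpsi.
move: ('D_('D_v Y y) psi y) => a; move: ('D_(\sum_i _) psi y) => b.
move: (_ *: psi y) => c; move: ('D_v _ y) => d.
by apply/rowP => k; rewrite !mxE; ring.
Qed.

Lemma sform_derive_field (Y : 'rV[R]_2 -> 'rV[R]_2) y v (w : 'rV[R]_5) : U y ->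
  smooth_on U Y -> space_form_tangent eps (psi y) w ->
  sf ('D_v (fun z : 'rV[R]_2 => 'D_(Y z) psi z) y) w
  = sf ('D_(nabla eps psi v Y y) psi y) w + sf (B y v (Y y)) w.
Proof.
move=> Uy sY tw; refine (etrans (esym (sform_ambient _ v tw)) _).
exact (etrans (congr1 (sf^~ w) (ambient_nabla_field v Uy sY)) (sformDl _ _ _ _)).
Qed.

Lemma shape_frame eta y v e : U y -> orthonormal y e ->
  shape eps psi eta y v = \sum_a sf (B y v (e a)) eta *: e a.
Proof.
move=> Uy oe; apply/rowP => l; rewrite /shape mxE summxE.
under eq_bigr do rewrite mxE (ginv_coord _ _ Uy oe) mulr_sumr.
rewrite exchange_big; apply: eq_bigr => a _ /=.
rewrite mxE [X in B y v X](row_sum_delta (e a)) (second_form_sumr _ _ _ Uy) sform_suml.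
rewrite mulr_suml; apply: eq_bigr => k _.
by rewrite sformZl mulrA; congr (_ * _); exact: mulrC.
Qed.

Lemma shape_eigen eta y v w e k : U y -> orthonormal y e ->
  shape eps psi eta y v = k *: v -> sf (B y v w) eta = k * metric eps psi y v w.
Proof.
move=> Uy oe H.
rewrite [in LHS](orthonormal_expand w Uy oe) (second_form_sumr _ _ _ Uy) sform_suml.
have -> : k * metric eps psi y v w = metric eps psi y (k *: v) w.
  by rewrite /metric derive_scalev ?sformZl//; exact: dpsi.
rewrite -H (shape_frame _ _ Uy oe) /metric derive_sumv; last exact: dpsi.
rewrite sform_suml; apply: eq_bigr => a _.
rewrite sformZl derive_scalev; last exact: dpsi.
rewrite sformZl mulrC; exact: (congr1 (fun x => _ * x) (sformC _ _ _)).
Qed.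

Lemma mean_vec_frame y e : U y -> orthonormal y e ->
  mean_vec eps psi y = 2^-1 *: \sum_a B y (e a) (e a).
Proof.
move=> Uy oe; congr (_ *: _).
under [RHS]eq_bigr do rewrite (second_form_bilinear _ _ Uy).
rewrite [RHS]exchange_big; apply: eq_bigr => i _ /=.
rewrite [RHS]exchange_big; apply: eq_bigr => j _ /=.
by rewrite (ginv_coord _ _ Uy oe) scaler_suml.
Qed.

Lemma gradient_frame (h : 'rV[R]_2 -> R) y e : U y -> orthonormal y e ->
  differentiable h y -> gradient eps psi h y = \sum_a 'D_(e a) h y *: e a.
Proof.
move=> Uy oe dh; apply/rowP => l; rewrite /gradient mxE summxE.
under eq_bigr do rewrite mxE (ginv_coord _ _ Uy oe) mulr_sumr.
rewrite exchange_big; apply: eq_bigr => a _ /=.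
rewrite mxE (derive_row (e a) dh) mulr_suml; apply: eq_bigr => k _.
by rewrite mulrA [_ * e a 0 k]mulrC.
Qed.

(** The normal connection and the derivative in [R^5] differ by vectors orthogonal to the
    values of the second form. *)
Lemma shape_normal_nabla (Z : 'rV[R]_2 -> 'rV[R]_5) y v w e : U y -> orthonormal y e ->
  shape eps psi (normal_nabla eps psi v Z y) y w = shape eps psi ('D_v Z y) y w.
Proof.
move=> Uy oe; rewrite !(shape_frame _ _ Uy oe); apply: eq_bigr => a _; congr (_ *: _).
rewrite /normal_nabla sformDr (second_form_normal _ _ _ Uy oe) addr0 sformC.
rewrite (sform_ambient _ _ (second_form_tangent _ _ Uy)).
exact: sformC.
Qed.

(** The left side contracts a bilinear expression with the inverse metric, which is the sum
    of the squares of the vectors of an orthonormal frame. *)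
Lemma trace_shape_frame (Z : 'rV[R]_2 -> 'rV[R]_5) y e : U y -> orthonormal y e ->
  differentiable Z y ->
  \sum_i \sum_j ginv eps psi y i j *:
     shape eps psi (normal_nabla eps psi (bas R i) Z y) y (bas R j)
  = \sum_a \sum_b sf (B y (e a) (e b)) ('D_(e a) Z y) *: e b.
Proof.
move=> Uy oe dZ.
under eq_bigr do under eq_bigr do
  rewrite (shape_normal_nabla _ _ _ Uy oe) (shape_frame _ _ Uy oe) (ginv_coord _ _ Uy oe)
    scaler_sumr.
transitivity (\sum_i \sum_j \sum_b \sum_a (e a 0 i * e a 0 j * 
   sf (B y (bas R j) (e b)) ('D_(bas R i) Z y)) *: e b).
  apply: eq_bigr => i _; apply: eq_bigr => j _; apply: eq_bigr => b _.
  by rewrite scalerA mulr_suml scaler_suml.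
transitivity (\sum_a \sum_b \sum_i \sum_j (e a 0 i * e a 0 j * 
   sf (B y (bas R j) (e b)) ('D_(bas R i) Z y)) *: e b).
  exact: exchange_big4.
apply: eq_bigr => a _; apply: eq_bigr => b _.
have E1 : B y (e a) (e b) = \sum_j e a 0 j *: B y (bas R j) (e b).
  exact: etrans (congr1 (fun x => B y x (e b)) (row_sum_delta (e a)))
    (second_form_suml (fun j => e a 0 j) (fun j => bas R j) (e b) Uy).
have E2 : 'D_(e a) Z y = \sum_i e a 0 i *: 'D_(bas R i) Z y by exact: derive_row.
rewrite E1 E2 sform_sumr scaler_suml; apply: eq_bigr => i _.
rewrite sformZr sform_suml mulr_sumr scaler_suml; apply: eq_bigr => j _.
by rewrite sformZl mulrA.
Qed.

End ParametrizedSurface.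

(** * The Gauss equation *)

Section GaussEquation.
Context {R : realType} {eps : R} {psi : 'rV[R]_2 -> 'rV[R]_5} {U : set 'rV[R]_2}.
Context (oU : open U) (spsi : smooth_on U psi)
  (psiS : forall y, U y -> space_form eps (psi y)).
Context {e : 'I_2 -> 'rV[R]_2 -> 'rV[R]_2} (se : forall a, smooth_on U (e a))
  (oe : forall y, U y -> @orthonormal R eps psi y (fun a => e a y)).
Local Notation sf := (sform eps).
Local Notation B := (second_form eps psi).
Implicit Types (y v w u : 'rV[R]_2).

Let sV i : smooth_on U (fun z : 'rV[R]_2 => 'D_(bas R i) psi z).
Proof. exact: smooth_on_derive. Qed.

Lemma smooth_on_gram i j : smooth_on U (fun z : 'rV[R]_2 => gram eps psi z i j).
Proof.
apply: (@eq_smooth_on _ _ _ _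
  (fun z : 'rV[R]_2 => sf ('D_(bas R i) psi z) ('D_(bas R j) psi z))) => //.
  by move=> z _; rewrite mxE.
exact: smooth_on_sform.
Qed.

Lemma smooth_on_ginv i j : smooth_on U (fun z : 'rV[R]_2 => ginv eps psi z i j).
Proof.
apply: (@eq_smooth_on _ _ _ _ (fun z : 'rV[R]_2 => \sum_a e a z 0 i * e a z 0 j)) => //.
  by move=> z Uz; rewrite (ginv_coord spsi i j Uz (oe Uz)).
apply: smooth_on_sum => // a; apply: smooth_onM => //;
  exact: (smooth_on_rowP (e a) oU).1 (se a) _.
Qed.

Lemma smooth_on_christoffel i j :
  smooth_on U (fun z : 'rV[R]_2 => christoffel eps psi z i j).
Proof.
apply/smooth_on_rowP => // l.
apply: (@eq_smooth_on _ _ _ _ (fun z : 'rV[R]_2 => 2^-1 * \sum_k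
  (('D_(bas R i) (fun z : 'rV[R]_2 => gram eps psi z j k) z
  + 'D_(bas R j) (fun z : 'rV[R]_2 => gram eps psi z i k) z
  - 'D_(bas R k) (fun z : 'rV[R]_2 => gram eps psi z i j) z) * ginv eps psi z k l))) => //.
  move=> z _; rewrite /christoffel; cbv zeta; rewrite !mxE.
  by apply: (congr1 (fun a => 2^-1 * a)); apply: eq_bigr => k _; rewrite mxE.
apply: smooth_onM => //; first exact: smooth_on_cst.
apply: smooth_on_sum => // k; apply: smooth_onM => //; last exact: smooth_on_ginv.
apply: smooth_onB => //; first apply: smooth_onD => //;
  apply: smooth_on_derive; exact: smooth_on_gram.
Qed.

Lemma nabla_bas i j :
  nabla eps psi (bas R i) (fun=> bas R j) = fun y => christoffel eps psi y i j.
Proof. by apply/funext => y; rewrite nabla_cst sum_bas. Qed.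

(** The Gauss formula [d_i d_k psi = nabla + B - eps g_ik psi] differentiated along [d_j] and
    projected on [d_l psi]. The normal part [N] is orthogonal to [d_l psi], so its derivative
    contributes through the second form again. *)
Lemma third_derivative i j k l y : U y ->
  sf ('D_(bas R j) (fun z : 'rV[R]_2 => 'D_(bas R i) (fun z : 'rV[R]_2 => 'D_(bas R k) psi z) z) y)
     ('D_(bas R l) psi y)
  = metric eps psi y (nabla eps psi (bas R j) (fun z => christoffel eps psi z i k) y) (bas R l)
    - sf (B y (bas R i) (bas R k)) (B y (bas R j) (bas R l))
    - eps * gram eps psi y i k * gram eps psi y j l.
Proof.
move=> Uy.
pose V m := fun z : 'rV[R]_2 => 'D_(bas R m) psi z.
pose G := fun z : 'rV[R]_2 => christoffel eps psi z i k.
pose P := fun z : 'rV[R]_2 => 'D_(G z) psi z.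
pose Q := fun z : 'rV[R]_2 => 'D_(bas R i) (V k) z.
have sG : smooth_on U G := smooth_on_christoffel i k.
have sP : smooth_on U P := smooth_on_field_row oU sG spsi.
have sQ : smooth_on U Q := smooth_on_derive (bas R i) (sV k).
pose N := fun z => Q z - P z.
have sN : smooth_on U N by exact: smooth_onB.
have tV m z : U z -> space_form_tangent eps (psi z) (V m z).
  exact: derive_position_tangent.
have NE z : U z -> N z = B z (bas R i) (bas R k) - (eps * gram eps psi z i k) *: psi z.
  move=> Uz; rewrite /N /Q /P /second_form /ambient_nabla nabla_bas mxE /metric -/(V k).
  rewrite -/(V k z) -/(G z); move: ('D_(G z) psi z) ('D_(bas R i) (V k) z) (_ *: psi z) => a b c.
  by apply/rowP => p; rewrite !mxE; ring.
have epsV m z : U z -> eps * sf (psi z) (V m z) = 0.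
  by move=> Uz; rewrite sformC; exact: tangent_position (tV m z Uz).
have Nn z : U z -> sf (N z) (V l z) = 0.
  move=> Uz; rewrite NE// sformBl sformZl mulrAC epsV// mul0r subr0.
  exact: (second_form_normal oU spsi psiS _ _ _ Uz (oe Uz)).
have dN := smooth_on_diff sN Uy.
have dP := smooth_on_diff sP Uy.
have dV m := smooth_on_diff (sV m) Uy.
have dpsi := smooth_on_diff spsi Uy.
have E1 : sf ('D_(bas R j) N y) (V l y) = - sf (N y) ('D_(bas R j) (V l) y).
  apply/eqP; rewrite -addr_eq0; apply/eqP.
  have E0 : 'D_(bas R j) (fun z : 'rV[R]_2 => sf (N z) (V l z)) y = 0.
    by rewrite (eq_on_derive (bas R j) oU Uy Nn) derive_cst.
  exact: etrans (esym (derive_sform eps (bas R j) dN (dV l))) E0.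
have E2 : sf ('D_(bas R j) Q y) (V l y)
    = sf ('D_(bas R j) N y) (V l y) + sf ('D_(bas R j) P y) (V l y).
  rewrite -sformDl; apply: (congr1 (sf^~ (V l y))).
  rewrite /N deriveB_fun; last 2 first.
  - exact: smooth_on_diff sQ _ Uy.
  - exact: dP.
  by rewrite subrK.
have E3 : sf ('D_(bas R j) P y) (V l y)
    = metric eps psi y (nabla eps psi (bas R j) G y) (bas R l).
  rewrite -(sform_ambient (eps := eps) _ _ (tV l y Uy)).
  rewrite -> (ambient_nabla_field oU spsi (bas R j) Uy sG).
  rewrite sformDl (second_form_normal oU spsi psiS _ _ _ Uy (oe Uy)) addr0.
  reflexivity.
have E4 : sf (B y (bas R i) (bas R k)) ('D_(bas R j) (V l) y)
    = sf (B y (bas R i) (bas R k)) (B y (bas R j) (bas R l)).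
  have tB := second_form_tangent oU spsi psiS (bas R i) (bas R k) Uy.
  have EB : B y (bas R j) (bas R l) = ambient_nabla eps psi (bas R j) (V l) y
      - 'D_(nabla eps psi (bas R j) (fun=> bas R l) y) psi y by [].
  rewrite EB sformBr (second_form_normal oU spsi psiS _ _ _ Uy (oe Uy)) subr0.
  by rewrite ![sf (B _ _ _) _]sformC (sform_ambient (V l) (bas R j) tB).
have E5 : eps * sf (psi y) ('D_(bas R j) (V l) y) = - (eps * gram eps psi y j l).
  have : 'D_(bas R j) (fun z : 'rV[R]_2 => eps * sf (psi z) (V l z)) y = 0.
    by rewrite (eq_on_derive (bas R j) oU Uy (epsV l)) derive_cst.
  rewrite deriveM_fun; last 2 first.
  - exact: differentiable_cst.
  - exact: smooth_on_diff (smooth_on_sform eps oU spsi (sV l)) _ Uy.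
  rewrite derive_cst mulr0 addr0 (derive_sform eps (bas R j) dpsi (dV l)) mulrDr mxE.
  by rewrite addrC => /eqP; rewrite addr_eq0 => /eqP.
rewrite -/(V k) -/(Q) -/(V l y).
refine (etrans E2 _).
rewrite E1 E3 (NE y Uy) sformBl sformZl E4.
move: (metric _ _ _ _ _) (sf (psi y) _) E5 (sf _ _) => m p E5 s.
move: (gram _ _ _ i k) (gram _ _ _ j l) E5 => a b E5.
by rewrite (mulrAC eps a p) E5; ring.
Qed.

Lemma sum2 (T : nmodType) (F : 'I_2 -> T) : \sum_i F i = F 0 + F 1.
Proof. by rewrite !big_ord_recl big_ord0 addr0; congr (_ + F _); apply/val_inj. Qed.

Lemma det_mx22 (A : 'M[R]_2) : \det A = A 0 0 * A 1 1 - A 0 1 * A 1 0.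
Proof.
rewrite (expand_det_row _ 0) sum2 /cofactor !det_mx11 !mxE /=.
rewrite expr0 expr1 mul1r mulN1r mulrN.
by congr (_ * A _ _ - _ * A _ _); apply/val_inj.
Qed.

Lemma metric_suml y n (c : 'I_n -> R) (v : 'I_n -> 'rV[R]_2) w : differentiable psi y ->
  metric eps psi y (\sum_k c k *: v k) w = \sum_k c k * metric eps psi y (v k) w.
Proof.
move=> dpsi; rewrite /metric (derive_sumv _ dpsi) sform_suml; apply: eq_bigr => k _.
by rewrite (derive_scalev _ _ dpsi) sformZl.
Qed.

Lemma metric_frame y v w : U y -> metric eps psi y v w =
  \sum_a metric eps psi y v (e a y) * metric eps psi y w (e a y).
Proof.
move=> Uy; have E := orthonormal_expand spsi v Uy (oe Uy).
refine (etrans (congr1 (fun x => metric eps psi y x w) E) _).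
rewrite (metric_suml _ _ _ (smooth_on_diff spsi Uy)); apply: eq_bigr => a _.
exact: (congr1 (fun x => _ * x) (metricC _ _ _)).
Qed.

Lemma metricBl y v w u : differentiable psi y ->
  metric eps psi y (v - w) u = metric eps psi y v u - metric eps psi y w u.
Proof. by move=> dpsi; rewrite /metric derive_subv// sformBl. Qed.

(** Change of basis in the Gauss equation: [c] is the matrix of the coordinate basis in the
    orthonormal frame, and the denominator the square of its determinant. *)
Lemma gauss_algebra (X Y Z : 'rV[R]_5) (m m' c00 c01 c10 c11 : R) :
  m - sf (c10 *: (c10 *: X + c11 *: Y) + c11 *: (c10 *: Y + c11 *: Z))
         (c00 *: (c00 *: X + c01 *: Y) + c01 *: (c00 *: Y + c01 *: Z))
    - eps * (c10 * c10 + c11 * c11) * (c00 * c00 + c01 * c01)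
  = m' - sf (c00 *: (c10 *: X + c11 *: Y) + c01 *: (c10 *: Y + c11 *: Z))
            (c10 *: (c00 *: X + c01 *: Y) + c11 *: (c00 *: Y + c01 *: Z))
    - eps * (c00 * c10 + c01 * c11) * (c10 * c00 + c11 * c01) ->
  (c00 * c00 + c01 * c01) * (c10 * c10 + c11 * c11)
    - (c00 * c10 + c01 * c11) * (c10 * c00 + c11 * c01) != 0 ->
  (m - m') / ((c00 * c00 + c01 * c01) * (c10 * c10 + c11 * c11)
    - (c00 * c10 + c01 * c11) * (c10 * c00 + c11 * c01)) = eps + sf X Z - sf Y Y.
Proof.
rewrite !sformE [sf Z X]sformC [sf Y X]sformC [sf Z Y]sformC.
move: (sf X X) (sf X Y) (sf X Z) (sf Y Y) (sf Y Z) (sf Z Z) => xx xy xz yy yz zz T d0.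
apply: (mulIf d0); rewrite divfK// (_ : m - m' = (m - m') + 0) ?addr0//.
move/eqP: T; rewrite -subr_eq0 => /eqP T.
by rewrite -[LHS]subr0 -[X in _ - X]T; ring.
Qed.

(** Gauss' theorema egregium: third derivatives commute, so the two expressions that
    [third_derivative] gives for them differ only by curvature terms that cancel. *)
Lemma gauss_curv_frame y : U y ->
  gauss_curv eps psi y = eps + sf (B y (e 0 y) (e 0 y)) (B y (e 1 y) (e 1 y))
    - sf (B y (e 0 y) (e 1 y)) (B y (e 0 y) (e 1 y)).
Proof.
move=> Uy; rewrite /gauss_curv !nabla_bas.
have T0 := third_derivative 1 0 1 0 Uy.
have T1 := third_derivative 0 1 1 0 Uy.
have T01 := derive_comm_row (bas R 0) (bas R 1) oU (sV 1) Uy.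
have T := etrans (esym T0) (etrans (congr1 (fun x => sf x ('D_(bas R 0) psi y)) T01) T1).
rewrite (metricBl _ _ _ (smooth_on_diff spsi Uy)).
rewrite det_mx22.
pose c i a := metric eps psi y (bas R i) (e a y).
have gE i j : gram eps psi y i j = c i 0 * c j 0 + c i 1 * c j 1.
  rewrite mxE -/(metric _ _ _ _ _).
  by rewrite -> (metric_frame (bas R i) (bas R j) Uy); rewrite sum2.
have BE i j : B y (bas R i) (bas R j)
  = c i 0 *: (c j 0 *: B y (e 0 y) (e 0 y) + c j 1 *: B y (e 0 y) (e 1 y))
  + c i 1 *: (c j 0 *: B y (e 1 y) (e 0 y) + c j 1 *: B y (e 1 y) (e 1 y)).
  have Ej a : B y (e a y) (bas R j) = c j 0 *: B y (e a y) (e 0 y) + c j 1 *: B y (e a y) (e 1 y).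
    refine (etrans (congr1 (fun x => B y _ x) (orthonormal_expand spsi (bas R j) Uy (oe Uy))) _).
    by rewrite (second_form_sumr oU spsi (c j) (fun a => e a y) _ Uy) sum2.
  refine (etrans (congr1 (fun x => B y x _) (orthonormal_expand spsi (bas R i) Uy (oe Uy))) _).
  rewrite (second_form_suml oU spsi (c i) (fun a => e a y) _ Uy) sum2.
  by rewrite -> (Ej 0), (Ej 1).
have BC := second_formC (eps := eps) oU spsi (e 1 y) (e 0 y) Uy.
rewrite BC in BE.
have d0 : gram eps psi y 0 0 * gram eps psi y 1 1 - gram eps psi y 0 1 * gram eps psi y 1 0 != 0.
  have := gram_unit spsi Uy (oe Uy); rewrite unitmxE unitfE.
  by rewrite det_mx22.
rewrite !BE !gE in T d0 *.
exact: gauss_algebra T d0.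
Qed.

End GaussEquation.

(** * The adapted moving frame *)

(** Abstracts the derivatives of the goal, so that the arithmetic tactics do not unfold
    the limits that define them. *)
Ltac gen_derive := repeat match goal with
  |- context [@derive ?K ?V ?W ?f ?a ?v] =>
    let d := fresh "d" in generalize (@derive K V W f a v); intro d
  end.

(** The setting of the theorem in one chart, everything being a function of the coordinates.
    The labelling [b2 = 0] is part of [as_b]. *)
Record adapted_surface {R : realType} (eps : R) (U : set 'rV[R]_2)
    (psi : 'rV[R]_2 -> 'rV[R]_5) (e1 e2 : 'rV[R]_2 -> 'rV[R]_2)
    (e3 e4 : 'rV[R]_2 -> 'rV[R]_5) (k1 k2 al a1 a2 b1 : 'rV[R]_2 -> R) : Prop :=
  AdaptedSurface {
    as_open : open U;
    as_smooth : smooth_on U psi;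
    as_space : forall y, U y -> space_form eps (psi y);
    as_smooth1 : smooth_on U e1;
    as_smooth2 : smooth_on U e2;
    as_smooth4 : smooth_on U e4;
    as_metric : forall y, U y -> [/\ metric eps psi y (e1 y) (e1 y) = 1,
      metric eps psi y (e2 y) (e2 y) = 1 & metric eps psi y (e1 y) (e2 y) = 0];
    as_e3 : forall y, U y -> e3 y = (mean_curv eps psi y)^-1 *: mean_vec eps psi y;
    as_normal4 : forall y, U y -> is_normal eps psi y (e4 y);
    as_normal : forall y, U y -> sform eps (e4 y) (e4 y) = 1 /\ sform eps (e3 y) (e4 y) = 0;
    as_shape : forall y, U y ->
      [/\ shape eps psi (e3 y) y (e1 y) = k1 y *: e1 y,
          shape eps psi (e3 y) y (e2 y) = k2 y *: e2 y,
          shape eps psi (e4 y) y (e1 y) = al y *: e1 y &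
          shape eps psi (e4 y) y (e2 y) = - al y *: e2 y];
    as_nabla : forall y, U y -> nabla eps psi (e1 y) e1 y = - a1 y *: e2 y /\
      nabla eps psi (e2 y) e2 y = a2 y *: e1 y;
    as_b : forall y, U y -> b1 y = sform eps (normal_nabla eps psi (e1 y) e3 y) (e4 y) /\
      0 = sform eps (normal_nabla eps psi (e2 y) e3 y) (e4 y);
    as_biconservative : forall y, U y ->
      2 *: (\sum_i \sum_j ginv eps psi y i j *:
            shape eps psi (normal_nabla eps psi (bas R i) (mean_vec eps psi) y)
              y (bas R j))
      + gradient eps psi (fun z => mean_curv eps psi z ^+ 2) y = 0;
    as_umbilic : forall y, U y ->
      ~ (forall v, shape eps psi ((mean_curv eps psi y)^-1 *: mean_vec eps psi y) y v
                   = mean_curv eps psi y *: v) }.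

Lemma eq_opp_self {R : realType} (c d : R) : c = - d -> c = d -> c = 0.
Proof. by move=> -> ?; lra. Qed.

Lemma sform_lin2 {R : realType} (eps a b : R) x y z :
  sform eps (a *: x + b *: y) z = a * sform eps x z + b * sform eps y z.
Proof. by rewrite sformDl !sformZl. Qed.

Lemma sform_lin2r {R : realType} (eps a b : R) x y z :
  sform eps z (a *: x + b *: y) = a * sform eps z x + b * sform eps z y.
Proof. by rewrite sformDr !sformZr. Qed.

Lemma biconservative_algebra {R : realType} (a b c d d' m n : R) :
  2 * (a * d + m * (c * n)) + 2 * c * d = 0 -> 2 * (b * d') + 2 * c * d' = 0 ->
  (a + c) * d + c * n * m = 0 /\ (b + c) * d' = 0.
Proof. by move=> L1 L2; split; lra. Qed.

Lemma ord2 (i : 'I_2) : i = 0 \/ i = 1.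
Proof. by case: i => [[|[|//]] ?]; [left|right]; exact: val_inj. Qed.

Section MovingFrame.
Context {R : realType} {eps : R} {U : set 'rV[R]_2} {psi : 'rV[R]_2 -> 'rV[R]_5}
  {e1 e2 : 'rV[R]_2 -> 'rV[R]_2} {e3 e4 : 'rV[R]_2 -> 'rV[R]_5}
  {k1 k2 al a1 a2 b1 : 'rV[R]_2 -> R}
  (S : adapted_surface eps U psi e1 e2 e3 e4 k1 k2 al a1 a2 b1).
Local Notation sf := (sform eps).
Local Notation B := (second_form eps psi).
Local Notation f := (mean_curv eps psi).
Local Notation H := (mean_vec eps psi).
Implicit Types (y v w u : 'rV[R]_2).

Let oU := as_open S.
Let spsi := as_smooth S.
Let psiS := as_space S.
Let s1 := as_smooth1 S.
Let s2 := as_smooth2 S.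
Let s4 := as_smooth4 S.

Definition frame_field (a : 'I_2) := if a == 0 then e1 else e2.

Let se a : smooth_on U (frame_field a).
Proof. by rewrite /frame_field; case: ifP. Qed.

Lemma frame_orthonormal y : U y -> @orthonormal R eps psi y (fun a => frame_field a y).
Proof.
move=> Uy a b; have [m1 m2 m3] := as_metric S Uy.
case: (ord2 a) => ->; case: (ord2 b) => ->.
- exact: m1.
- exact: m3.
- exact: etrans (metricC _ _ _) m3.
- exact: m2.
Qed.

Let oe := frame_orthonormal.

Let dpsi y : U y -> differentiable psi y.
Proof. exact: smooth_on_diff. Qed.

Definition X1 := fun z : 'rV[R]_2 => 'D_(e1 z) psi z.
Definition X2 := fun z : 'rV[R]_2 => 'D_(e2 z) psi z.

Lemma smooth_X1 : smooth_on U X1. Proof. exact: smooth_on_field_row. Qed.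
Lemma smooth_X2 : smooth_on U X2. Proof. exact: smooth_on_field_row. Qed.

Lemma tangent_X1 y : U y -> space_form_tangent eps (psi y) (X1 y).
Proof. exact: derive_position_tangent. Qed.
Lemma tangent_X2 y : U y -> space_form_tangent eps (psi y) (X2 y).
Proof. exact: derive_position_tangent. Qed.

Lemma X_orthonormal y : U y ->
  [/\ sf (X1 y) (X1 y) = 1, sf (X2 y) (X2 y) = 1 & sf (X1 y) (X2 y) = 0].
Proof. move=> Uy; exact (as_metric S Uy). Qed.

Lemma mean_vecE y : U y -> H y = 2^-1 *: (B y (e1 y) (e1 y) + B y (e2 y) (e2 y)).
Proof. by move=> Uy; rewrite (mean_vec_frame oU spsi Uy (oe Uy)) sum2. Qed.

(** Where the mean curvature vanishes, [A_(H/f)] and [f Id] are both zero. *)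
Lemma mean_curv_gt0 y : U y -> 0 < f y.
Proof.
move=> Uy; rewrite lt_neqAle sqrtr_ge0 andbT eq_sym; apply/eqP => f0.
apply: (as_umbilic S Uy) => v; rewrite f0 invr0 !scale0r.
rewrite (shape_frame oU spsi _ _ Uy (oe Uy)) big1// => a _.
by rewrite sform0r scale0r.
Qed.

Lemma sform_mean_vec y : U y -> sf (H y) (H y) = f y ^+ 2.
Proof.
move=> Uy; have := mean_curv_gt0 Uy; rewrite /mean_curv.
by rewrite sqrtr_gt0 => /ltW/sqr_sqrtr.
Qed.

Lemma mean_vec_e3 y : U y -> H y = f y *: e3 y.
Proof.
move=> Uy; rewrite (as_e3 S Uy) scalerA divff ?scale1r//.
by rewrite gt_eqF// mean_curv_gt0.
Qed.

Lemma e3_unit y : U y -> sf (e3 y) (e3 y) = 1.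
Proof.
move=> Uy; rewrite (as_e3 S Uy) sformZl sformZr (sform_mean_vec Uy).
have f0 := mean_curv_gt0 Uy; move: (f y) f0 => c c0.
by field; rewrite gt_eqF.
Qed.

Lemma second_form_shape y : U y ->
  [/\ [/\ sf (B y (e1 y) (e1 y)) (e3 y) = k1 y, sf (B y (e1 y) (e2 y)) (e3 y) = 0 &
          sf (B y (e2 y) (e2 y)) (e3 y) = k2 y] &
      [/\ sf (B y (e1 y) (e1 y)) (e4 y) = al y, sf (B y (e1 y) (e2 y)) (e4 y) = 0 &
          sf (B y (e2 y) (e2 y)) (e4 y) = - al y]].
Proof.
move=> Uy; have [S31 S32 S41 S42] := as_shape S Uy; have [m1 m2 m3] := as_metric S Uy.
split; split.
- by rewrite (shape_eigen oU spsi _ Uy (oe Uy) S31) m1 mulr1.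
- by rewrite (shape_eigen oU spsi _ Uy (oe Uy) S31) m3 mulr0.
- by rewrite (shape_eigen oU spsi _ Uy (oe Uy) S32) m2 mulr1.
- by rewrite (shape_eigen oU spsi _ Uy (oe Uy) S41) m1 mulr1.
- by rewrite (shape_eigen oU spsi _ Uy (oe Uy) S41) m3 mulr0.
- by rewrite (shape_eigen oU spsi _ Uy (oe Uy) S42) m2 mulr1.
Qed.

(** Half the trace of [A_3]. The right side is defined on the surface, hence [f] does not
    depend on the chart. *)
Lemma mean_curvE y : U y -> f y = (k1 y + k2 y) / 2.
Proof.
move=> Uy; have [[b11 _ b22] _] := second_form_shape Uy.
have E1 : sf (H y) (e3 y) = (k1 y + k2 y) / 2.
  by rewrite -> (mean_vecE Uy); rewrite sformZl sformDl; rewrite -> b11, b22; exact: mulrC.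
have E2 : sf (H y) (e3 y) = f y.
  by rewrite -> (mean_vec_e3 Uy); rewrite sformZl; rewrite -> (e3_unit Uy); exact: mulr1.
by rewrite <- E2.
Qed.

Lemma k1E y : U y -> k1 y = 2 * f y - k2 y.
Proof.
by move=> Uy; have := mean_curvE Uy; generalize (f y) (k1 y) (k2 y) => a b c; lra.
Qed.

Lemma normal_mean_vec y v : U y -> sf (H y) ('D_v psi y) = 0.
Proof.
move=> Uy; rewrite -> (mean_vecE Uy); rewrite sformZl sformDl.
have N1 := second_form_normal oU spsi psiS (e1 y) (e1 y) v Uy (oe Uy).
have N2 := second_form_normal oU spsi psiS (e2 y) (e2 y) v Uy (oe Uy).
by rewrite -> N1, N2; rewrite addr0 mulr0.
Qed.

Lemma tangentD x (v w : 'rV[R]_5) (c d : R) : space_form_tangent eps x v ->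
  space_form_tangent eps x w -> space_form_tangent eps x (c *: v + d *: w).
Proof.
move=> /tangentP tv /tangentP tw; apply/tangentP.
by rewrite sformDl !sformZl tv tw !mulr0 addr0.
Qed.

Lemma tangent_mean_vec y : U y -> space_form_tangent eps (psi y) (H y).
Proof.
move=> Uy; rewrite (mean_vecE Uy) scalerDr; apply: tangentD;
  exact: (second_form_tangent oU spsi psiS).
Qed.

Lemma tangent_e3 y : U y -> space_form_tangent eps (psi y) (e3 y).
Proof.
move=> Uy; rewrite (as_e3 S Uy) -[_ *: _]addr0 -(scale0r (H y)).
by apply: tangentD; exact: tangent_mean_vec.
Qed.

Lemma e3_normal y v : U y -> sf (e3 y) ('D_v psi y) = 0.
Proof. by move=> Uy; rewrite (as_e3 S Uy) sformZl (normal_mean_vec _ Uy) mulr0. Qed.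

Lemma tangent_e4 y : U y -> space_form_tangent eps (psi y) (e4 y).
Proof. by move=> /(as_normal4 S)[]. Qed.

Lemma e4_normal y v : U y -> sf (e4 y) ('D_v psi y) = 0.
Proof. by move=> /(as_normal4 S)[_]; exact. Qed.

Lemma frame_expand y (v : 'rV[R]_5) : U y -> space_form_tangent eps (psi y) v ->
  v = sf v (X1 y) *: X1 y + sf v (X2 y) *: X2 y + sf v (e3 y) *: e3 y + sf v (e4 y) *: e4 y.
Proof.
move=> Uy tv; have [x1 x2 x12] := X_orthonormal Uy; have [n4 n34] := as_normal S Uy.
refine (tangent_expand (psiS Uy) _ _ _ _).
- by split; [exact: tangent_X1|exact: tangent_X2|exact: tangent_e3|exact: tangent_e4|].
- by split; [exact x1|exact x2|exact: e3_unit|exact n4].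
- split; [exact x12|exact (etrans (sformC _ _ _) (e3_normal _ Uy))|].
  exact (etrans (sformC _ _ _) (e4_normal _ Uy)).
- split; [exact (etrans (sformC _ _ _) (e3_normal _ Uy))| |exact n34].
  exact (etrans (sformC _ _ _) (e4_normal _ Uy)).
Qed.

(** * Smoothness of the frame and of its coefficients *)

Definition X11 := fun z : 'rV[R]_2 => 'D_(e1 z) X1 z.
Definition X12 := fun z : 'rV[R]_2 => 'D_(e1 z) X2 z.
Definition X21 := fun z : 'rV[R]_2 => 'D_(e2 z) X1 z.
Definition X22 := fun z : 'rV[R]_2 => 'D_(e2 z) X2 z.

Lemma smooth_X11 : smooth_on U X11.
Proof. exact: (smooth_on_field_row oU s1 smooth_X1). Qed.
Lemma smooth_X12 : smooth_on U X12.
Proof. exact: (smooth_on_field_row oU s1 smooth_X2). Qed.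
Lemma smooth_X21 : smooth_on U X21.
Proof. exact: (smooth_on_field_row oU s2 smooth_X1). Qed.
Lemma smooth_X22 : smooth_on U X22.
Proof. exact: (smooth_on_field_row oU s2 smooth_X2). Qed.

Lemma ambient_X11 y : U y ->
  ambient_nabla eps psi (e1 y) X1 y = - a1 y *: X2 y + B y (e1 y) (e1 y).
Proof.
move=> Uy; refine (etrans (ambient_nabla_field oU spsi (e1 y) Uy s1) _).
apply: (congr1 (fun x => x + _)); have [-> _] := as_nabla S Uy.
exact: (derive_scalev _ _ (dpsi Uy)).
Qed.

Lemma ambient_X22 y : U y ->
  ambient_nabla eps psi (e2 y) X2 y = a2 y *: X1 y + B y (e2 y) (e2 y).
Proof.
move=> Uy; refine (etrans (ambient_nabla_field oU spsi (e2 y) Uy s2) _).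
apply: (congr1 (fun x => x + _)); have [_ ->] := as_nabla S Uy.
exact: (derive_scalev _ _ (dpsi Uy)).
Qed.

Lemma derive_sform_cst (F G : 'rV[R]_2 -> 'rV[R]_5) (c : R) y v : smooth_on U F ->
  smooth_on U G -> (forall z, U z -> sf (F z) (G z) = c) -> U y ->
  sf ('D_v F y) (G y) = - sf (F y) ('D_v G y).
Proof.
move=> sF sG FG Uy; apply/eqP; rewrite -addr_eq0; apply/eqP.
refine (etrans (esym (derive_sform eps v (smooth_on_diff sF Uy) (smooth_on_diff sG Uy))) _).
exact (etrans (eq_on_derive v oU Uy FG) (derive_cst _ _ _)).
Qed.

(** Half of the coefficients are the definitions of [a1] and [a2]; the others follow by
    differentiating the orthonormality relations. *)
Lemma tangential_coefficients y : U y ->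
  [/\ [/\ sf (X11 y) (X1 y) = 0, sf (X12 y) (X1 y) = a1 y, sf (X21 y) (X1 y) = 0 &
          sf (X22 y) (X1 y) = a2 y] &
      [/\ sf (X11 y) (X2 y) = - a1 y, sf (X12 y) (X2 y) = 0, sf (X21 y) (X2 y) = - a2 y &
          sf (X22 y) (X2 y) = 0]].
Proof.
have x1 z : U z -> sf (X1 z) (X1 z) = 1 by move=> /X_orthonormal[].
have x2 z : U z -> sf (X2 z) (X2 z) = 1 by move=> /X_orthonormal[].
have x12 z : U z -> sf (X1 z) (X2 z) = 0 by move=> /X_orthonormal[].
move=> Uy.
have [n1 n2] := as_nabla S Uy.
have N v u : sf (B y v v) ('D_u psi y) = 0.
  exact (second_form_normal oU spsi psiS v v u Uy (oe Uy)).
have E11 : sf (X11 y) (X2 y) = - a1 y.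
  refine (etrans (sform_derive_field oU spsi (e1 y) Uy s1 (tangent_X2 Uy)) _).
  refine (etrans (congr2 (fun u c => sf ('D_u psi y) _ + c) n1 (N _ _)) _).
  rewrite addr0 (derive_scalev _ _ (dpsi Uy)) sformZl.
  exact (etrans (congr1 ( *%R _) (x2 y Uy)) (mulr1 _)).
have E22 : sf (X22 y) (X1 y) = a2 y.
  refine (etrans (sform_derive_field oU spsi (e2 y) Uy s2 (tangent_X1 Uy)) _).
  refine (etrans (congr2 (fun u c => sf ('D_u psi y) _ + c) n2 (N _ _)) _).
  rewrite addr0 (derive_scalev _ _ (dpsi Uy)) sformZl.
  exact (etrans (congr1 ( *%R _) (x1 y Uy)) (mulr1 _)).
have E1 := derive_sform_cst (e1 y) smooth_X1 smooth_X2 x12 Uy.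
have E2 := derive_sform_cst (e2 y) smooth_X1 smooth_X2 x12 Uy.
split; split.
- exact (eq_opp_self (derive_sform_cst (e1 y) smooth_X1 smooth_X1 x1 Uy) (sformC _ _ _)).
- refine (etrans (sformC _ _ _) _); apply: oppr_inj; exact (etrans (esym E1) E11).
- exact (eq_opp_self (derive_sform_cst (e2 y) smooth_X1 smooth_X1 x1 Uy) (sformC _ _ _)).
- exact E22.
- exact E11.
- exact (eq_opp_self (derive_sform_cst (e1 y) smooth_X2 smooth_X2 x2 Uy) (sformC _ _ _)).
- refine (etrans E2 _); apply: (congr1 -%R); exact (etrans (sformC _ _ _) E22).
- exact (eq_opp_self (derive_sform_cst (e2 y) smooth_X2 smooth_X2 x2 Uy) (sformC _ _ _)).
Qed.

Lemma smooth_a1 : smooth_on U a1.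
Proof.
apply: (eq_smooth_on oU (f := fun z => - sf (X11 z) (X2 z))).
  by move=> z Uz; have [_ [E _ _ _]] := tangential_coefficients Uz; rewrite -> E; rewrite opprK.
apply: smooth_onN => //; exact: (smooth_on_sform eps oU smooth_X11 smooth_X2).
Qed.

Lemma smooth_a2 : smooth_on U a2.
Proof.
apply: (eq_smooth_on oU (f := fun z => sf (X22 z) (X1 z))).
  by move=> z Uz; have [[_ _ _ E] _] := tangential_coefficients Uz; exact E.
exact: (smooth_on_sform eps oU smooth_X22 smooth_X1).
Qed.

(** Smoothness of [a1] being known, this yields smoothness of the second form, whose
    definition involves the inverse metric. *)
Lemma second_form_X11 y : U y -> B y (e1 y) (e1 y) = X11 y + eps *: psi y + a1 y *: X2 y.
Proof.
move=> Uy; have := ambient_X11 Uy; rewrite /ambient_nabla.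
have [x1 _ _] := X_orthonormal Uy; rewrite -> (x1 : sf ('D_(e1 y) psi y) (X1 y) = 1).
move=> E; rewrite /X11; rewrite mulr1 in E; rewrite E.
by rewrite scaleNr addrAC addNr add0r.
Qed.

Lemma second_form_X22 y : U y -> B y (e2 y) (e2 y) = X22 y + eps *: psi y - a2 y *: X1 y.
Proof.
move=> Uy; have := ambient_X22 Uy; rewrite /ambient_nabla.
have [_ x2 _] := X_orthonormal Uy; rewrite -> (x2 : sf ('D_(e2 y) psi y) (X2 y) = 1).
move=> E; rewrite /X22; rewrite mulr1 in E; rewrite E.
by rewrite addrAC subrr add0r.
Qed.

Let scst (c : R) : smooth_on U (fun=> c : R).
Proof. exact: smooth_on_cst. Qed.

Lemma smooth_second_form11 : smooth_on U (fun z => B z (e1 z) (e1 z)).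
Proof.
apply: (eq_smooth_on oU (f := fun z => X11 z + eps *: psi z + a1 z *: X2 z)).
  by move=> z Uz; rewrite -> (second_form_X11 Uz).
apply: (smooth_onD oU); last exact: (smooth_onZ oU smooth_a1 smooth_X2).
apply: (smooth_onD oU); first exact: smooth_X11.
exact: (smooth_onZ oU (scst eps) spsi).
Qed.

Lemma smooth_second_form22 : smooth_on U (fun z => B z (e2 z) (e2 z)).
Proof.
apply: (eq_smooth_on oU (f := fun z => X22 z + eps *: psi z - a2 z *: X1 z)).
  by move=> z Uz; rewrite -> (second_form_X22 Uz).
apply: (smooth_onB oU); last exact: (smooth_onZ oU smooth_a2 smooth_X1).
apply: (smooth_onD oU); first exact: smooth_X22.
exact: (smooth_onZ oU (scst eps) spsi).
Qed.

Lemma smooth_mean_vec : smooth_on U H.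
Proof.
apply: (eq_smooth_on oU
  (f := fun z => 2^-1 *: (B z (e1 z) (e1 z) + B z (e2 z) (e2 z)))).
  by move=> z Uz; rewrite -> (mean_vecE Uz).
apply: (smooth_onZ oU (scst 2^-1)); apply: (smooth_onD oU).
  exact: smooth_second_form11.
exact: smooth_second_form22.
Qed.

Lemma smooth_mean_curv : smooth_on U f.
Proof.
apply: (smooth_on_sqrt oU); first exact: smooth_on_sform oU smooth_mean_vec smooth_mean_vec.
by move=> z Uz; rewrite (sform_mean_vec Uz) exprn_gt0// mean_curv_gt0.
Qed.

Lemma smooth_e3 : smooth_on U e3.
Proof.
apply: (eq_smooth_on oU (f := fun z => (f z)^-1 *: H z)).
  by move=> z Uz; rewrite (as_e3 S Uz).
apply: (smooth_onZ oU); last exact: smooth_mean_vec.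
apply: (smooth_onV oU); first exact: smooth_mean_curv.
by move=> z Uz; rewrite gt_eqF// mean_curv_gt0.
Qed.

Lemma smooth_k1 : smooth_on U k1.
Proof.
apply: (eq_smooth_on oU (f := fun z => sf (B z (e1 z) (e1 z)) (e3 z))).
  by move=> z Uz; have [[E _ _] _] := second_form_shape Uz; exact E.
exact: smooth_on_sform oU smooth_second_form11 smooth_e3.
Qed.

Lemma smooth_k2 : smooth_on U k2.
Proof.
apply: (eq_smooth_on oU (f := fun z => sf (B z (e2 z) (e2 z)) (e3 z))).
  by move=> z Uz; have [[_ _ E] _] := second_form_shape Uz; exact E.
exact: smooth_on_sform oU smooth_second_form22 smooth_e3.
Qed.

Lemma smooth_al : smooth_on U al.
Proof.
apply: (eq_smooth_on oU (f := fun z => sf (B z (e1 z) (e1 z)) (e4 z))).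
  by move=> z Uz; have [_ [E _ _]] := second_form_shape Uz; exact E.
exact: smooth_on_sform oU smooth_second_form11 s4.
Qed.

Let normal_part (Y : 'rV[R]_2 -> 'rV[R]_2) y v (n : 'rV[R]_5) : U y -> smooth_on U Y ->
  space_form_tangent eps (psi y) n -> (forall w, sf n ('D_w psi y) = 0) ->
  sf ('D_v (fun z : 'rV[R]_2 => 'D_(Y z) psi z) y) n = sf (B y v (Y y)) n.
Proof.
move=> Uy sY tn nn; refine (etrans (sform_derive_field oU spsi v Uy sY tn) _).
exact (etrans (congr1 (fun c => c + _) (etrans (sformC _ _ _) (nn _))) (add0r _)).
Qed.

(** [B(E1, E2) = 0] because [E1] and [E2] diagonalize [A_3] and [A_4] simultaneously. *)
Lemma cross_normal y : U y ->
  [/\ sf (X12 y) (e3 y) = 0, sf (X12 y) (e4 y) = 0,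
      sf (X21 y) (e3 y) = 0 & sf (X21 y) (e4 y) = 0].
Proof.
move=> Uy; have [[_ b3 _] [_ b4 _]] := second_form_shape Uy.
have P3 Y v (sY : smooth_on U Y) := normal_part v Uy sY (tangent_e3 Uy) (fun w => e3_normal w Uy).
have P4 Y v (sY : smooth_on U Y) := normal_part v Uy sY (tangent_e4 Uy) (fun w => e4_normal w Uy).
have C := second_formC (eps := eps) oU spsi (e2 y) (e1 y) Uy.
split; [exact (etrans (P3 _ _ s2) b3)|exact (etrans (P4 _ _ s2) b4)| |].
  exact (etrans (P3 _ _ s1) (etrans (congr1 (sf^~ _) C) b3)).
exact (etrans (P4 _ _ s1) (etrans (congr1 (sf^~ _) C) b4)).
Qed.

Lemma normal_coefficients y : U y ->
  [/\ sf (X11 y) (e3 y) = k1 y, sf (X22 y) (e3 y) = k2 y,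
      sf (X11 y) (e4 y) = al y & sf (X22 y) (e4 y) = - al y].
Proof.
move=> Uy; have [[b113 _ b223] [b114 _ b224]] := second_form_shape Uy.
have P3 Y v (sY : smooth_on U Y) := normal_part v Uy sY (tangent_e3 Uy) (fun w => e3_normal w Uy).
have P4 Y v (sY : smooth_on U Y) := normal_part v Uy sY (tangent_e4 Uy) (fun w => e4_normal w Uy).
split; [exact (etrans (P3 _ _ s1) b113)|exact (etrans (P3 _ _ s2) b223)| |].
  exact (etrans (P4 _ _ s1) b114).
exact (etrans (P4 _ _ s2) b224).
Qed.

(** * Derivatives of the normal frame *)

(** The derivative of a normal field is tangent to the space form: the correction term of
    the connection vanishes on normal vectors. *)
Lemma derive_normal_expand (n : 'rV[R]_2 -> 'rV[R]_5) y v : U y -> smooth_on U n ->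
  (forall z, U z -> space_form_tangent eps (psi z) (n z)) ->
  (forall z w, U z -> sf (n z) ('D_w psi z) = 0) ->
  'D_v n y = - sf ('D_v X1 y) (n y) *: X1 y + - sf ('D_v X2 y) (n y) *: X2 y
    + sf ('D_v n y) (e3 y) *: e3 y + sf ('D_v n y) (e4 y) *: e4 y.
Proof.
move=> Uy sn tn nn.
have A : ambient_nabla eps psi v n y = 'D_v n y.
  rewrite /ambient_nabla; have E := etrans (sformC _ _ _) (nn y v Uy).
  by rewrite -> E; rewrite mulr0 scale0r addr0.
have T := derive_tangent oU spsi psiS v Uy (smooth_on_diff sn Uy) tn.
rewrite -> A in T; refine (etrans (frame_expand Uy T) _).
have D1 := derive_sform_cst v sn smooth_X1 (fun z => nn z (e1 z)) Uy.
have D2 := derive_sform_cst v sn smooth_X2 (fun z => nn z (e2 z)) Uy.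
refine (congr2 (fun a b => a *: X1 y + b *: X2 y + _ + _) _ _).
  exact (etrans D1 (congr1 -%R (sformC _ _ _))).
exact (etrans D2 (congr1 -%R (sformC _ _ _))).
Qed.

Lemma normal_connection_e3 y : U y -> sf ('D_(e1 y) e3 y) (e4 y) = b1 y
  /\ sf ('D_(e2 y) e3 y) (e4 y) = 0.
Proof.
move=> Uy; have [-> E0] := as_b S Uy.
have t4 := tangent_e4 Uy.
have N4 v : sf ('D_v psi y) (e4 y) = 0 := etrans (sformC _ _ _) (e4_normal v Uy).
have K v : sf (normal_nabla eps psi v e3 y) (e4 y) = sf ('D_v e3 y) (e4 y).
  rewrite /normal_nabla sformDl; rewrite -> N4; rewrite addr0.
  exact: sform_ambient.
by split; [exact (esym (K _))|exact (etrans (esym (K _)) (esym E0))].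
Qed.

Lemma derive_e3 y : U y -> 'D_(e1 y) e3 y = - k1 y *: X1 y + b1 y *: e4 y /\
  'D_(e2 y) e3 y = - k2 y *: X2 y.
Proof.
move=> Uy; have [n11 n22 _ _] := normal_coefficients Uy.
have [n12 _ n21 _] := cross_normal Uy; have [eb1 eb2] := normal_connection_e3 Uy.
have E v := derive_normal_expand v Uy smooth_e3 tangent_e3 (fun z w => @e3_normal z w).
have Z v : sf ('D_v e3 y) (e3 y) = 0.
  exact (eq_opp_self (derive_sform_cst v smooth_e3 smooth_e3 e3_unit Uy) (sformC _ _ _)).
split; refine (etrans (E _) _).
  by rewrite -> (n11 : sf ('D_(e1 y) X1 y) _ = _), (n12 : sf ('D_(e1 y) X2 y) _ = _),
    Z, eb1; rewrite oppr0 !scale0r !addr0.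
by rewrite -> (n21 : sf ('D_(e2 y) X1 y) _ = _), (n22 : sf ('D_(e2 y) X2 y) _ = _),
    Z, eb2; rewrite oppr0 !scale0r !addr0 add0r.
Qed.

Lemma derive_e4 y : U y -> 'D_(e1 y) e4 y = - al y *: X1 y - b1 y *: e3 y /\
  'D_(e2 y) e4 y = al y *: X2 y.
Proof.
move=> Uy; have [_ _ n11 n22] := normal_coefficients Uy.
have [_ n12 _ n21] := cross_normal Uy; have [eb1 eb2] := normal_connection_e3 Uy.
have E v := derive_normal_expand v Uy s4 tangent_e4 (fun z w => @e4_normal z w).
have U4 z : U z -> sf (e4 z) (e4 z) = 1 by move=> /(as_normal S)[].
have O3 z : U z -> sf (e3 z) (e4 z) = 0 by move=> /(as_normal S)[].
have Z v : sf ('D_v e4 y) (e4 y) = 0.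
  exact (eq_opp_self (derive_sform_cst v s4 s4 U4 Uy) (sformC _ _ _)).
have T v : sf ('D_v e4 y) (e3 y) = - sf ('D_v e3 y) (e4 y).
  have E0 := derive_sform_cst v smooth_e3 s4 O3 Uy.
  exact (etrans (sformC _ _ _) (canRL opprK (esym E0))).
split; refine (etrans (E _) _).
  by rewrite -> (n11 : sf ('D_(e1 y) X1 y) _ = _), (n12 : sf ('D_(e1 y) X2 y) _ = _),
    Z, (T (e1 y)), eb1; rewrite oppr0 !scale0r !addr0 (scaleNr (b1 y)).
by rewrite -> (n21 : sf ('D_(e2 y) X1 y) _ = _), (n22 : sf ('D_(e2 y) X2 y) _ = _),
    Z, (T (e2 y)), eb2; rewrite opprK oppr0 !scale0r !addr0 add0r.
Qed.

(** * Bracket of the frame and compatibility equations *)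

Lemma frame_bracket y : U y ->
  'D_(e1 y) e2 y - 'D_(e2 y) e1 y = a1 y *: e1 y + a2 y *: e2 y.
Proof.
move=> Uy; have [[_ t12 t21 _] [_ t12' t21' _]] := tangential_coefficients Uy.
have D : 'D_('D_(e1 y) e2 y - 'D_(e2 y) e1 y) psi y = X12 y - X21 y.
  exact (esym (derive_bracket_row oU s1 s2 spsi Uy)).
refine (etrans (orthonormal_expand spsi _ Uy (oe Uy)) _).
rewrite sum2; apply: (congr2 +%R); apply: (congr1 (fun c => c *: _)).
  refine (etrans (congr1 (sf^~ (X1 y)) D) _).
  by rewrite sformBl; rewrite -> t12, t21; rewrite subr0.
refine (etrans (congr1 (sf^~ (X2 y)) D) _).
by rewrite sformBl; rewrite -> t12', t21'; rewrite opprK add0r.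
Qed.

Lemma derive_bracket_fun (h : 'rV[R]_2 -> R) y : U y -> smooth_on U h ->
  'D_(e1 y) (fun z : 'rV[R]_2 => 'D_(e2 z) h z) y
  - 'D_(e2 y) (fun z : 'rV[R]_2 => 'D_(e1 z) h z) y
  = a1 y * 'D_(e1 y) h y + a2 y * 'D_(e2 y) h y.
Proof.
move=> Uy sh; refine (etrans (derive_bracket oU s1 s2 sh Uy) _).
refine (etrans (congr1 (fun x => 'D_x h y) (frame_bracket Uy)) _).
have dh := smooth_on_diff sh Uy.
by rewrite derive_addv// !derive_scalev.
Qed.

Lemma derive_bracket_frame (F : 'rV[R]_2 -> 'rV[R]_5) y : U y -> smooth_on U F ->
  'D_(e1 y) (fun z : 'rV[R]_2 => 'D_(e2 z) F z) y
  - 'D_(e2 y) (fun z : 'rV[R]_2 => 'D_(e1 z) F z) y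
  = a1 y *: 'D_(e1 y) F y + a2 y *: 'D_(e2 y) F y.
Proof.
move=> Uy sF; refine (etrans (derive_bracket_row oU s1 s2 sF Uy) _).
refine (etrans (congr1 (fun x => 'D_x F y) (frame_bracket Uy)) _).
have dF := smooth_on_diff sF Uy.
by rewrite derive_addv// !derive_scalev.
Qed.

Lemma sform_derivel (Q w : 'rV[R]_2 -> 'rV[R]_5) (c : 'rV[R]_2 -> R) y v :
  smooth_on U Q -> smooth_on U w -> (forall z, U z -> sf (Q z) (w z) = c z) -> U y ->
  sf ('D_v Q y) (w y) = 'D_v c y - sf (Q y) ('D_v w y).
Proof.
move=> sQ sw Qw Uy; apply/eqP; rewrite eq_sym subr_eq eq_sym; apply/eqP.
refine (etrans (esym (derive_sform eps v (smooth_on_diff sQ Uy) (smooth_on_diff sw Uy))) _).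
exact (eq_on_derive v oU Uy Qw).
Qed.

Lemma position_X22 y : U y -> eps * sf (X22 y) (psi y) = - eps.
Proof.
move=> Uy; have O z : U z -> eps * sf (X2 z) (psi z) = 0.
  by move=> Uz; exact: tangent_position (tangent_X2 Uz).
have sX := smooth_X2; have [_ x2 _] := X_orthonormal Uy.
have [e0|e0] := eqVneq eps 0; first by rewrite e0 mul0r oppr0.
have O' z : U z -> sf (X2 z) (psi z) = 0.
  by move=> /O/eqP; rewrite mulf_eq0 (negbTE e0) => /eqP.
have E := derive_sform_cst (e2 y) sX spsi O' Uy.
by rewrite -> (E : sf (X22 y) (psi y) = - sf (X2 y) (X2 y)), x2; rewrite mulrN1.
Qed.

Lemma second_form_expand y v w : U y ->
  B y v w = sf (B y v w) (e3 y) *: e3 y + sf (B y v w) (e4 y) *: e4 y.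
Proof.
move=> Uy; refine (etrans (frame_expand Uy (second_form_tangent oU spsi psiS v w Uy)) _).
have N u := second_form_normal oU spsi psiS v w u Uy (oe Uy).
have N1 : sf (B y v w) (X1 y) = 0 := N _; have N2 : sf (B y v w) (X2 y) = 0 := N _.
by rewrite -> N1, N2; rewrite !scale0r !add0r.
Qed.

Lemma second_form_frame y : U y ->
  [/\ B y (e1 y) (e1 y) = k1 y *: e3 y + al y *: e4 y, B y (e1 y) (e2 y) = 0 &
      B y (e2 y) (e2 y) = k2 y *: e3 y + - al y *: e4 y].
Proof.
move=> Uy; have [[b3 c3 d3] [b4 c4 d4]] := second_form_shape Uy.
pose L (a b : R) := a *: e3 y + b *: e4 y.
split; refine (etrans (second_form_expand _ _ Uy) _).
- exact (congr2 L b3 b4).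
- refine (etrans (congr2 L c3 c4) _); by rewrite /L !scale0r addr0.
- exact (congr2 L d3 d4).
Qed.

Lemma X11E y : U y -> X11 y = - a1 y *: X2 y + k1 y *: e3 y + al y *: e4 y - eps *: psi y.
Proof.
move=> Uy; have [E _ _] := second_form_frame Uy; have := second_form_X11 Uy.
rewrite -> E; generalize (X11 y) (X2 y) (e3 y) (e4 y) (psi y) => x x2 n3 n4 p E'.
by apply/rowP => i; have := congr1 (fun v : 'rV[R]_5 => v 0 i) E'; rewrite !mxE; lra.
Qed.

Lemma X22E y : U y -> X22 y = a2 y *: X1 y + k2 y *: e3 y + - al y *: e4 y - eps *: psi y.
Proof.
move=> Uy; have [_ _ E] := second_form_frame Uy; have := second_form_X22 Uy.
rewrite -> E; generalize (X22 y) (X1 y) (e3 y) (e4 y) (psi y) => x x1 n3 n4 p E'.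
by apply/rowP => i; have := congr1 (fun v : 'rV[R]_5 => v 0 i) E'; rewrite !mxE; lra.
Qed.

Lemma X21E y : U y -> X21 y = - a2 y *: X2 y.
Proof.
move=> Uy; have [[_ _ t1 _] [_ _ t2 _]] := tangential_coefficients Uy.
have [_ _ n3 n4] := cross_normal Uy; have [_ _ x12] := X_orthonormal Uy.
have T := derive_tangent oU spsi psiS (e2 y) Uy (smooth_on_diff smooth_X1 Uy) tangent_X1.
have x21 : sf ('D_(e2 y) psi y) (X1 y) = 0 := etrans (sformC _ _ _) x12.
have A : ambient_nabla eps psi (e2 y) X1 y = X21 y.
  by rewrite /ambient_nabla; rewrite -> x21; rewrite mulr0 scale0r addr0.
rewrite -> A in T; refine (etrans (frame_expand Uy T) _).
by rewrite -> t1, t2, n3, n4; rewrite !scale0r !addr0 add0r.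
Qed.

(** The bracket relation [[E1, E2] = a1 E1 + a2 E2], applied to [X1] and [X2] and projected on
    [E3], [E4] and [X1]. A projection of [D_v Xij] is computed as the derivative of the known
    coefficient of [Xij], minus a product with a derivative of the frame. *)
Lemma codazzi_gauss y : U y ->
  [/\ 'D_(e1 y) k2 y + al y * b1 y = a2 y * (k2 y - k1 y),
      k2 y * b1 y - 'D_(e1 y) al y = - 2 * a2 y * al y,
      'D_(e2 y) k1 y = a1 y * (k2 y - k1 y),
      'D_(e2 y) al y = - 2 * a1 y * al y &
      'D_(e1 y) a2 y - 'D_(e2 y) a1 y - a1 y ^+ 2 - a2 y ^+ 2
        = eps + k1 y * k2 y - al y ^+ 2].
Proof.
move=> Uy.
have T z (Uz : U z) := tangential_coefficients Uz.
have N z (Uz : U z) := normal_coefficients Uz.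
have C z (Uz : U z) := cross_normal Uz.
have [[t111 t121 t211 t221] [t112 t122 t212 t222]] := T y Uy.
have [n113 n223 n114 n224] := N y Uy.
have [n123 n124 n213 n214] := C y Uy.
have [E31 E32] := derive_e3 Uy; have [E41 E42] := derive_e4 Uy.
have B2 := derive_bracket_frame Uy smooth_X2.
have B1 := derive_bracket_frame Uy smooth_X1.
have P22 : eps * sf (X22 y) (psi y) = - eps := position_X22 Uy.
pose P (Q w : 'rV[R]_2 -> 'rV[R]_5) c v (sQ : smooth_on U Q) (sw : smooth_on U w)
  (Qw : forall z, U z -> sf (Q z) (w z) = c z) := sform_derivel v sQ sw Qw Uy.
have p22_3 := P _ _ k2 (e1 y) smooth_X22 smooth_e3 (fun z Uz => let: And4 _ x _ _ := N z Uz in x).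
have p12_3 := P _ _ (fun=> 0) (e2 y) smooth_X12 smooth_e3 (fun z Uz => let: And4 x _ _ _ := C z Uz in x).
have p22_4 := P _ _ (fun z => - al z) (e1 y) smooth_X22 s4 (fun z Uz => let: And4 _ _ _ x := N z Uz in x).
have p12_4 := P _ _ (fun=> 0) (e2 y) smooth_X12 s4 (fun z Uz => let: And4 _ x _ _ := C z Uz in x).
have p22_1 := P _ _ a2 (e1 y) smooth_X22 smooth_X1
  (fun z Uz => let: conj (And4 _ _ _ x) _ := T z Uz in x).
have p12_1 := P _ _ a1 (e2 y) smooth_X12 smooth_X1
  (fun z Uz => let: conj (And4 _ x _ _) _ := T z Uz in x).
have p21_3 := P _ _ (fun=> 0) (e1 y) smooth_X21 smooth_e3 (fun z Uz => let: And4 _ _ x _ := C z Uz in x).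
have p11_3 := P _ _ k1 (e2 y) smooth_X11 smooth_e3 (fun z Uz => let: And4 x _ _ _ := N z Uz in x).
have p21_4 := P _ _ (fun=> 0) (e1 y) smooth_X21 s4 (fun z Uz => let: And4 _ _ _ x := C z Uz in x).
have p11_4 := P _ _ al (e2 y) smooth_X11 s4 (fun z Uz => let: And4 _ _ x _ := N z Uz in x).
have dal : 'D_(e1 y) (fun z : 'rV[R]_2 => - al z) y = - 'D_(e1 y) al y.
  exact (deriveN_fun _ (smooth_on_diff smooth_al Uy)).
have BB2 (w : 'rV[R]_5) : sf ('D_(e1 y) X22 y) w - sf ('D_(e2 y) X12 y) w
    = a1 y * sf (X12 y) w + a2 y * sf (X22 y) w.
  refine (etrans (esym (sformBl eps _ _ _)) (etrans (congr1 (sf^~ w) B2) _)).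
  exact (sform_lin2 _ _ _ _ _ _).
have BB1 (w : 'rV[R]_5) : sf ('D_(e1 y) X21 y) w - sf ('D_(e2 y) X11 y) w
    = a1 y * sf (X11 y) w + a2 y * sf (X21 y) w.
  refine (etrans (esym (sformBl eps _ _ _)) (etrans (congr1 (sf^~ w) B1) _)).
  exact (sform_lin2 _ _ _ _ _ _).
have q22_3 : sf (X22 y) ('D_(e1 y) e3 y) = - k1 y * a2 y + b1 y * - al y.
  by rewrite -> E31; rewrite sform_lin2r; rewrite -> t221, n224.
have q12_3 : sf (X12 y) ('D_(e2 y) e3 y) = 0.
  by rewrite -> E32; rewrite sformZr; rewrite -> t122; rewrite mulr0.
have q22_4 : sf (X22 y) ('D_(e1 y) e4 y) = - al y * a2 y + - b1 y * k2 y.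
  by rewrite -> E41; rewrite -scaleNr sform_lin2r; rewrite -> t221, n223.
have q12_4 : sf (X12 y) ('D_(e2 y) e4 y) = 0.
  by rewrite -> E42; rewrite sformZr; rewrite -> t122; rewrite mulr0.
have q22_1 : sf (X22 y) ('D_(e1 y) X1 y) = k1 y * k2 y - al y ^+ 2 + eps.
  refine (etrans (congr1 (sf (X22 y)) (X11E Uy)) _).
  rewrite sformBr sformZr; rewrite -> P22; rewrite opprK; apply: (congr1 (fun c => c + _)).
  rewrite sformDr sform_lin2r sformZr; rewrite -> t222, n223, n224.
  by rewrite mulr0 add0r mulrN expr2.
have q12_1 : sf (X12 y) ('D_(e2 y) X1 y) = 0.
  have E21 : 'D_(e2 y) X1 y = - a2 y *: X2 y := X21E Uy.
  by rewrite -> E21; rewrite sformZr; rewrite -> t122; rewrite mulr0.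
have q21_3 : sf (X21 y) ('D_(e1 y) e3 y) = 0.
  by rewrite -> E31; rewrite sform_lin2r; rewrite -> t211, n214; rewrite !mulr0 addr0.
have q11_3 : sf (X11 y) ('D_(e2 y) e3 y) = - k2 y * - a1 y.
  by rewrite -> E32; rewrite sformZr; rewrite -> t112.
have q21_4 : sf (X21 y) ('D_(e1 y) e4 y) = 0.
  by rewrite -> E41; rewrite -scaleNr sform_lin2r; rewrite -> t211, n213; rewrite !mulr0 addr0.
have q11_4 : sf (X11 y) ('D_(e2 y) e4 y) = al y * - a1 y.
  by rewrite -> E42; rewrite sformZr; rewrite -> t112.
have Z v : 'D_v (fun=> 0 : R) y = 0 := derive_cst _ _ _.
have F23 := BB2 (e3 y); have F24 := BB2 (e4 y); have F21 := BB2 (X1 y).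
have F13 := BB1 (e3 y); have F14 := BB1 (e4 y).
rewrite -> p22_3, p12_3, n123, n223, q22_3, q12_3, Z in F23.
rewrite -> p22_4, p12_4, n124, n224, q22_4, q12_4, dal, Z in F24.
rewrite -> p22_1, p12_1, t121, t221, q22_1, q12_1 in F21.
rewrite -> p21_3, p11_3, n213, n113, q21_3, q11_3, Z in F13.
rewrite -> p21_4, p11_4, n214, n114, q21_4, q11_4, Z in F14.
clear -F23 F24 F21 F13 F14.
move: F23 F24 F21 F13 F14; gen_derive => F23 F24 F21 F13 F14.
move: (k1 y) (k2 y) (al y) (a1 y) (a2 y) (b1 y) F23 F24 F21 F13 F14
  => k1' k2' al' a1' a2' b1' F23 F24 F21 F13 F14.
split; lra.
Qed.


Lemma gauss_curvE y : U y -> gauss_curv eps psi y = eps + k1 y * k2 y - al y ^+ 2.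
Proof.
move=> Uy; refine (etrans (gauss_curv_frame oU spsi psiS se oe Uy) _).
have [B11 B12 B22] := second_form_frame Uy.
have E12 : B y (frame_field 0 y) (frame_field 1 y) = 0 := B12.
have E11 : B y (frame_field 0 y) (frame_field 0 y) = _ := B11.
have E22 : B y (frame_field 1 y) (frame_field 1 y) = _ := B22.
rewrite -> E12, E11, E22; rewrite sform0l subr0.
have [n44 n34] := as_normal S Uy; have n33 := e3_unit Uy.
move: (k1 y) (k2 y) (al y) (e3 y) (e4 y) n33 n34 n44 => a b c x z xx xz zz.
rewrite sform_lin2 !sform_lin2r xx xz zz sformC xz; ring.
Qed.

(** The biconservative equation in the frame, with [H = f E3] and [b2 = 0]. The components
    along [E1] and [E2] are separated at the end. *)
Lemma biconservative_equations y : U y ->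
  (k1 y + f y) * 'D_(e1 y) f y + f y * b1 y * al y = 0 /\
  (k2 y + f y) * 'D_(e2 y) f y = 0.
Proof.
move=> Uy.
have [B11 B12 B22] := second_form_frame Uy.
have dH := smooth_on_diff smooth_mean_vec Uy.
have df := smooth_on_diff smooth_mean_curv Uy.
have [E31 E32] := derive_e3 Uy.
have [n44 n34] := as_normal S Uy; have n33 := e3_unit Uy.
have X13 : sf (e3 y) (X1 y) = 0 := e3_normal _ Uy.
have X23 : sf (e3 y) (X2 y) = 0 := e3_normal _ Uy.
have X14 : sf (e4 y) (X1 y) = 0 := e4_normal _ Uy.
have X24 : sf (e4 y) (X2 y) = 0 := e4_normal _ Uy.
have DH v : 'D_v H y = 'D_v f y *: e3 y + f y *: 'D_v e3 y.
  refine (etrans (eq_on_derive v oU Uy mean_vec_e3) _).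
  exact (derive_scale_row v df (smooth_on_diff smooth_e3 Uy)).
have c11 : sf (B y (e1 y) (e1 y)) ('D_(e1 y) H y) = k1 y * 'D_(e1 y) f y + al y * (f y * b1 y).
  rewrite -> DH, E31, B11; rewrite sform_lin2 !sform_lin2r.
  rewrite -> X13, X14, n33, n34, (sformC eps (e4 y) (e3 y)), n34, n44.
  by rewrite !(mulr0, add0r, addr0, mulr1).
have c22 : sf (B y (e2 y) (e2 y)) ('D_(e2 y) H y) = k2 y * 'D_(e2 y) f y.
  rewrite -> DH, E32, B22; rewrite sform_lin2 !sform_lin2r !sformZr.
  rewrite -> X23, X24, n33, (sformC eps (e4 y) (e3 y)), n34.
  by rewrite !(mulr0, add0r, addr0, mulr1).
have c12 (w : 'rV[R]_5) : sf (B y (e1 y) (e2 y)) w = 0 by rewrite -> B12; rewrite sform0l.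
have c21 (w : 'rV[R]_5) : sf (B y (e2 y) (e1 y)) w = 0.
  by rewrite -> (second_formC oU spsi (e2 y) (e1 y) Uy); exact: c12.
have D2 v : 'D_v (fun z : 'rV[R]_2 => f z ^+ 2) y = 2 * f y * 'D_v f y.
  refine (etrans (deriveM_fun v df df) _).
  by gen_derive; generalize (f y) => c; ring.
have d2 : differentiable (fun z : 'rV[R]_2 => f z ^+ 2) y by exact: (differentiableM df df).
have := as_biconservative S Uy.
have TR := trace_shape_frame oU spsi psiS Uy (oe Uy) dH.
have GR := gradient_frame spsi Uy (oe Uy) d2.
have {}TR := etrans TR (etrans (sum2 _) (congr2 +%R (sum2 _) (sum2 _))).
have {}GR := etrans GR (sum2 _).
have {}TR := etrans TR (congr2 +%R
  (congr2 +%R (congr1 (fun c => c *: e1 y) c11) (congr1 (fun c => c *: e2 y) (c12 _)))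
  (congr2 +%R (congr1 (fun c => c *: e1 y) (c21 _)) (congr1 (fun c => c *: e2 y) c22))).
have {}GR := etrans GR (congr2 +%R (congr1 (fun c => c *: e1 y) (D2 (e1 y)))
   (congr1 (fun c => c *: e2 y) (D2 (e2 y)))).
rewrite -> TR, GR => E.
have [x1 x2 x12] := X_orthonormal Uy.
have L (a b : R) : a *: e1 y + b *: e2 y = 0 -> a = 0 /\ b = 0.
  move=> E0; have E1 : a *: X1 y + b *: X2 y = 0.
    rewrite -(derive_scalev _ _ (dpsi Uy)) -(derive_scalev b _ (dpsi Uy)) -derive_addv.
      by rewrite E0 derive0.
    exact: dpsi.
  split.
    have : sf (a *: X1 y + b *: X2 y) (X1 y) = 0 by rewrite E1 sform0l.
    rewrite sform_lin2; rewrite -> x1, (sformC eps (X2 y)), x12.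
    by rewrite mulr1 mulr0 addr0.
  have : sf (a *: X1 y + b *: X2 y) (X2 y) = 0 by rewrite E1 sform0l.
  rewrite sform_lin2; rewrite -> x2, x12.
  by rewrite mulr1 mulr0 add0r.
move: E; gen_derive => E.
move: (e1 y) (e2 y) (k1 y) (k2 y) (f y) (al y) (b1 y) L E => u1 u2 a b c m n L E.
have [] := L (2 * (a * d + m * (c * n)) + 2 * c * d) (2 * (b * d0) + 2 * c * d0).
  rewrite -E; apply/rowP => i; rewrite !mxE; ring.
exact: biconservative_algebra.
Qed.

Lemma X12E y : U y -> X12 y = a1 y *: X1 y.
Proof.
move=> Uy; have [[_ t1 _ _] [_ t2 _ _]] := tangential_coefficients Uy.
have [n3 n4 _ _] := cross_normal Uy; have [_ _ x12] := X_orthonormal Uy.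
have T := derive_tangent oU spsi psiS (e1 y) Uy (smooth_on_diff smooth_X2 Uy) tangent_X2.
have A : ambient_nabla eps psi (e1 y) X2 y = X12 y.
  rewrite /ambient_nabla; rewrite -> (x12 : sf ('D_(e1 y) psi y) (X2 y) = 0).
  by rewrite mulr0 scale0r addr0.
rewrite -> A in T; refine (etrans (frame_expand Uy T) _).
by rewrite -> t1, t2, n3, n4; rewrite !scale0r !addr0.
Qed.

(** When [a1 = 0] the field [X2] is parallel along [E1], and the bracket is [a2 E2]. *)
Lemma derive_X12 y : U y -> (forall z, U z -> a1 z = 0) ->
  X12 y = 0 /\ 'D_(e1 y) X22 y = a2 y *: X22 y.
Proof.
move=> Uy a0; have X0 z : U z -> X12 z = 0 by move=> Uz; rewrite -> (X12E Uz); rewrite a0// scale0r.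
split; first exact: X0.
have := derive_bracket_frame Uy smooth_X2.
have E : 'D_(e2 y) X12 y = 0 := etrans (eq_on_derive (e2 y) oU Uy X0) (derive_cst _ _ _).
rewrite -> (E : 'D_(e2 y) (fun z : 'rV[R]_2 => 'D_(e1 z) X2 z) y = 0), (a0 y Uy).
by rewrite subr0 scale0r add0r.
Qed.

(** Frenet equation of the integral curves of [E2]: the coefficients of [X22E] are constant
    along the curve, and the derivatives of [X1], [E3], [E4] and [psi] are multiples of [X2]. *)
Lemma derive_X22 y : U y -> 'D_(e2 y) a2 y = 0 -> 'D_(e2 y) k2 y = 0 -> 'D_(e2 y) al y = 0 ->
  'D_(e2 y) X22 y = - (a2 y ^+ 2 + k2 y ^+ 2 + al y ^+ 2 + eps) *: X2 y.
Proof.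
move=> Uy da dk dl.
have [_ D3] := derive_e3 Uy; have [_ D4] := derive_e4 Uy.
have dal : 'D_(e2 y) (fun z : 'rV[R]_2 => - al z) y = 0.
  by refine (etrans (deriveN_fun _ (smooth_on_diff smooth_al Uy)) _); rewrite -> dl; exact: oppr0.
have T (h : 'rV[R]_2 -> R) (F : 'rV[R]_2 -> 'rV[R]_5) : smooth_on U h -> smooth_on U F ->
    'D_(e2 y) h y = 0 -> differentiable (fun z : 'rV[R]_2 => h z *: F z) y /\
    'D_(e2 y) (fun z : 'rV[R]_2 => h z *: F z) y = h y *: 'D_(e2 y) F y.
  move=> sh sF h0; split; first exact: smooth_on_diff (smooth_onZ oU sh sF) _ Uy.
  refine (etrans (derive_scale_row _ (smooth_on_diff sh Uy) (smooth_on_diff sF Uy)) _).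
  by rewrite -> h0; rewrite scale0r add0r.
have [dT1 ET1] := T _ _ smooth_a2 smooth_X1 da; have [dT2 ET2] := T _ _ smooth_k2 smooth_e3 dk.
have [dT3 ET3] := T _ _ (smooth_onN oU smooth_al) s4 dal.
have [dT4 ET4] := T _ _ (scst eps) spsi (derive_cst _ _ _).
have d12 := differentiableD dT1 dT2; have d123 := differentiableD d12 dT3.
refine (etrans (eq_on_derive (e2 y) oU Uy X22E) _).
refine (etrans (deriveB_fun _ d123 dT4) _).
refine (etrans (congr2 (fun a b => a - b) (etrans (deriveD_fun _ d12 dT3)
  (congr2 +%R (etrans (deriveD_fun _ dT1 dT2) (congr2 +%R ET1 ET2)) ET3)) ET4) _).
rewrite -> (X21E Uy : 'D_(e2 y) X1 y = _), D3, D4, (erefl _ : 'D_(e2 y) psi y = X2 y).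
move: (X2 y) (a2 y) (k2 y) (al y) => x a k l.
by apply/rowP => i; rewrite !mxE; ring.
Qed.

End MovingFrame.

(** * The functions of the frame along its integral curves *)

Lemma quotient_pow_algebra {R : realType} (n a b c d : R) : a != 0 -> b != 0 ->
  n * - (b ^- 2 * (c * b * d / a)) + b^-1 * (c * d * n / a) = 0.
Proof. by move=> a0 b0; field; rewrite a0 b0. Qed.

Section FirstIntegralCoordinate.
Context {R : realType} {V : normedModType R}.
Implicit Types (U : set V) (h q u : V -> R).

(** If the derivative of [u] along a curve is [q = sqrt (P u)], then a primitive of
    [1 / sqrt P], evaluated at [u], is the parameter of the curve up to a constant. *)
Lemma first_integral_coordinate U u q (P : R -> R) y0 : open U -> U y0 ->
  smooth_on U u -> smooth_on U q -> (forall y, U y -> 0 < q y) -> continuous P ->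
  (forall y, U y -> q y ^+ 2 = P (u y)) ->
  exists (r : R) (s : V -> R), [/\ 0 < r, ball y0 r `<=` U, smooth_on (ball y0 r) s &
    forall y v, ball y0 r y -> 'D_v s y = 'D_v u y / q y].
Proof.
move=> oU Uy0 su sq q0 cP qP.
have P0 : 0 < P (u y0) by rewrite -qP// exprn_gt0// q0.
have [G [r1 r10 dG]] := primitive_inv_sqrt cP P0.
have cu := differentiable_continuous (smooth_on_diff su Uy0).
have nG : \forall y \near y0, ball (u y0) r1 (u y).
  by apply: cu; apply: nbhsx_ballx.
have /nbhs_ballP[r /= r0 Hr] : nbhs y0 (U `&` [set y | ball (u y0) r1 (u y)]).
  exact: filterI (near_open oU Uy0) nG.
have rU : ball y0 r `<=` U by move=> y /Hr[].
have oB : open (ball y0 r) by exact: ball_open.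
have dGd x : ball (u y0) r1 x -> differentiable G x.
  by move=> /dG[? _]; apply/derivable1_diffP.
have ds y : ball y0 r y -> differentiable (fun z => G (u z)) y.
  move=> By; have [Uy uy] := Hr y By.
  exact: (differentiable_comp (smooth_on_diff su Uy) (dGd _ uy)).
have Ds y v : ball y0 r y -> 'D_v (fun z => G (u z)) y = 'D_v u y / q y.
  move=> By; have [Uy uy] := Hr y By.
  refine (etrans (derive_comp v (smooth_on_diff su Uy) (dGd _ uy)) _).
  have E : 'D_('D_v u y * 1) G (u y) = 'D_v u y * 'D_1 G (u y).
    exact (derive_scalev ('D_v u y) (1 : R) (dGd _ uy)).
  rewrite mulr1 in E; refine (etrans E (congr1 (fun c => _ * c) _)).
  have [_ ->] := dG _ uy; rewrite -qP// sqrtr_sqr ger0_norm//.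
  exact: ltW (q0 y Uy).
exists r, (fun z => G (u z)); split=> //.
apply: smooth_onI => // v.
apply: (eq_smooth_on oB (f := fun y => 'D_v u y * (q y)^-1)).
  by move=> y By; exact (esym (Ds y v By)).
apply: smooth_onM => //.
  exact: smooth_on_sub rU (smooth_on_derive v su).
apply: (smooth_onV oB (smooth_on_sub rU sq)) => y /rU Uy.
by rewrite gt_eqF// q0.
Qed.

(** If [N] and [h] have logarithmic derivatives in the ratio [m], then [N / h^m] has
    derivative zero. *)
Lemma derive_quotient_pow (N h : V -> R) (m : nat) y v : differentiable N y ->
  differentiable h y -> 0 < h y -> h y * 'D_v N y = m%:R * 'D_v h y * N y ->
  'D_v (fun z => N z / h z ^+ m) y = 0.
Proof.
move=> dN dh h0 E.
have hn0 : h y != 0 by rewrite gt_eqF.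
have dX k : differentiable (fun z => h z ^+ k) y /\
    h y * 'D_v (fun z => h z ^+ k) y = k%:R * h y ^+ k * 'D_v h y.
  elim: k => [|k [dk Ek]].
    split; first exact: differentiable_cst.
    rewrite (_ : 'D_v (fun z => h z ^+ 0) y = 0) ?mulr0 ?mul0r//.
    exact: derive_cst.
  have dM := differentiableM dh dk.
  have -> : (fun z => h z ^+ k.+1) = (fun z => h z * h z ^+ k).
    by apply/funext => z; rewrite exprS.
  split; first exact: dM.
  have -> : 'D_v (fun z => h z * h z ^+ k) y
      = h y * 'D_v (fun z => h z ^+ k) y + h y ^+ k * 'D_v h y.
    exact (deriveM_fun v dh dk).
  rewrite Ek -natr1 exprS; gen_derive; generalize (h y) (h y ^+ k) (k%:R : R) => a b c; ring.
have [dXm Em] := dX m.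
have Xn0 : h y ^+ m != 0 by rewrite expf_neq0.
have dV := differentiableV dXm Xn0.
refine (etrans (deriveM_fun v dN dV) _).
have EV : 'D_v (fun z => (h z ^+ m)^-1) y = - (h y ^+ m ^- 2 * 'D_v (fun z => h z ^+ m) y).
  exact (deriveV_fun v Xn0 dXm).
refine (etrans (congr1 (fun c => _ * c + _) EV) _).
have E1 : 'D_v N y = m%:R * 'D_v h y * N y / h y by rewrite -E mulrAC mulfV// mul1r.
have E2 : 'D_v (fun z => h z ^+ m) y = m%:R * h y ^+ m * 'D_v h y / h y.
  by rewrite -Em mulrAC mulfV// mul1r.
rewrite -> E1, E2; exact: quotient_pow_algebra.
Qed.

End FirstIntegralCoordinate.

(** Were [E2(f)] nonzero at a point, the second biconservative equation would force
    [k2 = - f] nearby, and Codazzi would contradict the first one: they give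
    [5 E1(f) = 6 E1(f)]. Here [d], [c], [a], [m], [n], [k], [k'] stand for [E1(f)], [f], [a2],
    [alpha], [b1], [k2], [k1]. *)
Lemma umbilic_contradiction {R : realType} (d c a m n k k' : R) : 0 < d -> 0 < c ->
  a = 3 / 2 * (d / c) -> k = - c -> k' = 2 * c - k -> (k' + c) * d + c * n * m = 0 ->
  - d + m * n = a * (k - k') -> False.
Proof.
move=> d0 c0 -> -> -> E1 E2.
have c0' : c != 0 by rewrite gt_eqF.
have E3 : m * n = - 4 * d.
  apply: (mulfI c0'); move: E1; lra.
move: E2; rewrite E3.
have -> : 3 / 2 * (d / c) * (- c - (2 * c - - c)) = - 6 * d by field.
lra.
Qed.


(** The left side is the [E2]-derivative of [k1 k2 - alpha^2], rewritten by Codazzi. *)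
Lemma frame_curvature_algebra {R : realType} (a k k' l : R) : 0 < l ->
  k * (- (a * (k' - k))) + k' * (a * (k' - k)) - 2 * l * (- 2 * a * l) = 0 -> a = 0.
Proof.
move=> l0 E; have : a * ((k' - k) ^+ 2 + 4 * l ^+ 2) = 0 by rewrite -[RHS]E; ring.
move/eqP; rewrite mulf_eq0 => /orP[/eqP//|]; rewrite gt_eqF//.
by rewrite ltr_wpDl ?sqr_ge0// mulr_gt0// exprn_gt0.
Qed.

Lemma codazzi_solve {R : realType} (f d a k k' l b dk dl da e : R) : 0 < f -> 0 < l ->
  a = 3 / 2 * (d / f) -> k = 2 * f - k' -> (k + f) * d + f * b * l = 0 ->
  dk + l * b = a * (k' - k) -> k' * b - dl = - 2 * a * l ->
  da - 0 - 0 ^+ 2 - a ^+ 2 = e + k * k' - l ^+ 2 ->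
  [/\ d = 2 / 3 * a * f, dk = 4 / 3 * a * k',
      l * dl = 2 * a * l ^+ 2 - 2 / 3 * a * k' * (3 * f - k'),
      da = a ^+ 2 + e + 2 * f * k' - k' ^+ 2 - l ^+ 2 &
      b * (f * l) = d * (k' - 3 * f)].
Proof.
move=> f0 l0 aE -> Bi C1 C2 G.
have fn0 : f != 0 by rewrite gt_eqF.
have dE : d = 2 / 3 * a * f by rewrite aE; field.
have lb : l * b = - (2 / 3 * a * (3 * f - k')).
  apply: (mulfI fn0); move: Bi; rewrite dE; lra.
have C2' : dl = k' * b + 2 * a * l by lra.
split=> //; first lra.
- by rewrite C2' mulrDr mulrCA lb; ring.
- lra.
- lra.
Qed.

Lemma invariant_D_algebra {R : realType} (f a k l df dk dl : R) :
  df = 2 / 3 * a * f -> dk = 4 / 3 * a * k ->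
  l * dl = 2 * a * l ^+ 2 - 2 / 3 * a * k * (3 * f - k) ->
  f * ((l * dl + l * dl) + (k * dk + k * dk) - ((k * df + f * dk) + (k * df + f * dk)))
    = 6 * df * (l * l + k * k - (k * f + k * f)).
Proof. by move=> -> -> ->; field. Qed.

Lemma invariant_lam_algebra {R : realType} (f a k l df dk dl da e : R) :
  df = 2 / 3 * a * f -> dk = 4 / 3 * a * k ->
  l * dl = 2 * a * l ^+ 2 - 2 / 3 * a * k * (3 * f - k) ->
  da = a ^+ 2 + e + 2 * f * k - k ^+ 2 - l ^+ 2 ->
  f * ((a * da + a * da) + (k * dk + k * dk) + (l * dl + l * dl) + 0)
    = 3 * df * (a * a + k * k + l * l + e).
Proof. by move=> -> -> -> ->; field. Qed.

Lemma invariants_solve {R : realType} (f k l a e C D lam : R) : 0 < f ->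
  k / f ^+ 2 = C -> (l * l + k * k - (k * f + k * f)) / f ^+ 6 = D ->
  (a * a + k * k + l * l + e) / f ^+ 3 = lam ->
  [/\ k = C * f ^+ 2, l ^+ 2 = 2 * C * f ^+ 3 - C ^+ 2 * f ^+ 4 + D * f ^+ 6,
      a ^+ 2 = (lam - 2 * C) * f ^+ 3 - e - D * f ^+ 6,
      a ^+ 2 + k ^+ 2 + l ^+ 2 + e = lam * f ^+ 3 &
      e + (2 * f - k) * k - l ^+ 2 = e - D * f ^+ 6].
Proof.
move=> f0 EC ED EL; have fn0 : f != 0 by rewrite gt_eqF.
have Ek : k = C * f ^+ 2 by rewrite -EC; field.
have El : l * l + k * k - (k * f + k * f) = D * f ^+ 6 by rewrite -ED; field.
have Ea : a * a + k * k + l * l + e = lam * f ^+ 3 by rewrite -EL; field.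
have L : l ^+ 2 = 2 * C * f ^+ 3 - C ^+ 2 * f ^+ 4 + D * f ^+ 6.
  by rewrite -El Ek; ring.
split=> //.
- have -> : a ^+ 2 = lam * f ^+ 3 - k * k - l ^+ 2 - e by rewrite -[lam * _]Ea; ring.
  by rewrite L Ek; ring.
- by rewrite L Ek; ring.
Qed.

Section IntegrableCase.
Context {R : realType} {eps : R} {U : set 'rV[R]_2} {psi : 'rV[R]_2 -> 'rV[R]_5}
  {e1 e2 : 'rV[R]_2 -> 'rV[R]_2} {e3 e4 : 'rV[R]_2 -> 'rV[R]_5}
  {k1 k2 al a1 a2 b1 : 'rV[R]_2 -> R}
  (S : adapted_surface eps U psi e1 e2 e3 e4 k1 k2 al a1 a2 b1).
Local Notation f := (mean_curv eps psi).
Local Notation K := (gauss_curv eps psi).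
Context (al_gt0 : forall y, U y -> 0 < al y)
  (df_gt0 : forall y, U y -> 0 < 'D_(e1 y) f y)
  (a2E : forall y, U y -> a2 y = 3 / 2 * ('D_(e1 y) f y / f y)).
Context {W : 'rV[R]_2 -> R} (sW : smooth_on setT W)
  (dW : forall x, exists v, 'D_v W x <> 0)
  (WfK : forall y, U y -> W (\row_(i < 2) if i == 0 then f y else K y) = 0).
Implicit Types (y v w u : 'rV[R]_2).

Let oU := as_open S.
Let s1 := as_smooth1 S.
Let s2 := as_smooth2 S.
Let sf0 := smooth_mean_curv S.
Let sk1 := smooth_k1 S.
Let sk2 := smooth_k2 S.
Let sal := smooth_al S.
Let sa2 := smooth_a2 S.
Let f_gt0 y : U y -> 0 < f y := @mean_curv_gt0 _ _ _ _ _ _ _ _ _ _ _ _ _ _ S y.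


Lemma derive2_mean_curv y : U y -> 'D_(e2 y) f y = 0.
Proof.
move=> Uy; apply/eqP/negP => /negP d0.
pose g := fun z : 'rV[R]_2 => 'D_(e2 z) f z.
have sg : smooth_on U g := smooth_on_field oU s2 sf0.
have cg := differentiable_continuous (smooth_on_diff sg Uy).
have ng : \forall z \near y, g z != 0 by exact: (cvgr_neq0 (g y) cg d0).
have k2f : \forall z \near y, k2 z = - f z.
  apply: filterS2 (near_open oU Uy) ng => z Uz gz.
  have [_ /eqP] := biconservative_equations S Uz.
  by rewrite mulf_eq0 (negbTE gz) orbF addr_eq0 => /eqP.
have Dk : 'D_(e1 y) k2 y = - 'D_(e1 y) f y.
  refine (etrans (near_eq_derive (e1 y) k2f) _).
  exact (deriveN_fun _ (smooth_on_diff sf0 Uy)).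
have [Bi _] := biconservative_equations S Uy.
have [C1 _ _ _ _] := codazzi_gauss S Uy.
rewrite -> Dk in C1.
exact (@umbilic_contradiction R ('D_(e1 y) f y) (f y) (a2 y) (al y) _ (k2 y) (k1 y)
  (df_gt0 Uy) (f_gt0 Uy) (a2E Uy) (nbhs_singleton k2f) (k1E S Uy) Bi C1).
Qed.

Lemma smooth_gauss_curv : smooth_on U K.
Proof.
apply: (eq_smooth_on oU (f := fun z => eps + k1 z * k2 z - al z ^+ 2)).
  by move=> z Uz; exact (esym (gauss_curvE S Uz)).
apply: (smooth_onB oU); last exact: smooth_onX.
apply: (smooth_onD oU); first exact: smooth_on_cst.
exact: smooth_onM.
Qed.

(** The gradient of [W] at [(f, K)] is orthogonal to both rows of derivatives. As
    [E2(f) = 0], [E2(K) != 0] would imply [W_K = 0], and then [E1(f) > 0] that [W_f = 0]. *)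
Lemma derive2_gauss_curv y : U y -> 'D_(e2 y) K y = 0.
Proof.
move=> Uy.
pose G := fun z : 'rV[R]_2 => \row_(i < 2) (if i == 0 then f z else K z) : 'rV[R]_2.
have dfy := smooth_on_diff sf0 Uy; have dK := smooth_on_diff smooth_gauss_curv Uy.
have dG : differentiable G y.
  apply/differentiable_rowP => i.
  rewrite (_ : (fun z => G z 0 i) = if i == 0 then (fun z => f z) else (fun z => K z)).
    by case: ifP.
  by apply/funext => z; rewrite mxE; case: ifP.
have dWy : differentiable W (G y) by exact: smooth_on_diff sW _ I.
have DG v : 'D_v G y = 'D_v f y *: bas R 0 + 'D_v K y *: bas R 1.
  apply/rowP => i; rewrite (derive_coord v i dG).
  case: (ord2 i) => ->; rewrite !mxE /=; rewrite ?mulr1 ?mulr0 ?addr0 ?add0r;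
    apply: (congr1 (fun h => 'D_v h y)); apply/funext => z; by rewrite mxE.
have D0 v : 'D_v f y * 'D_(bas R 0) W (G y) + 'D_v K y * 'D_(bas R 1) W (G y) = 0.
  have E : 'D_v (fun z : 'rV[R]_2 => W (G z)) y = 0.
    exact (etrans (eq_on_derive v oU Uy WfK) (derive_cst _ _ _)).
  rewrite -[RHS]E; refine (etrans _ (esym (derive_comp v dG dWy))).
  rewrite -> (DG v); rewrite (derive_addv _ _ dWy) !(derive_scalev _ _ dWy).
  reflexivity.
have D1 := D0 (e1 y); have D2 := D0 (e2 y).
rewrite -> (derive2_mean_curv Uy) in D2; rewrite mul0r add0r in D2.
apply/eqP; apply/negP => /negP K0.
move/eqP: D2; rewrite mulf_eq0 (negbTE K0) /= => /eqP W1.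
rewrite -> W1 in D1; rewrite mulr0 addr0 in D1.
move/eqP: D1; rewrite mulf_eq0 gt_eqF ?df_gt0//= => /eqP W0.
have [v] := dW (G y); apply.
rewrite (derive_row v dWy) sum2.
have W0' : 'D_(delta_mx 0 0) W (G y) = 0 := W0.
have W1' : 'D_(delta_mx 0 1) W (G y) = 0 := W1.
by rewrite -> W0', W1'; rewrite !scaler0 addr0.
Qed.


Lemma derive2_k1 y : U y -> 'D_(e2 y) k1 y = - 'D_(e2 y) k2 y.
Proof.
move=> Uy; have df := smooth_on_diff sf0 Uy.
have d2f : differentiable (fun z : 'rV[R]_2 => f z + f z) y by exact: (differentiableD df df).
have E : 'D_(e2 y) k1 y = 'D_(e2 y) (fun z : 'rV[R]_2 => (f z + f z) - k2 z) y.
  apply: (eq_on_derive _ oU Uy) => z Uz; rewrite (k1E S Uz).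
  by generalize (f z) (k2 z) => a b; ring.
refine (etrans E (etrans (deriveB_fun _ d2f (smooth_on_diff sk2 Uy)) _)).
refine (etrans (congr1 (fun c => c - _) (deriveD_fun _ df df)) _).
by rewrite -> (derive2_mean_curv Uy); rewrite addr0 sub0r.
Qed.

(** [E2(K) = 0] reads [a1 ((k2 - k1)^2 + 4 alpha^2) = 0] by Codazzi. *)
Lemma a1_eq0 y : U y -> a1 y = 0.
Proof.
move=> Uy; have [_ _ C3 C4 _] := codazzi_gauss S Uy.
have [d1 d2 dl] := And3 (smooth_on_diff sk1 Uy) (smooth_on_diff sk2 Uy) (smooth_on_diff sal Uy).
have d12 := differentiableM d1 d2; have dll := differentiableM dl dl.
have dc : differentiable (fun=> eps : R) y by exact: differentiable_cst.
have dk := differentiableD dc d12.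
have E := derive2_gauss_curv Uy.
have E' : 'D_(e2 y) K y
    = 'D_(e2 y) (fun z : 'rV[R]_2 => (eps + k1 z * k2 z) - al z * al z) y.
  exact (eq_on_derive (e2 y) oU Uy (fun z Uz => gauss_curvE S Uz)).
rewrite -> E' in E.
have {}E := etrans (esym (deriveB_fun (e2 y) dk dll)) E.
have Ek : 'D_(e2 y) (fun z : 'rV[R]_2 => eps + k1 z * k2 z) y
    = k1 y * 'D_(e2 y) k2 y + k2 y * 'D_(e2 y) k1 y.
  refine (etrans (deriveD_fun _ dc d12) _).
  refine (etrans (congr1 (fun c => c + _) (derive_cst _ _ _)) _).
  by rewrite add0r; exact (deriveM_fun _ d1 d2).
have El := deriveM_fun (e2 y) dl dl.
have C5 : 'D_(e2 y) k2 y = - (a1 y * (k2 y - k1 y)).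
  by rewrite <- C3; rewrite -> (derive2_k1 Uy); rewrite opprK.
have {}E := etrans (esym (congr2 (fun c d => c - d) Ek El)) E.
rewrite -> C3, C4, C5 in E.
apply: (@frame_curvature_algebra R (a1 y) (k1 y) (k2 y) (al y) (al_gt0 Uy)).
by rewrite -[RHS]E mulr_natl mulr2n mulrDl.
Qed.

Lemma derive2_k2 y : U y -> 'D_(e2 y) k2 y = 0.
Proof.
move=> Uy; have [_ _ C3 _ _] := codazzi_gauss S Uy.
apply: oppr_inj; rewrite oppr0 -derive2_k1//.
by rewrite -> C3, (a1_eq0 Uy); rewrite mul0r.
Qed.

Lemma derive2_al y : U y -> 'D_(e2 y) al y = 0.
Proof.
move=> Uy; have [_ _ _ C4 _] := codazzi_gauss S Uy.
by rewrite -> C4, (a1_eq0 Uy); rewrite mulr0 mul0r.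
Qed.

(** The bracket relation applied to [f]. *)
Lemma derive2_derive1 y : U y -> 'D_(e2 y) (fun z : 'rV[R]_2 => 'D_(e1 z) f z) y = 0.
Proof.
move=> Uy; have := derive_bracket_fun S Uy sf0.
have E : 'D_(e1 y) (fun z : 'rV[R]_2 => 'D_(e2 z) f z) y = 0.
  exact (etrans (eq_on_derive (e1 y) oU Uy derive2_mean_curv) (derive_cst _ _ _)).
rewrite -> E, (a1_eq0 Uy), (derive2_mean_curv Uy); rewrite mul0r mulr0 addr0 sub0r.
by move/eqP; rewrite oppr_eq0 => /eqP.
Qed.

Lemma derive2_a2 y : U y -> 'D_(e2 y) a2 y = 0.
Proof.
move=> Uy; pose d1f := fun z : 'rV[R]_2 => 'D_(e1 z) f z.
have dd : differentiable d1f y by exact: (smooth_on_diff (smooth_on_field oU s1 sf0)).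
have df := smooth_on_diff sf0 Uy.
have f0 : f y != 0 by rewrite gt_eqF// f_gt0.
have dV := differentiableV df f0.
refine (etrans (eq_on_derive (e2 y) oU Uy a2E) _).
refine (etrans (derive_cstM (3 / 2) (e2 y) (differentiableM dd dV)) _).
have EM := etrans (deriveM_fun (e2 y) dd dV)
  (congr1 (fun c => _ * c + _) (deriveV_fun (e2 y) f0 df)).
refine (etrans (congr1 ( *%R _) EM) _).
have E1 : 'D_(e2 y) d1f y = 0 := derive2_derive1 Uy.
rewrite -> E1, (derive2_mean_curv Uy).
by rewrite !mulr0 oppr0 mulr0 addr0 mulr0.
Qed.

Lemma frame_ode y : U y ->
  [/\ 'D_(e1 y) f y = 2 / 3 * a2 y * f y,
      'D_(e1 y) k2 y = 4 / 3 * a2 y * k2 y,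
      al y * 'D_(e1 y) al y = 2 * a2 y * al y ^+ 2 - 2 / 3 * a2 y * k2 y * (3 * f y - k2 y),
      'D_(e1 y) a2 y = a2 y ^+ 2 + eps + 2 * f y * k2 y - k2 y ^+ 2 - al y ^+ 2 &
      b1 y * (f y * al y) = 'D_(e1 y) f y * (k2 y - 3 * f y)].
Proof.
move=> Uy; have [C1 C2 _ _ G] := codazzi_gauss S Uy.
have [Bi _] := biconservative_equations S Uy.
have Da : 'D_(e2 y) a1 y = 0.
  exact (etrans (eq_on_derive (e2 y) oU Uy a1_eq0) (derive_cst _ _ _)).
rewrite -> Da, (a1_eq0 Uy) in G.
exact (@codazzi_solve R (f y) ('D_(e1 y) f y) (a2 y) (k1 y) (k2 y) (al y) (b1 y) _ _ _ eps
  (f_gt0 Uy) (al_gt0 Uy) (a2E Uy) (k1E S Uy) Bi C1 C2 G).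
Qed.

Lemma frame_span y v : U y -> exists a b : R, v = a *: e1 y + b *: e2 y.
Proof.
move=> Uy; have E := orthonormal_expand (as_smooth S) v Uy (frame_orthonormal S Uy).
by rewrite sum2 in E; do 2 eexists; exact: E.
Qed.

Lemma frame_constant (h : 'rV[R]_2 -> R) (c : 'rV[R]_2) (r : R) : smooth_on U h ->
  (forall y, ball c r y -> 'D_(e1 y) h y = 0) ->
  (forall y, ball c r y -> 'D_(e2 y) h y = 0) ->
  ball c r `<=` U -> forall y z, ball c r y -> ball c r z -> h y = h z.
Proof.
move=> sh h1 h2 cU y z cy cz; apply: (eq_on_ball cz cy) => x cx; have Ux := cU x cx.
have dh := smooth_on_diff sh Ux; split=> //.
have [a [b ->]] := frame_span (y - z) Ux.
rewrite derive_addv// !derive_scalev//; rewrite -> (h1 x cx), (h2 x cx).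
by rewrite !scaler0 addr0.
Qed.

Let smooth_quotient (N : 'rV[R]_2 -> R) m : smooth_on U N ->
  smooth_on U (fun z : 'rV[R]_2 => N z / f z ^+ m).
Proof.
move=> sN; apply: (smooth_onM oU sN).
apply: (smooth_onV oU (smooth_onX m oU sf0)) => z Uz.
by rewrite expf_neq0// gt_eqF// f_gt0.
Qed.

Let square2 (h : 'rV[R]_2 -> R) y v : differentiable h y ->
  differentiable (fun z : 'rV[R]_2 => h z * h z) y /\
  'D_v (fun z : 'rV[R]_2 => h z * h z) y = h y * 'D_v h y + h y * 'D_v h y.
Proof.
by move=> dh; split; [exact: differentiableM | exact: (deriveM_fun v dh dh)].
Qed.

Let ND := fun z : 'rV[R]_2 => (al z * al z + k2 z * k2 z) - (k2 z * f z + k2 z * f z).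
Let NL := fun z : 'rV[R]_2 => ((a2 z * a2 z + k2 z * k2 z) + al z * al z) + eps.

Let derive_ND y v : U y -> differentiable ND y /\ 'D_v ND y =
  (al y * 'D_v al y + al y * 'D_v al y) + (k2 y * 'D_v k2 y + k2 y * 'D_v k2 y)
  - ((k2 y * 'D_v f y + f y * 'D_v k2 y) + (k2 y * 'D_v f y + f y * 'D_v k2 y)).
Proof.
move=> Uy; have [dl El] := square2 v (smooth_on_diff sal Uy).
have dk := smooth_on_diff sk2 Uy; have df := smooth_on_diff sf0 Uy.
have [dkk Ek] := square2 v dk.
have dkf := differentiableM dk df; have Ekf := deriveM_fun v dk df.
have d1 := differentiableD dl dkk; have d2 := differentiableD dkf dkf.
split; first exact: (differentiableB d1 d2).
refine (etrans (deriveB_fun v d1 d2) _).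
refine (congr2 (fun a b => a - b) (etrans (deriveD_fun v dl dkk) _) (etrans (deriveD_fun v dkf dkf) _)).
  exact (congr2 (fun a b => a + b) El Ek).
exact (congr2 (fun a b => a + b) Ekf Ekf).
Qed.

Let derive_NL y v : U y -> differentiable NL y /\ 'D_v NL y =
  (a2 y * 'D_v a2 y + a2 y * 'D_v a2 y) + (k2 y * 'D_v k2 y + k2 y * 'D_v k2 y)
  + (al y * 'D_v al y + al y * 'D_v al y) + 0.
Proof.
move=> Uy; have [dl El] := square2 v (smooth_on_diff sal Uy).
have [dk Ek] := square2 v (smooth_on_diff sk2 Uy).
have [da Ea] := square2 v (smooth_on_diff sa2 Uy).
have dc : differentiable (fun=> eps : R) y by exact: differentiable_cst.
have d1 := differentiableD da dk; have d2 := differentiableD d1 dl.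
split; first exact: (differentiableD d2 dc).
refine (etrans (deriveD_fun v d2 dc) _).
refine (congr2 (fun a b => a + b) (etrans (deriveD_fun v d1 dl) _) (derive_cst _ _ _)).
refine (congr2 (fun a b => a + b) (etrans (deriveD_fun v da dk) _) El).
exact (congr2 (fun a b => a + b) Ea Ek).
Qed.

(** Three first integrals of [frame_ode]: the numerators [k2], [alpha^2 + k2^2 - 2 k2 f] and
    [a2^2 + k2^2 + alpha^2 + eps] scale along [E1] like [f^2], [f^6] and [f^3]. *)
Lemma frame_invariants c (r : R) : U c -> 0 < r -> ball c r `<=` U ->
  exists C D lam : R, forall y, ball c r y ->
  [/\ k2 y = C * f y ^+ 2,
      al y ^+ 2 = 2 * C * f y ^+ 3 - C ^+ 2 * f y ^+ 4 + D * f y ^+ 6,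
      a2 y ^+ 2 = (lam - 2 * C) * f y ^+ 3 - eps - D * f y ^+ 6,
      a2 y ^+ 2 + k2 y ^+ 2 + al y ^+ 2 + eps = lam * f y ^+ 3 &
      K y = eps - D * f y ^+ 6].
Proof.
move=> Uc r0 cU; have cc : ball c r c by exact: ballxx.
have sD : smooth_on U ND.
  apply: (smooth_onB oU); apply: (smooth_onD oU); exact: smooth_onM.
have sL : smooth_on U NL.
  apply: (smooth_onD oU); last exact: smooth_on_cst.
  apply: (smooth_onD oU); last exact: smooth_onM.
  by apply: (smooth_onD oU); exact: smooth_onM.
exists (k2 c / f c ^+ 2), (ND c / f c ^+ 6), (NL c / f c ^+ 3) => y cy.
have Uy := cU y cy.
have cC : k2 y / f y ^+ 2 = k2 c / f c ^+ 2.
  apply: (frame_constant (smooth_quotient 2 sk2) _ _ cU cy cc) => z /cU Uz;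
    apply: (derive_quotient_pow (smooth_on_diff sk2 Uz) (smooth_on_diff sf0 Uz) (f_gt0 Uz)).
    have [-> -> _ _ _] := frame_ode Uz.
    by generalize (f z) (k2 z) (a2 z) => x k a; field.
  by rewrite -> (derive2_k2 Uz), (derive2_mean_curv Uz); rewrite mulr0 mulr0 mul0r.
have cD : ND y / f y ^+ 6 = ND c / f c ^+ 6.
  apply: (frame_constant (smooth_quotient 6 sD) _ _ cU cy cc) => z /cU Uz;
    apply: (derive_quotient_pow (smooth_on_diff sD Uz) (smooth_on_diff sf0 Uz) (f_gt0 Uz)).
    have [E1 E2 E3 _ _] := frame_ode Uz.
    refine (etrans (congr1 (fun x => f z * x) (derive_ND (e1 z) Uz).2) _).
    exact (@invariant_D_algebra R (f z) (a2 z) (k2 z) (al z) _ _ _ E1 E2 E3).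
  refine (etrans (congr1 (fun x => f z * x) (derive_ND (e2 z) Uz).2) _).
  rewrite -> (derive2_k2 Uz), (derive2_al Uz), (derive2_mean_curv Uz).
  by rewrite !mulr0 !addr0 subr0 mulr0 mul0r.
have cL : NL y / f y ^+ 3 = NL c / f c ^+ 3.
  apply: (frame_constant (smooth_quotient 3 sL) _ _ cU cy cc) => z /cU Uz;
    apply: (derive_quotient_pow (smooth_on_diff sL Uz) (smooth_on_diff sf0 Uz) (f_gt0 Uz)).
    have [E1 E2 E3 E4 _] := frame_ode Uz.
    refine (etrans (congr1 (fun x => f z * x) (derive_NL (e1 z) Uz).2) _).
    exact (@invariant_lam_algebra R (f z) (a2 z) (k2 z) (al z) _ _ _ _ eps E1 E2 E3 E4).
  refine (etrans (congr1 (fun x => f z * x) (derive_NL (e2 z) Uz).2) _).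
  rewrite -> (derive2_k2 Uz), (derive2_al Uz), (derive2_a2 Uz), (derive2_mean_curv Uz).
  by rewrite !mulr0 !addr0 mulr0 mul0r.
have [E1 E2 E3 E4 E5] := invariants_solve (f_gt0 Uy) cC cD cL.
split; [exact E1|exact E2|exact E3|exact E4|].
refine (etrans (gauss_curvE S Uy) (etrans _ E5)).
exact (congr1 (fun x : R => eps + x * k2 y - al y ^+ 2) (k1E S Uy)).
Qed.

(** * Adapted coordinates *)

(** By [frame_ode] and [frame_invariants], [E1(f)^2 = (2/3 f a2)^2] is a polynomial in [f]. *)
Lemma coordinate_s c (r : R) : U c -> 0 < r -> ball c r `<=` U ->
  exists (r' : R) (s : 'rV[R]_2 -> R), [/\ 0 < r', ball c r' `<=` ball c r,
    smooth_on (ball c r') s &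
    forall y, ball c r' y -> 'D_(e1 y) s y = 1 /\ 'D_(e2 y) s y = 0].
Proof.
move=> Uc r0 cU; have [C [D [lam inv]]] := frame_invariants Uc r0 cU.
pose q := fun z : 'rV[R]_2 => 'D_(e1 z) f z.
have sq : smooth_on U q := smooth_on_field oU s1 sf0.
pose P (x : R) : R := 4 / 9 * x ^+ 2 * ((lam - 2 * C) * x ^+ 3 - eps - D * x ^+ 6).
have cP : continuous P.
  move=> x; have cX n := @exprn_continuous R n x.
  apply: cvgM; first by apply: cvgM; [exact: cvg_cst|exact: cX].
  apply: cvgB; last by apply: cvgM; [exact: cvg_cst|exact: cX].
  apply: cvgB; last exact: cvg_cst.
  by apply: cvgM; [exact: cvg_cst|exact: cX].
have qP y : ball c r y -> q y ^+ 2 = P (f y).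
  move=> cy; have [E1 _ _ _ _] := frame_ode (cU y cy); have [_ _ E2 _ _] := inv y cy.
  by rewrite /q E1 /P -E2; generalize (f y) (a2 y) => a b; field.
have [r' [s [r'0 r'r ss Ds]]] := first_integral_coordinate (ball_open c r)
  (ballxx c r0) (smooth_on_sub cU sf0) (smooth_on_sub cU sq) (fun y cy => df_gt0 (cU y cy)) cP qP.
exists r', s; split=> // y cy; have Uy := cU y (r'r y cy).
have E1 := Ds y (e1 y) cy; have E2 := Ds y (e2 y) cy.
split.
  refine (etrans E1 _); rewrite /q; apply: divff; exact: lt0r_neq0 (df_gt0 Uy).
by refine (etrans E2 _); rewrite -> (derive2_mean_curv Uy); exact: mul0r.
Qed.

Let X := X2 (psi := psi) (e2 := e2).
Let Y := X22 (psi := psi) (e2 := e2).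

Lemma derive_scaled_coord (F : 'rV[R]_2 -> 'rV[R]_5) (k : R) i y v : differentiable F y ->
  'D_v (fun z : 'rV[R]_2 => k * F z 0 i) y = k * ('D_v F y) 0 i.
Proof.
move=> dF; have dFi := (differentiable_rowP F y).1 dF i.
refine (etrans (derive_cstM k v dFi) _).
exact (congr1 ( *%R k) (esym (derive_coord v i dF))).
Qed.

Lemma coordinate_t_algebra (f a g h l : R) : 0 < f ->
  f * (g * (a * g) + g * (a * g)) = 3%:R * (2 / 3 * a * f) * (g * g) /\
  (g * g / f ^+ 3 + l * (h * h)) - l * h ^+ 2 = (g / (f * Num.sqrt f)) ^+ 2.
Proof.
move=> f0; split; first by field.
rewrite expr_div_n exprMn sqr_sqrtr ?ltW// -exprSr; ring.
Qed.

(** A component [h] of [X2] is constant along [E1], and along [E2], where [f] is constant,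
    it is a harmonic oscillator: [h'' = - lam f^3 h]. Its energy, divided by [f^3], is
    constant on the ball, hence [(E2(h) / f^(3/2))^2] is the polynomial [m - lam h^2] in
    [h]. *)
Lemma coordinate_t c (r : R) : U c -> 0 < r -> ball c r `<=` U ->
  exists (r' : R) (t : 'rV[R]_2 -> R), [/\ 0 < r', ball c r' `<=` ball c r,
    smooth_on (ball c r') t &
    forall y, ball c r' y ->
      'D_(e1 y) t y = 0 /\ 'D_(e2 y) t y = f y * Num.sqrt (f y)].
Proof.
move=> Uc r0 cU; have [C [D [lam inv]]] := frame_invariants Uc r0 cU.
have sX : smooth_on U X := smooth_X2 S.
have sY : smooth_on U Y := smooth_X22 S.
(* [X22] does not vanish, since its [X1]-component is [a2 > 0]. *)
have [i Yi] : exists i, Y c 0 i != 0.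
  apply/not_existsP => Y0; have : a2 c = 0.
    have [[_ _ _ <-] _] := tangential_coefficients S Uc.
    rewrite (_ : X22 c = 0) ?sform0l//; apply/rowP => i; rewrite mxE.
    by apply/eqP; apply: contrapT => /negP; exact: Y0.
  apply/eqP; rewrite (a2E Uc); apply: lt0r_neq0.
  by rewrite mulr_gt0// divr_gt0// ?df_gt0// f_gt0.
(* This factor makes [E2(h) = 1] at [c], so that it is positive nearby. *)
pose k := (Y c 0 i)^-1.
pose h := fun z : 'rV[R]_2 => k * X z 0 i.
pose g := fun z : 'rV[R]_2 => k * Y z 0 i.
have sk : smooth_on U (fun=> k : R) by exact: smooth_on_cst.
have sh : smooth_on U h := smooth_onM oU sk ((smooth_on_rowP X oU).1 sX i).
have sg : smooth_on U g := smooth_onM oU sk ((smooth_on_rowP Y oU).1 sY i).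
have D1h y : U y -> 'D_(e1 y) h y = 0.
  move=> Uy; refine (etrans (derive_scaled_coord k i _ (smooth_on_diff sX Uy)) _).
  have [E _] := derive_X12 S Uy a1_eq0.
  have E' : 'D_(e1 y) X y = 0 := E.
  by rewrite -> E'; rewrite mxE mulr0.
have D2h y : U y -> 'D_(e2 y) h y = g y.
  move=> Uy; exact (derive_scaled_coord k i _ (smooth_on_diff sX Uy)).
have D1g y : U y -> 'D_(e1 y) g y = a2 y * g y.
  move=> Uy; refine (etrans (derive_scaled_coord k i _ (smooth_on_diff sY Uy)) _).
  have [_ E] := derive_X12 S Uy a1_eq0.
  have E' : 'D_(e1 y) Y y = a2 y *: Y y := E.
  by rewrite -> E'; rewrite mxE mulrCA.
have D2g y : ball c r y -> 'D_(e2 y) g y = - (lam * f y ^+ 3) * h y.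
  move=> cy; have Uy := cU y cy.
  refine (etrans (derive_scaled_coord k i _ (smooth_on_diff sY Uy)) _).
  have E' : 'D_(e2 y) Y y = - (a2 y ^+ 2 + k2 y ^+ 2 + al y ^+ 2 + eps) *: X y.
    exact (derive_X22 S Uy (derive2_a2 Uy) (derive2_k2 Uy) (derive2_al Uy)).
  have [_ _ _ EL _] := inv y cy.
  by rewrite -> E', EL; rewrite mxE mulrCA.
pose N := fun z : 'rV[R]_2 => g z * g z.
have sN : smooth_on U N := smooth_onM oU sg sg.
have sN3 := smooth_quotient 3 sN.
have slam : smooth_on U (fun=> lam : R) by exact: smooth_on_cst.
have slh : smooth_on U (fun z : 'rV[R]_2 => lam * (h z * h z)).
  exact (smooth_onM oU slam (smooth_onM oU sh sh)).
pose m := fun z : 'rV[R]_2 => N z / f z ^+ 3 + lam * (h z * h z).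
have sm : smooth_on U m := smooth_onD oU sN3 slh.
have Dh2 y v : U y -> 'D_v (fun z : 'rV[R]_2 => lam * (h z * h z)) y
    = lam * (h y * 'D_v h y + h y * 'D_v h y).
  move=> Uy; have [d2 E2] := square2 v (smooth_on_diff sh Uy).
  exact (etrans (derive_cstM lam v d2) (congr1 ( *%R lam) E2)).
have mc y : ball c r y -> m y = m c.
  move=> cy; apply: (frame_constant sm _ _ cU cy (ballxx c r0)) => z cz; have Uz := cU z cz;
    refine (etrans (deriveD_fun _ (smooth_on_diff sN3 Uz) (smooth_on_diff slh Uz)) _).
  - have [dN EN] := square2 (e1 z) (smooth_on_diff sg Uz).
    have Q : 'D_(e1 z) (fun x : 'rV[R]_2 => N x / f x ^+ 3) z = 0.
      apply: (derive_quotient_pow dN (smooth_on_diff sf0 Uz) (f_gt0 Uz)).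
      refine (etrans (congr1 (fun x => f z * x) EN) _).
      have [E1 _ _ _ _] := frame_ode Uz.
      refine (etrans (congr1 (fun x => f z * (g z * x + g z * x)) (D1g z Uz)) _).
      refine (etrans _ (congr1 (fun x => 3%:R * x * (g z * g z)) (esym E1))).
      exact (coordinate_t_algebra (a2 z) (g z) 0 0 (f_gt0 Uz)).1.
    refine (etrans (congr2 +%R Q (Dh2 z (e1 z) Uz)) _).
    refine (etrans (congr1 (fun a => 0 + lam * (_ * a + _ * a)) (D1h z Uz)) _).
    by rewrite mulr0 addr0 mulr0 addr0.
  - have [dN EN] := square2 (e2 z) (smooth_on_diff sg Uz).
    have f3 : f z ^+ 3 != 0 by rewrite expf_neq0// gt_eqF// f_gt0.
    have d3 : differentiable (fun x : 'rV[R]_2 => f x ^+ 3) z.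
      exact (smooth_on_diff (smooth_onX 3 oU sf0) Uz).
    have Q : 'D_(e2 z) (fun x : 'rV[R]_2 => N x / f x ^+ 3) z
        = (f z ^+ 3)^-1 * (g z * 'D_(e2 z) g z + g z * 'D_(e2 z) g z).
      have d3V := differentiableV d3 f3.
      refine (etrans (deriveM_fun _ dN d3V) _).
      have D0 : 'D_(e2 z) (fun x : 'rV[R]_2 => f x ^+ 3) z = 0.
        have df := smooth_on_diff sf0 Uz; have [df2 Ef2] := square2 (e2 z) df.
        refine (etrans (deriveM_fun _ df df2) _); rewrite -> Ef2, (derive2_mean_curv Uz).
        by rewrite !(mulr0, addr0).
      have DV : 'D_(e2 z) (fun x : 'rV[R]_2 => (f x ^+ 3)^-1) z = 0.
        refine (etrans (deriveV_fun (h := fun x : 'rV[R]_2 => f x ^+ 3) _ f3 d3) _).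
        by rewrite -> D0; rewrite mulr0 oppr0.
      refine (etrans (congr2 (fun a b => _ * a + _ * b) DV EN) _).
      by rewrite mulr0 add0r.
    refine (etrans (congr2 +%R Q (Dh2 z (e2 z) Uz)) _).
    refine (etrans (congr2 (fun a b => _ * (_ * a + _ * a) + lam * (_ * b + _ * b))
      (D2g z cz) (D2h z Uz)) _).
    move: f3; generalize (f z ^+ 3) (h z) (g z) => a b d a0.
    by field.
pose q := fun z : 'rV[R]_2 => g z / (f z * Num.sqrt (f z)).
have sq : smooth_on U q.
  apply: (smooth_onM oU sg); apply: (smooth_onV oU).
    apply: (smooth_onM oU sf0); exact: (smooth_on_sqrt oU sf0 f_gt0).
  move=> z Uz; have fz := f_gt0 Uz.
  apply: mulf_neq0; first exact: lt0r_neq0 fz.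
  by apply: lt0r_neq0; rewrite sqrtr_gt0.
have gc : 0 < g c by rewrite /g mulVf.
have /nbhs_ballP[r1 /= r10 Hr1] : nbhs c (ball c r `&` [set y | 0 < g y]).
  apply: filterI; first exact: nbhsx_ballx.
  have cg := differentiable_continuous (smooth_on_diff sg Uc).
  exact: (cvgr_gt (g c) cg _ gc).
have r1r : ball c r1 `<=` ball c r by move=> y /Hr1[].
have r1U := subset_trans r1r cU.
pose P (x : R) : R := m c - lam * x ^+ 2.
have cP : continuous P.
  move=> x; apply: cvgB; first exact: cvg_cst.
  by apply: cvgM; [exact: cvg_cst|exact: exprn_continuous].
have qP y : ball c r1 y -> q y ^+ 2 = P (h y).
  move=> cy; rewrite /P -(mc y (r1r y cy)).
  exact (esym (coordinate_t_algebra 0 (g y) (h y) lam (f_gt0 (r1U y cy))).2).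
have q0 y : ball c r1 y -> 0 < q y.
  move=> cy; have [_ gy] := Hr1 y cy; have fy := f_gt0 (r1U y cy).
  by rewrite divr_gt0// mulr_gt0// sqrtr_gt0.
have [r' [t [r'0 r'r st Dt]]] := first_integral_coordinate (ball_open c r1)
  (ballxx c r10) (smooth_on_sub r1U sh) (smooth_on_sub r1U sq) q0 cP qP.
exists r', t; split=> //; first exact: subset_trans r'r r1r.
move=> y cy; have Uy := r1U y (r'r y cy); have gy : 0 < g y by have [_] := Hr1 y (r'r y cy).
have fy := f_gt0 Uy.
have E1 := Dt y (e1 y) cy; have E2 := Dt y (e2 y) cy.
split.
  refine (etrans E1 _); refine (etrans (congr1 (fun a => a / q y) (D1h y Uy)) _); exact: mul0r.
refine (etrans E2 _); refine (etrans (congr1 (fun a => a / q y) (D2h y Uy)) _); rewrite /q; move: gy fy.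
generalize (f y) (g y) => a b b0 a0.
by rewrite invf_div mulrC divfK// gt_eqF.
Qed.


Lemma smooth_weight : smooth_on U (fun z : 'rV[R]_2 => f z * Num.sqrt (f z)).
Proof. exact (smooth_onM oU sf0 (smooth_on_sqrt oU sf0 f_gt0)). Qed.

Lemma weight_gt0 y : U y -> 0 < f y * Num.sqrt (f y).
Proof. by move=> Uy; have fy := f_gt0 Uy; rewrite mulr_gt0// sqrtr_gt0. Qed.

(** In the coordinates [(s, t)] the fields [E1] and [f^(-3/2) E2] become the coordinate
    fields; the inverse function theorem is applied to this dual frame. *)
Lemma adapted_coordinates c : U c ->
  exists (V : set 'rV[R]_2) (Phi G : 'rV[R]_2 -> 'rV[R]_2) (r : R),
  [/\ [/\ 0 < r, open V, V `<=` U & V c],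
      [/\ smooth_on V Phi, smooth_on (ball (Phi c) r) G,
        forall y, V y -> ball (Phi c) r (Phi y) /\ G (Phi y) = y &
        forall z, ball (Phi c) r z -> V (G z) /\ Phi (G z) = z] &
      forall y, V y -> 'D_(e1 y) Phi y = bas R 0 /\
        'D_(e2 y) Phi y = (f y * Num.sqrt (f y)) *: bas R 1].
Proof.
move=> Uc; have /nbhs_ballP[r0 /= r00 cU] : nbhs c U := near_open oU Uc.
have [r1 [s [r10 r1U ss Ds]]] := coordinate_s Uc r00 cU.
have [r2 [t [r20 r2U st Dt]]] := coordinate_t Uc r00 cU.
pose r3 := Num.min r1 r2.
have r30 : 0 < r3 by rewrite lt_min r10.
have r31 : ball c r3 `<=` ball c r1 by apply: le_ball; by rewrite ge_min lexx.
have r32 : ball c r3 `<=` ball c r2 by apply: le_ball; by rewrite ge_min lexx orbT.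
have r3r : ball c r3 `<=` ball c r0 by move=> y /r31/r1U.
have r3U : ball c r3 `<=` U by move=> y /r3r/cU.
pose h (i : 'I_2) := if i == 0 then s else t.
pose Phi := fun z : 'rV[R]_2 => \row_(i < 2) h i z.
have PhiE i : (fun z => Phi z 0 i) = h i by apply/funext => z; rewrite mxE.
have oB : open (ball c r3) := ball_open c r3.
have sPhi : smooth_on (ball c r3) Phi.
  apply/(smooth_on_rowP Phi oB) => i; rewrite PhiE /h.
  by case: ifP => _; [exact: smooth_on_sub r31 ss|exact: smooth_on_sub r32 st].
have DPhi y v : ball c r3 y -> 'D_v Phi y = 'D_v s y *: bas R 0 + 'D_v t y *: bas R 1.
  move=> cy; have dP := smooth_on_diff sPhi cy.
  apply/rowP => i; rewrite (derive_coord v i dP) PhiE.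
  by case: (ord2 i) => ->; rewrite !mxE /=; rewrite ?mulr1 ?mulr0 ?addr0 ?add0r.
pose w := fun z : 'rV[R]_2 => f z * Num.sqrt (f z).
have w0 y : U y -> w y != 0 by move=> /weight_gt0 /lt0r_neq0.
have sw : smooth_on U (fun z : 'rV[R]_2 => (w z)^-1) := smooth_onV oU smooth_weight w0.
have D1 y : ball c r3 y -> 'D_(e1 y) Phi y = bas R 0.
  move=> cy; have [E1 _] := Ds y (r31 y cy); have [E2 _] := Dt y (r32 y cy).
  refine (etrans (DPhi y (e1 y) cy) _).
  by rewrite -> E1, E2; rewrite scale1r scale0r addr0.
have D2 y : ball c r3 y -> 'D_(e2 y) Phi y = w y *: bas R 1.
  move=> cy; have [_ E1] := Ds y (r31 y cy); have [_ E2] := Dt y (r32 y cy).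
  refine (etrans (DPhi y (e2 y) cy) _).
  by rewrite -> E1, E2; rewrite scale0r add0r.
pose Z (i : 'I_2) (z : 'rV[R]_2) := if i == 0 then e1 z else (w z)^-1 *: e2 z.
have sZ i : smooth_on (ball c r3) (Z i).
  apply: (smooth_on_sub r3U); rewrite /Z; case: (i == 0); first exact: s1.
  exact (smooth_onZ oU sw s2).
have DZ i y : ball c r3 y -> 'D_(Z i y) Phi y = delta_mx 0 i.
  move=> cy; rewrite /Z; case: (ord2 i) => -> /=; first exact: D1.
  refine (etrans (derive_scalev _ _ (smooth_on_diff sPhi cy)) _).
  refine (etrans (congr1 (fun x => _ *: x) (D2 y cy)) _).
  by rewrite scalerA mulVf ?scale1r//; exact: w0 (r3U y cy).
have [V [G [r rgt0 [[oV VB Vc] VG GV sG]]]] := inverse_function oB (ballxx c r30) sPhi sZ DZ.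
exists V, Phi, G, r; split.
- by split=> // y /VB/r3U.
- by split=> //; exact: smooth_on_sub VB sPhi.
- by move=> y /VB cy; split; [exact: D1|exact: D2].
Qed.

End IntegrableCase.



(** * The three local forms *)

Section LocalForms.
Context {R : realType}.
Implicit Types (eps C D : R).

Lemma powR_three_halves (x : R) : 0 < x -> x `^ (3 / 2) = x * Num.sqrt x.
Proof.
move=> x0; rewrite (_ : 3 / 2 = 1 + 2^-1); last by field.
rewrite powRD ?powRr1 ?powR12_sqrt ?ltW//.
by rewrite gt_eqF ?implybT.
Qed.

Lemma sixth_root (d : R) : 0 < d -> exists2 c : R, 0 < c & c ^- 6 = d.
Proof.
move=> d0; exists ((d `^ 6^-1)^-1); first by rewrite invr_gt0 powR_gt0.
by rewrite exprVn invrK -powR_mulrn ?powR_ge0// -powRrM mulVf ?powRr1// ?ltW.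
Qed.

(** A positive quantity is recovered from its square, here in the factored form of the
    expression for [alpha]. *)
Lemma sqrt_form (c x l X : R) : 0 < c -> 0 < x -> 0 < l -> l ^+ 2 = c^-1 * x ^+ 3 * X ->
  l = c `^ (- (1 / 2)) * x `^ (3 / 2) * Num.sqrt X.
Proof.
move=> c0 x0 l0 E; rewrite powR_three_halves// powRN mul1r powR12_sqrt ?ltW//.
have X0 : 0 < X.
  have : 0 < c^-1 * x ^+ 3 * X by rewrite -E exprn_gt0.
  by rewrite pmulr_rgt0// mulr_gt0 ?invr_gt0 ?exprn_gt0.
have sc : 0 < Num.sqrt c by rewrite sqrtr_gt0.
have sx : 0 < Num.sqrt x by rewrite sqrtr_gt0.
have sX : 0 < Num.sqrt X by rewrite sqrtr_gt0.
apply/eqP; rewrite -(eqrXn2 (n := 2))//; [|exact: ltW|]; last first.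
  by rewrite ltW// !mulr_gt0// invr_gt0.
by rewrite E !exprMn exprVn !sqr_sqrtr ?ltW//; apply/eqP; ring.
Qed.

Lemma b1_form (x x' k l b C : R) : 0 < x -> 0 < l -> k = C * x ^+ 2 ->
  b * (x * l) = x' * (k - 3 * x) -> b = x' * (C * x - 3) / l.
Proof.
move=> x0 l0 -> E; apply/eqP; rewrite eq_sym.
have -> : x' * (C * x - 3) / l = x' * (C * x ^+ 2 - 3 * x) / (x * l).
  by field; rewrite !gt_eqF.
by rewrite -E mulfK// mulf_neq0// gt_eqF.
Qed.

(** The sign of [D] decides between the three forms; [c1] is the inverse of the sixth root of
    [|D|], and [c2 = c1 C]. When [D <= 0], [C > 0] because [alpha^2] is positive. *)
Lemma local_forms eps C D (I : set R) (f K k2 al a2 b1 : R -> R) : I !=set0 ->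
  (forall s, I s -> [/\ 0 < f s, 0 < derive1 f s, 0 < al s,
      a2 s = 3 / 2 * (derive1 f s / f s) & k2 s = C * f s ^+ 2] /\
    [/\ al s ^+ 2 = 2 * C * f s ^+ 3 - C ^+ 2 * f s ^+ 4 + D * f s ^+ 6,
        K s = eps - D * f s ^+ 6,
        b1 s * (f s * al s) = derive1 f s * (k2 s - 3 * f s) &
        derive1n 2 f s * f s - 5 / 2 * derive1 f s ^+ 2 - 2 / 3 * eps * f s ^+ 2
          + 2 / 3 * D * f s ^+ 8 = 0]) ->
  [\/ caseA eps I f a2 b1 al k2 K, caseB eps I f a2 b1 al k2 K |
      caseC eps I f a2 b1 al k2 K].
Proof.
move=> [s0 Is0] H.
have C0 : D <= 0 -> 0 < C.
  move=> D0; have [[f0 _ l0 _ _] [E _ _ _]] := H s0 Is0.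
  have : 0 < al s0 ^+ 2 by rewrite exprn_gt0.
  rewrite E => {}E; rewrite ltNge; apply/negP => C0; move: E; apply/negP; rewrite -leNgt.
  have : C * f s0 ^+ 3 <= 0 by rewrite mulr_le0_ge0// ltW// exprn_gt0.
  have : 0 <= C ^+ 2 * f s0 ^+ 4 by rewrite mulr_ge0 ?sqr_ge0// ltW// exprn_gt0.
  have : D * f s0 ^+ 6 <= 0 by rewrite mulr_le0_ge0// ltW// exprn_gt0.
  lra.
have [D0|D0|D0] := ltgtP D 0.
- have [|c c0 cE] := @sixth_root (- D); first by rewrite oppr_gt0.
  have cn0 : c != 0 by rewrite gt_eqF.
  have DE : D = - c ^- 6 by rewrite cE opprK.
  apply: Or31; exists c, (c * C); split=> //; first by rewrite mulr_gt0// C0// ltW.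
  move=> s Is; have [[f0 f'0 l0 aE kE] [lE KE bE ode]] := H s Is.
  have CE : C = c^-1 * (c * C) by rewrite mulKf.
  have lF : al s = c `^ (- (1 / 2)) * f s `^ (3 / 2)
      * Num.sqrt (2 * (c * C) - c^-1 * (c * C) ^+ 2 * f s - c ^- 5 * f s ^+ 3).
    by apply: sqrt_form => //; rewrite lE DE; field.
  split; split=> //.
  + by rewrite -lF -CE; exact: b1_form kE bE.
  + by rewrite -CE.
  + by rewrite KE DE; ring.
  + by rewrite -ode DE; ring.
- apply: Or33; have [c c0 cE] := sixth_root D0.
  have cn0 : c != 0 by rewrite gt_eqF.
  exists c, (c * C); split=> // s Is; have [[f0 f'0 l0 aE kE] [lE KE bE ode]] := H s Is.
  have CE : C = c^-1 * (c * C) by rewrite mulKf.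
  have lF : al s = c `^ (- (1 / 2)) * f s `^ (3 / 2)
      * Num.sqrt (2 * (c * C) - c^-1 * (c * C) ^+ 2 * f s + c ^- 5 * f s ^+ 3).
    by apply: sqrt_form => //; rewrite lE -cE; field.
  split; split=> //.
  + by rewrite -lF -CE; exact: b1_form kE bE.
  + by rewrite -CE.
  + by rewrite KE cE.
  + by rewrite cE.
- have {}C0 : 0 < C by apply: C0; rewrite D0.
  apply: Or32; exists C; split=> // s Is.
  have [[f0 f'0 l0 aE kE] [lE KE bE ode]] := H s Is.
  have lF : al s = Num.sqrt C * f s `^ (3 / 2) * Num.sqrt (2 - C * f s).
    have E : C^-1 `^ (- (1 / 2)) = Num.sqrt C.
      by rewrite powRN mul1r powR12_sqrt ?invr_ge0 ?ltW// sqrtrV ?ltW// invrK.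
    rewrite -E; apply: sqrt_form => //; first by rewrite invr_gt0.
    by rewrite lE D0 invrK; ring.
  split; split=> //.
  + rewrite -lF (b1_form f0 l0 kE bE) -mulNr -mulrN opprB; reflexivity.
  + by rewrite KE D0 mul0r subr0.
  + by rewrite -[RHS]ode D0 mulr0 mul0r addr0.
Qed.

End LocalForms.

(** * Functions of the first coordinate *)

Section Profile.
Context {R : realType} (c : 'rV[R]_2) (r : R).
Implicit Types (h : 'rV[R]_2 -> R) (y : 'rV[R]_2) (x : R).
Local Notation B := (ball c r).
Local Notation J := ((fun y : 'rV[R]_2 => y 0 0) @` B).

(** The horizontal line through the centre: a function of the first coordinate alone is
    its restriction to this line. *)
Definition center_line x : 'rV[R]_2 := \row_i if i == 0 then x else c 0 1.

Lemma center_line_ball y : B y -> B (center_line (y 0 0)).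
Proof.
rewrite -ball_normE /=; apply: le_lt_trans.
rewrite row_norm_le//; apply/forallP => i; rewrite !mxE; case: (ord2 i) => -> /=.
  by have := row_coord_le (c - y) 0; rewrite !mxE.
by rewrite subrr normr0.
Qed.

Lemma center_line_dom x : J x -> B (center_line x).
Proof. by move=> [y By <-]; exact: center_line_ball. Qed.

Lemma smooth_center_line : smooth_on setT center_line.
Proof.
apply/smooth_on_rowP; first exact: openT.
move=> i; rewrite (_ : (fun x => _) = if i == 0 then idfun else (fun=> c 0 1)); last first.
  by apply/funext => x; rewrite mxE; case: ifP.
case: ifP => _; last exact: smooth_on_cst.
by apply: smooth_on_linear => x; exact: cvg_id.
Qed.

Lemma derive_center_line x : 'D_1 center_line x = bas R 0.
Proof.
have dl := smooth_on_diff smooth_center_line (I : setT x).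
apply/rowP => i; rewrite (derive_coord _ i dl).
rewrite (_ : (fun x => _) = if i == 0 then id else (fun=> c 0 1)); last first.
  by apply/funext => z; rewrite mxE; case: ifP.
by rewrite mxE; case: (ord2 i) => -> /=; [exact: derive_id|exact: derive_cst].
Qed.

Lemma open_profile : open J.
Proof.
have -> : J = center_line @^-1` B.
  apply/seteqP; split=> x /=; first exact: center_line_dom.
  by move=> Bx; exists (center_line x) => //; rewrite mxE.
apply: open_comp; last exact: ball_open.
move=> x _; apply: differentiable_continuous.
exact: smooth_on_diff smooth_center_line _ I.
Qed.

(** The vertical segment from a point to the central line stays in the square. *)
Lemma profile_eq h y : (forall z, B z -> differentiable h z /\ 'D_(bas R 1) h z = 0) ->
  B y -> h y = h (center_line (y 0 0)).
Proof.
move=> H By; apply: (eq_on_ball (center_line_ball By) By) => z /H[dz Dz]; split; first exact dz.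
have -> : y - center_line (y 0 0) = (y 0 1 - c 0 1) *: bas R 1.
  by apply/rowP => i; rewrite !mxE; case: (ord2 i) => -> /=; rewrite ?subrr ?mulr0 ?mulr1.
by rewrite derive_scalev//; rewrite -> Dz; rewrite scaler0.
Qed.

Lemma smooth_profile h : smooth_on B h -> smooth_on J (fun x => h (center_line x)).
Proof.
move=> sh n; apply: (smooth_upto_comp open_profile sh _ center_line_dom).
exact: smooth_on_sub smooth_center_line n.
Qed.

Lemma derive1_profile h x : differentiable h (center_line x) ->
  derive1 (fun x => h (center_line x)) x = 'D_(bas R 0) h (center_line x).
Proof.
move=> dh; rewrite derive1E.
refine (etrans (derive_comp (1 : R) (smooth_on_diff smooth_center_line (I : setT x)) dh) _).
by rewrite derive_center_line.
Qed.

End Profile.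

(** * The local form in an adapted chart *)

(** The equation of [f]: differentiate [f' = 2/3 a2 f] and use [a2' = a2^2 + K]. *)
Lemma profile_ode_algebra {R : realType} (f d dd a da k l e D : R) :
  d = 2 / 3 * a * f -> dd = 2 / 3 * (a * d + f * da) ->
  da = a ^+ 2 + e + 2 * f * k - k ^+ 2 - l ^+ 2 ->
  e + (2 * f - k) * k - l ^+ 2 = e - D * f ^+ 6 ->
  dd * f - 5 / 2 * d ^+ 2 - 2 / 3 * e * f ^+ 2 + 2 / 3 * D * f ^+ 8 = 0.
Proof.
move=> -> -> -> E.
have -> : a ^+ 2 + e + 2 * f * k - k ^+ 2 - l ^+ 2 = a ^+ 2 + (e - D * f ^+ 6).
  by rewrite -E; ring.
by field.
Qed.

Lemma weight_inv {R : realType} (x m : R) : 0 < x -> x * (x * m) = 1 ->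
  [/\ 0 < x ^- 2, m = x ^- 2 & (Num.sqrt (x ^- 2))^-1 = x].
Proof.
move=> x0 E; have xn0 : x != 0 by rewrite gt_eqF.
split; first by rewrite invr_gt0 exprn_gt0.
  apply: (mulfI xn0); apply: (mulfI xn0); rewrite E; field; exact: xn0.
by rewrite -exprVn sqrtr_sqr ger0_norm ?invr_ge0 ?ltW// invrK.
Qed.

Section AdaptedBall.
Context {R : realType} {eps : R} {c : 'rV[R]_2} {r : R} {psi : 'rV[R]_2 -> 'rV[R]_5}
  {e1 e2 : 'rV[R]_2 -> 'rV[R]_2} {e3 e4 : 'rV[R]_2 -> 'rV[R]_5}
  {k1 k2 al a1 a2 b1 : 'rV[R]_2 -> R}.
Local Notation B := (ball c r).
Context (S : adapted_surface eps B psi e1 e2 e3 e4 k1 k2 al a1 a2 b1).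
Local Notation f := (mean_curv eps psi).
Local Notation K := (gauss_curv eps psi).
Local Notation I := ((fun y : 'rV[R]_2 => y 0 0) @` B).
Context (al_gt0 : forall y : 'rV[R]_2, B y -> 0 < al y)
  (df_gt0 : forall y : 'rV[R]_2, B y -> 0 < 'D_(e1 y) f y)
  (a2E : forall y : 'rV[R]_2, B y -> a2 y = 3 / 2 * ('D_(e1 y) f y / f y)).
Context {W : 'rV[R]_2 -> R} (sW : smooth_on setT W)
  (dW : forall x, exists v, 'D_v W x <> 0)
  (WfK : forall y : 'rV[R]_2, B y -> W (\row_(i < 2) if i == 0 then f y else K y) = 0).
Context (r0 : 0 < r) (e1E : forall y : 'rV[R]_2, B y -> e1 y = bas R 0)
  (e2E : forall y : 'rV[R]_2, B y -> e2 y = (f y * Num.sqrt (f y)) *: bas R 1).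
Implicit Types (y v w u : 'rV[R]_2) (h : 'rV[R]_2 -> R).

Let f_gt0 y : B y -> 0 < f y := @mean_curv_gt0 _ _ _ _ _ _ _ _ _ _ _ _ _ _ S y.
Let sf := smooth_mean_curv S.
Let ode y (By : B y) := frame_ode S al_gt0 df_gt0 a2E sW dW WfK By.
Let D2f y (By : B y) : 'D_(e2 y) f y = 0 := derive2_mean_curv S df_gt0 a2E By.
Let D2K y (By : B y) := derive2_gauss_curv S df_gt0 a2E sW dW WfK By.
Let D2k y (By : B y) := derive2_k2 S al_gt0 df_gt0 a2E sW dW WfK By.
Let D2l y (By : B y) := derive2_al S al_gt0 df_gt0 a2E sW dW WfK By.
Let D2a y (By : B y) := derive2_a2 S al_gt0 df_gt0 a2E sW dW WfK By.

Let q := fun z : 'rV[R]_2 => 'D_(bas R 0) f z.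
Let sq : smooth_on B q := smooth_on_derive (bas R 0) sf.

Let w y := f y * Num.sqrt (f y).

Let w_gt0 y : B y -> 0 < w y := @weight_gt0 _ _ _ _ _ _ _ _ _ _ _ _ _ _ S y.

Let q_eq y : B y -> 'D_(e1 y) f y = q y.
Proof. by move=> By; rewrite e1E. Qed.

Let D2q y : B y -> 'D_(e2 y) q y = 0.
Proof.
move=> By; refine (etrans (esym (eq_on_derive _ (as_open S) By q_eq)) _).
exact (derive2_derive1 S al_gt0 df_gt0 a2E sW dW WfK By).
Qed.

Lemma profile_of h y : smooth_on B h -> (forall y : 'rV[R]_2, B y -> 'D_(e2 y) h y = 0) -> B y ->
  h y = h (center_line c (y 0 0)).
Proof.
move=> sh D2h By; apply: (profile_eq _ By) => z Bz; have dh := smooth_on_diff sh Bz.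
split; first exact dh.
have := D2h z Bz; rewrite -> (e2E Bz), (derive_scalev _ _ dh).
move/eqP; rewrite [_ *: _]/(_ * _) mulf_eq0 => /orP[|/eqP//].
by rewrite gt_eqF// w_gt0.
Qed.

Lemma profile_derive1 x : I x -> derive1 (fun s : R => f (center_line c s)) x = q (center_line c x).
Proof. by move=> Ix; apply: derive1_profile; exact (smooth_on_diff sf (center_line_dom Ix)). Qed.

Lemma profile_derive2 x : I x ->
  derive1n 2 (fun s : R => f (center_line c s)) x = 'D_(bas R 0) q (center_line c x).
Proof.
move=> Ix; refine (etrans (derive1E (derive1 (fun s : R => f (center_line c s))) x) _).
refine (etrans (eq_on_derive (1 : R) (@open_profile R c r) Ix profile_derive1) _).
refine (etrans (esym (derive1E (fun s : R => q (center_line c s)) x)) _).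
by apply: derive1_profile; exact (smooth_on_diff sq (center_line_dom Ix)).
Qed.

Let P h := fun x : R => h (center_line c x).

(** [E2] is a positive multiple of the second coordinate field, hence functions constant along
    [E2] depend on the first coordinate only. This applies to [f], [K], [k2], [alpha], [a2] and
    [E1(f)], and [k1], [b1] are expressed through them. *)
Lemma adapted_profiles :
  [/\ forall y, B y ->
      [/\ [/\ 0 < w (center_line c (y 0 0)) ^- 2, metric eps psi y (bas R 0) (bas R 0) = 1,
            metric eps psi y (bas R 0) (bas R 1) = 0 &
            metric eps psi y (bas R 1) (bas R 1) = w (center_line c (y 0 0)) ^- 2],
          e1 y = bas R 0 /\
          e2 y = (Num.sqrt (w (center_line c (y 0 0)) ^- 2))^-1 *: bas R 1,
          f y = P f (y 0 0) /\ K y = P K (y 0 0),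
          [/\ k1 y = P k1 (y 0 0), k2 y = P k2 (y 0 0) & al y = P al (y 0 0)] &
          a2 y = P a2 (y 0 0) /\ b1 y = P b1 (y 0 0)],
    smooth_on I (P f) &
    [\/ caseA eps I (P f) (P a2) (P b1) (P al) (P k2) (P K),
        caseB eps I (P f) (P a2) (P b1) (P al) (P k2) (P K) |
        caseC eps I (P f) (P a2) (P b1) (P al) (P k2) (P K)]].
Proof.
have pf y (By : B y) := profile_of sf D2f By.
have pK y (By : B y) := profile_of (smooth_gauss_curv S) D2K By.
have pk y (By : B y) := profile_of (smooth_k2 S) D2k By.
have pl y (By : B y) := profile_of (smooth_al S) D2l By.
have pa y (By : B y) := profile_of (smooth_a2 S) D2a By.
have pq y (By : B y) := profile_of sq D2q By.
have bE y : B y -> b1 y = q y * (k2 y - 3 * f y) / (f y * al y).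
  move=> By; have [_ _ _ _ E] := ode By.
  have n0 : f y * al y != 0 by apply: lt0r_neq0; exact (mulr_gt0 (f_gt0 By) (al_gt0 By)).
  rewrite -(q_eq By) -[in RHS]E; exact (esym (mulfK n0 _)).
split.
- move=> y By; have Bl := center_line_ball By.
  have pw : w (center_line c (y 0 0)) = w y by rewrite /w -pf.
  have [m1 m2 m3] := as_metric S By.
  have dp := smooth_on_diff (as_smooth S) By.
  rewrite (e1E By) in m1 m3; rewrite (e2E By) in m2 m3.
  have ES : 'D_(w y *: bas R 1) psi y = w y *: 'D_(bas R 1) psi y.
    exact (derive_scalev _ _ dp).
  have m2' : w y * (w y * metric eps psi y (bas R 1) (bas R 1)) = 1.
    refine (etrans _ m2); refine (etrans _ (esym (congr2 (sform eps) ES ES))).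
    rewrite sformZl sformZr; reflexivity.
  have m3' : metric eps psi y (bas R 0) (bas R 1) = 0.
    apply: (mulfI (lt0r_neq0 (w_gt0 By))); rewrite mulr0.
    refine (etrans _ m3); refine (etrans _ (esym (congr1 (sform eps _) ES))).
    rewrite sformZr; reflexivity.
  have [g1 g2 g3] := weight_inv (w_gt0 By) m2'.
  split.
  + by rewrite pw; split; [exact g1|exact m1|exact m3'|exact g2].
  + by rewrite pw g3; split; [exact (e1E By)|exact (e2E By)].
  + by split; [exact (pf y By)|exact (pK y By)].
  + split; [|exact (pk y By)|exact (pl y By)].
    by rewrite /P (k1E S By) (k1E S Bl) -(pf y By) -(pk y By).
  + split; first exact (pa y By).
    by rewrite /P (bE _ By) (bE _ Bl) -(pf y By) -(pk y By) -(pl y By) -(pq y By).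
- exact: smooth_profile sf.
- have Bc : B c := ballxx c r0.
  have [C [D [lam inv]]] := frame_invariants S al_gt0 df_gt0 a2E sW dW WfK Bc r0 (@subset_refl _ B).
  apply: (@local_forms R eps C D); first by exists (c 0 0), c.
  move=> x Ix; have Bx := center_line_dom Ix.
  have [T1 T2 T3 T4 T5] := ode Bx; have [J1 J2 _ _ J5] := inv _ Bx.
  have a2x := a2E Bx; have q0 := df_gt0 Bx.
  have d1 := profile_derive1 Ix; have d2 := profile_derive2 Ix.
  rewrite (q_eq Bx) in T1 T5 a2x q0.
  have E2 : 'D_(bas R 0) q (center_line c x) = 2 / 3 * (a2 (center_line c x) * q (center_line c x)
      + f (center_line c x) * 'D_(e1 (center_line c x)) a2 (center_line c x)).
    have da := smooth_on_diff (smooth_a2 S) Bx; have df := smooth_on_diff sf Bx.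
    have qE z : B z -> q z = 2 / 3 * (a2 z * f z).
      move=> Bz; have [E _ _ _ _] := ode Bz.
      exact (etrans (esym (q_eq Bz)) (etrans E (esym (mulrA _ _ _)))).
    refine (etrans (eq_on_derive _ (as_open S) Bx qE) _).
    refine (etrans (derive_cstM (2 / 3) _ (differentiableM da df)) _).
    refine (etrans (congr1 ( *%R _) (deriveM_fun _ da df)) _).
    by rewrite (e1E Bx).
  split; split.
  + exact (f_gt0 Bx).
  + by rewrite d1.
  + exact (al_gt0 Bx).
  + by rewrite d1.
  + exact J1.
  + exact J2.
  + exact J5.
  + by rewrite d1.
  + rewrite d1 d2; refine (profile_ode_algebra T1 E2 T4 _).
    rewrite <- (k1E S Bx); rewrite <- J5; exact (esym (gauss_curvE S Bx)).
Qed.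

End AdaptedBall.

(** * Charts of the surface *)

Section Charts.
Context {R : realType} {M : surface R}.
Implicit Types (c d : chart R M) (p q : M) (y z : 'rV[R]_2).

Lemma cimg_cdom c y : cimg c y -> cdom c (cinv c y) /\ cmap c (cinv c y) = y.
Proof. by move=> [p cp <-]; rewrite cmapK. Qed.

Lemma cdom_cimg c p : cdom c p -> cimg c (cmap c p).
Proof. by exists p. Qed.

(** The chart being a homeomorphism onto its image. *)
Lemma open_chart_image c (O : set M) : open O -> open (cmap c @` (cdom c `&` O)).
Proof.
move=> oO; rewrite openE => y [p [cp Op] <-].
have nO : nbhs p O by exact: open_nbhs_nbhs.
have n1 : \forall z \near cmap c p, O (cinv c z).
  by apply: (cinv_continuous cp); rewrite cmapK.
have n2 : \forall z \near cmap c p, cimg c z.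
  by apply: open_nbhs_nbhs; split; [exact: cimg_open|exact: cdom_cimg].
apply: filterS2 n1 n2 => z Oz /cimg_cdom[dz Ez].
by exists (cinv c z).
Qed.

(** A diffeomorphism [Phi] of a part of the image of [c] onto a ball transforms [c] into a
    chart compatible with the whole atlas, hence in the atlas by maximality. *)
Lemma refine_chart c (V : set 'rV[R]_2) (Phi G : 'rV[R]_2 -> 'rV[R]_2) z0 r :
  atlas c -> open V -> V `<=` cimg c -> smooth_on V Phi -> smooth_on (ball z0 r) G ->
  (forall y, V y -> ball z0 r (Phi y) /\ G (Phi y) = y) ->
  (forall z, ball z0 r z -> V (G z) /\ Phi (G z) = z) ->
  exists d, [/\ atlas d, cdom d = cdom c `&` cmap c @^-1` V, cimg d = ball z0 r,
    cmap d = (fun p => Phi (cmap c p)) & cinv d = (fun z => cinv c (G z))].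
Proof.
move=> ac oV Vc sPhi sG VG GV.
pose D : set M := cdom c `&` cmap c @^-1` V.
pose m (p : M) := Phi (cmap c p); pose iv z := cinv c (G z).
have oD : open D.
  rewrite openE => p [cp Vp]; apply: filterI.
    by apply: open_nbhs_nbhs; split=> //; exact: cdom_open.
  by apply: (cmap_continuous cp); apply: open_nbhs_nbhs.
have mK p : D p -> iv (m p) = p.
  by move=> [cp Vp]; rewrite /iv /m (VG _ Vp).2 cmapK.
have mB : m @` D = ball z0 r.
  apply/seteqP; split=> [_ [p [cp Vp] <-]|z Bz]; first exact: (VG _ Vp).1.
  have [Vz Ez] := GV z Bz; have [dz Gz] := cimg_cdom (Vc _ Vz).
  exists (cinv c (G z)); last by rewrite /m Gz.
  by split=> //=; rewrite Gz.
have mc p : D p -> {for p, continuous m}.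
  move=> [cp Vp]; apply: (@continuous_comp _ _ _ (cmap c) Phi).
    exact: cmap_continuous.
  by apply: differentiable_continuous; exact: smooth_on_diff sPhi _ Vp.
have ic p : D p -> {for m p, continuous iv}.
  move=> [cp Vp]; have [Bp Gp] := VG _ Vp.
  apply: (@continuous_comp _ _ _ G (cinv c)).
    by apply: differentiable_continuous; exact: smooth_on_diff sG _ Bp.
  by rewrite /m Gp; exact: cinv_continuous.
have oI : open (m @` D) by rewrite mB; exact: ball_open.
pose d := @Chart R M D m iv oD oI mK mc ic.
exists d; split=> //; apply: atlas_maximal => d' ad'.
have [c1 c2] := atlas_compatible ac ad'.
have sub p : cdom d p -> cdom c p by case.
split.
- have oO : open (cmap d @` (cdom d `&` cdom d')) by apply: open_chart_image; exact: cdom_open.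
  have oO' : open (cmap c @` (cdom c `&` cdom d')) by apply: open_chart_image; exact: cdom_open.
  apply: (smooth_on_comp oO oO' c1).
    apply: smooth_on_sub sG => _ [p [Dp _] <-]; rewrite -mB.
    by exists p.
  move=> _ [p [[cp Vp] d'p] <-]; exists p; first by split.
  by rewrite /= /m (VG _ Vp).2.
- have oO : open (cmap d' @` (cdom d `&` cdom d')).
    by rewrite setIC; apply: open_chart_image; exact: cdom_open.
  have c2' : smooth_on (cmap d' @` (cdom d `&` cdom d')) (cmap c \o cinv d').
    apply: smooth_on_sub c2 => _ [p [[cp Vp] d'p] <-]; by exists p.
  apply: (smooth_on_comp oO oV sPhi c2').
  by move=> _ [p [[cp Vp] d'p] <-] /=; rewrite cmapK.
Qed.

End Charts.

Section AdaptedSurface.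
Context {R : realType} {eps : R} {M : surface R} {phi : M -> 'rV[R]_5} {F : frame M}.
Context (phi_immersion : immersion eps phi)
    (phi_biconservative : nonCMC_biconservative eps phi)
    (F_adapted : adapted_frame eps phi F)
    (F_labelling : frame_labelling F).
Implicit Types (c d : chart R M) (p q : M) (y z : 'rV[R]_2).

Lemma chart_adapted c : atlas c ->
  adapted_surface eps (cimg c) (phi \o cinv c) (E1 F c) (E2 F c)
    (E3 F \o cinv c) (E4 F \o cinv c) (k1 F \o cinv c) (k2 F \o cinv c)
    (alpha F \o cinv c) (a1 F \o cinv c) (a2 F \o cinv c) (b1 F \o cinv c).
Proof.
move=> ac; have [phiS phis _] := phi_immersion; have [bi nc] := phi_biconservative.
have [[s4 n4] fr] := F_adapted.
split.
- exact: cimg_open.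
- exact: phis.
- by move=> y _; exact: phiS.
- exact: vcomp_smooth.
- exact: vcomp_smooth.
- exact: s4.
- by move=> y cy; have [m _ _ _ _] := fr c ac y cy; exact m.
- by move=> y cy; have [_ [m _ _] _ _ _] := fr c ac y cy; exact m.
- by move=> y cy; exact (n4 c ac y cy).
- by move=> y cy; have [_ [_ m m'] _ _ _] := fr c ac y cy; split; [exact m|exact m'].
- by move=> y cy; have [_ _ m _ _] := fr c ac y cy; exact m.
- by move=> y cy; have [_ _ _ m _] := fr c ac y cy; exact m.
- move=> y cy; have [_ _ _ _ [m m']] := fr c ac y cy; split; first exact m.
  have [_ b20] := F_labelling (cinv c y); rewrite -[LHS]b20; exact m'.
- by move=> y cy; exact (bi c ac y cy).
- by move=> y cy; have [_ _ m] := nc c ac y cy; exact m.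
Qed.

Lemma mean_curv_change c d p : atlas c -> atlas d -> cdom c p -> cdom d p ->
  mean_curv eps (phi \o cinv c) (cmap c p) = mean_curv eps (phi \o cinv d) (cmap d p).
Proof.
move=> ac ad cp dp.
have E1 := mean_curvE (chart_adapted ac) (cdom_cimg cp).
have E2 := mean_curvE (chart_adapted ad) (cdom_cimg dp).
rewrite /= in E1 E2; rewrite (cmapK cp) in E1; rewrite (cmapK dp) in E2.
exact (etrans E1 (esym E2)).
Qed.

End AdaptedSurface.

(** * Local forms and the covariant derivative of [E2] *)

Section LocalModel.
Context {R : realType} {eps : R} {M : surface R} {phi : M -> 'rV[R]_5} {F : frame M}.
Context (phi_immersion : immersion eps phi)
    (phi_biconservative : nonCMC_biconservative eps phi)
    (F_adapted : adapted_frame eps phi F)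
    (F_labelling : frame_labelling F).
Implicit Types (c d : chart R M) (p q : M) (y z : 'rV[R]_2).

Let S c (ac : atlas c) :=
  chart_adapted phi_immersion phi_biconservative F_adapted F_labelling ac.

(** The chain rule for the change of charts, which also governs the components of [E1]. *)
Lemma derive_mean_curv_change c d p : atlas c -> atlas d -> cdom c p -> cdom d p ->
  'D_(E1 F c (cmap c p)) (mean_curv eps (phi \o cinv c)) (cmap c p)
  = 'D_(E1 F d (cmap d p)) (mean_curv eps (phi \o cinv d)) (cmap d p).
Proof.
move=> ac ad cp dp.
have oO : open (cmap c @` (cdom c `&` cdom d)) by apply: open_chart_image; exact: cdom_open.
have Op : (cmap c @` (cdom c `&` cdom d)) (cmap c p) by exists p.
have [c1 _] := atlas_compatible ac ad.
have dh := smooth_on_diff c1 Op.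
have dg := smooth_on_diff (smooth_mean_curv (S ad)) (cdom_cimg dp).
have hp : (cmap d \o cinv c) (cmap c p) = cmap d p by rewrite /= cmapK.
have E z : (cmap c @` (cdom c `&` cdom d)) z -> mean_curv eps (phi \o cinv c) z
    = mean_curv eps (phi \o cinv d) ((cmap d \o cinv c) z).
  move=> [q [cq dq] <-]; rewrite /= (cmapK cq).
  exact (mean_curv_change phi_immersion phi_biconservative F_adapted F_labelling ac ad cq dq).
refine (etrans (eq_on_derive _ oO Op E) _).
rewrite -hp in dg; refine (etrans (derive_comp _ dh dg) _).
refine (etrans (congr1 (fun v => 'D_v _ _) (vcomp_change (E1 F) ac ad cp dp)) _).
by rewrite hp.
Qed.

Lemma frame_a2E c y (l : R) : atlas c -> cimg c y ->
  nabla eps (phi \o cinv c) (E2 F c y) (E2 F c) y = l *: E1 F c y <-> a2 F (cinv c y) = l.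
Proof.
move=> ac cy; have [_ ->] := as_nabla (S ac) cy; split=> [E|<-//].
have [m1 _ _] := as_metric (S ac) cy.
have E10 : E1 F c y != 0.
  apply/eqP => E0; move: m1; rewrite E0 /metric derive0 sform0l => /esym/eqP.
  by rewrite oner_eq0.
have : (a2 F (cinv c y) - l) *: E1 F c y = 0.
  by rewrite scalerBl -E subrr.
by move/eqP; rewrite scaler_eq0 (negbTE E10) orbF subr_eq0 => /eqP.
Qed.

Lemma local_forms_derive (I : set R) (f K k2 al a2 b1 : R -> R) s : I s ->
  [\/ caseA eps I f a2 b1 al k2 K, caseB eps I f a2 b1 al k2 K |
      caseC eps I f a2 b1 al k2 K] -> a2 s = 3 / 2 * (derive1 f s / f s).
Proof.
by move=> Is [[? [? [_ _ H]]]|[? [_ H]]|[? [? [_ H]]]]; have [[]] := H s Is.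
Qed.

(** The chart [d] of the local form can be exchanged for an arbitrary chart [c]: [f] and
    [E1(f)] are the same in both, and [E1] is the first coordinate field of [d]. *)
Lemma nabla_of_local_form c y d (g22 f K fk1 fk2 falpha fa2 fb1 : R -> R) :
  atlas c -> cimg c y -> atlas d -> cdom d (cinv c y) ->
  adapted_chart eps phi F d g22 f K fk1 fk2 falpha fa2 fb1 ->
  let I := (fun y : 'rV[R]_2 => y 0 0) @` cimg d in
  smooth_on I f -> (forall s, I s -> fa2 s = 3 / 2 * (derive1 f s / f s)) ->
  a2 F (cinv c y) = 3 / 2 * ('D_(E1 F c y) (mean_curv eps (phi \o cinv c)) y
                             / mean_curv eps (phi \o cinv c) y).
Proof.
move=> ac cy ad dp A I sf H.
have [cp Ey] := cimg_cdom cy; set p := cinv c y in cp dp Ey *.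
have dz := cdom_cimg dp; set z := cmap d p in dz.
have Is : I (z 0 0) by exists z.
have [_ [E1z _] [fz _] _ [a2z _]] := A z dz.
have zp : cinv d z = p by exact: cmapK.
rewrite zp in a2z; rewrite a2z (H _ Is).
have fy : mean_curv eps (phi \o cinv c) y = f (z 0 0).
  rewrite -fz -Ey.
  exact (mean_curv_change phi_immersion phi_biconservative F_adapted F_labelling ac ad cp dp).
have Dfy : 'D_(E1 F c y) (mean_curv eps (phi \o cinv c)) y = derive1 f (z 0 0).
  rewrite -Ey; refine (etrans (derive_mean_curv_change ac ad cp dp) _).
  have fE x : cimg d x -> mean_curv eps (phi \o cinv d) x = f (x 0 0).
    by move=> dx; have [_ _ [E _] _ _] := A x dx; exact E.
  refine (etrans (eq_on_derive _ (cimg_open (c:=d)) dz fE) _).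
  have dc : differentiable (fun x : 'rV[R]_2 => x 0 0) z by exact: differentiable_coord.
  refine (etrans (derive_comp _ dc (smooth_on_diff sf Is)) _).
  rewrite derive1E E1z; apply: (congr1 (fun v => 'D_v f (z 0 0))).
  rewrite -(@derive_coord _ _ _ id)// derive_id; exact: mxE.
by rewrite fy Dfy.
Qed.

Context (al_gt0 : forall p, 0 < alpha F p)
  (df_gt0 : everywhere (fun c y =>
     0 < 'D_(E1 F c y) (mean_curv eps (phi \o cinv c)) y))
  (phi_W : W_surface eps phi)
  (a2E : everywhere (fun c y => a2 F (cinv c y)
     = 3 / 2 * ('D_(E1 F c y) (mean_curv eps (phi \o cinv c)) y
                / mean_curv eps (phi \o cinv c) y))).

(** The chart [(s, t)]; in it [E1] is the first coordinate field and [E2] is [f^(3/2)] times the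
    second one, because vector fields transform by the derivative of [Phi]. *)
Lemma local_form_chart p : exists2 d, atlas d /\ cdom d p &
  exists g22 f K fk1 fk2 falpha fa2 fb1 : R -> R,
    let I := (fun y : 'rV[R]_2 => y 0 0) @` cimg d in
    [/\ adapted_chart eps phi F d g22 f K fk1 fk2 falpha fa2 fb1,
        smooth_on I f &
        [\/ caseA eps I f fa2 fb1 falpha fk2 K,
            caseB eps I f fa2 fb1 falpha fk2 K |
            caseC eps I f fa2 fb1 falpha fk2 K]].
Proof.
have [W [sW dW WfK]] := phi_W.
have [c ac cp] := atlas_cover p.
have Uy := cdom_cimg cp.
have [V [Phi [G [r [[r0 oV VU Vc] [sPhi sG VG GV] DPhi]]]]] :=
  adapted_coordinates (S ac) (fun y _ => al_gt0 (cinv c y)) (df_gt0 ac) (a2E ac) sW dW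
    (WfK c ac) Uy.
have [d [ad dd di dm dv]] := refine_chart ac oV VU sPhi sG VG GV.
have dp : cdom d p by rewrite dd.
exists d => //.
have move z (Bz : ball (Phi (cmap c p)) r z) (E : vfield M) :
    E d z = 'D_(E c (G z)) Phi (G z).
  have [Vz Ez] := GV z Bz; have [cz cGz] := cimg_cdom (VU _ Vz).
  set q := cinv c (G z) in cz cGz.
  have dq : cdom d q by rewrite dd; split=> //=; rewrite cGz.
  have mq : cmap d q = z by rewrite dm cGz.
  have := vcomp_change E ac ad cz dq; rewrite mq cGz => <-.
  apply: (eq_on_derive _ oV Vz) => y Vy; rewrite /= dm.
  by have [_ ->] := cimg_cdom (VU _ Vy).
have e1E z : ball (Phi (cmap c p)) r z -> E1 F d z = bas R 0.
  by move=> Bz; rewrite (move z Bz); have [E _] := DPhi _ (GV z Bz).1; exact E.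
have e2E z : ball (Phi (cmap c p)) r z -> E2 F d z
    = (mean_curv eps (phi \o cinv d) z * Num.sqrt (mean_curv eps (phi \o cinv d) z)) *: bas R 1.
  move=> Bz; have [Vz Ez] := GV z Bz; have [cz cGz] := cimg_cdom (VU _ Vz).
  have dq : cdom d (cinv c (G z)) by rewrite dd; split=> //=; rewrite cGz.
  have Em := mean_curv_change phi_immersion phi_biconservative F_adapted F_labelling ac ad cz dq.
  have mq : cmap d (cinv c (G z)) = z by rewrite dm cGz.
  rewrite cGz mq in Em; rewrite (move z Bz) -Em.
  by have [_ E] := DPhi _ Vz; exact E.
have Sd := S ad; rewrite di in Sd.
have dfd := df_gt0 ad; have a2d := a2E ad; have Wd := WfK d ad.
rewrite di in dfd a2d Wd.
have [A sf L] := adapted_profiles Sd (fun y _ => al_gt0 (cinv d y)) dfd a2d sW dW Wd r0 e1E e2E.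
pose w x := mean_curv eps (phi \o cinv d) (center_line (Phi (cmap c p)) x).
exists (fun x => (w x * Num.sqrt (w x)) ^- 2).
do 2 eexists; exists (fun x => k1 F (cinv d (center_line (Phi (cmap c p)) x))).
do 4 eexists; rewrite /= di; split; [|exact sf|exact L].
rewrite /adapted_chart di => y By /=; exact (A y By).
Qed.

End LocalModel.

Theorem proposition3p19 (R : realType) (eps : R) (M : surface R)
    (phi : M -> 'rV[R]_5) (F : frame M)
    (phi_immersion : immersion eps phi)
    (phi_biconservative : nonCMC_biconservative eps phi)
    (phi_W : W_surface eps phi)
    (phi_flat : flat_normal_bundle eps phi)
    (F_adapted : adapted_frame eps phi F)
    (F_labelling : frame_labelling F)
    (F_signs : frame_signs eps phi F)
    (fK_neq0 : everywhere (fun (c : chart R M) y =>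
       3 * mean_curv eps (phi \o cinv c) y ^+ 2
       + gauss_curv eps (phi \o cinv c) y - eps <> 0))
    (nablaE3_neq0 : everywhere (fun (c : chart R M) y =>
       exists v, normal_nabla eps (phi \o cinv c) v (E3 F \o cinv c) y <> 0))
    (A4_neq0 : everywhere (fun (c : chart R M) y =>
       exists v, shape eps (phi \o cinv c) (E4 F (cinv c y)) y v <> 0))
    (nablaE2E2_neq0 : everywhere (fun (c : chart R M) y =>
       nabla eps (phi \o cinv c) (E2 F c y) (E2 F c) y <> 0)) :
  everywhere (fun (c : chart R M) y =>
    let f := mean_curv eps (phi \o cinv c) in
    nabla eps (phi \o cinv c) (E2 F c y) (E2 F c) y
    = (3 / 2 * ('D_(E1 F c y) f y / f y) : R) *: E1 F c y)
  <->
  (forall p : M, exists2 c : chart R M, atlas c /\ cdom c p &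
     exists g22 f K fk1 fk2 falpha fa2 fb1 : R -> R,
       let I := (fun y : 'rV[R]_2 => y 0 0) @` cimg c in
       [/\ adapted_chart eps phi F c g22 f K fk1 fk2 falpha fa2 fb1,
           smooth_on I f &
           [\/ caseA eps I f fa2 fb1 falpha fk2 K,
               caseB eps I f fa2 fb1 falpha fk2 K |
               caseC eps I f fa2 fb1 falpha fk2 K]]).
Proof.
have [al_gt0 df_gt0] := F_signs.
have a2E := frame_a2E phi_immersion phi_biconservative F_adapted F_labelling.
split=> [H p|H c ac y cy].
  apply: (local_form_chart phi_immersion phi_biconservative F_adapted F_labelling
    al_gt0 df_gt0 phi_W) => c ac y cy.
  exact ((a2E c y _ ac cy).1 (H c ac y cy)).
have [d [ad dp] [g22 [f [K [fk1 [fk2 [falpha [fa2 [fb1 [A sf L]]]]]]]]]] := H (cinv c y).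
apply: (a2E c y _ ac cy).2.
apply: (nabla_of_local_form phi_immersion phi_biconservative F_adapted F_labelling
  ac cy ad dp A sf) => s Is.
exact: local_forms_derive Is L.
Qed.
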